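(* Let $Z$ be a centered random vector on $\mathbb{R}^d$ and define the normalized sums $U_n=\frac{1}{\sqrt n}\sum_{k=1}^n Z_k$, where $Z_1,\dots,Z_n$ are independent copies of $Z$. Then the sequence $\{\delta_{\mathsf{LSI}}(U_n)\}_{n\ge1}$ is subadditive, i.e. $\delta_{\mathsf{LSI}}(U_{n+m})\le\delta_{\mathsf{LSI}}(U_n)+\delta_{\mathsf{LSI}}(U_m)$ for all $n,m\ge1$. Moreover, for all $n\ge1$, \[ D(U_n)\ge D(Z)-(n-1)\,\delta_{\mathsf{LSI}}(Z),\qquad \frac12 I(U_n)\ge \frac12 I(Z)-n\,\delta_{\mathsf{LSI}}(Z)+\delta_{\mathsf{LSI}}(U_n). \]
   Context: Let $\phi(x)=(2\pi)^{-d/2}e^{-|x|^2/2}$. For a random vector $X$ with density $f$, $D(X):=\int f\log\frac{f}{\phi}$ and $I(X):=\int f|\nabla\log\frac{f}{\phi}|^2$ (with $I(X)=\infty$ if the integral does not exist). The LSI deficit is $\delta_{\mathsf{LSI}}(X):=\frac12 I(X)-D(X)$ when $I(X)<\infty$ and $\delta_{\mathsf{LSI}}(X):=\infty$ when $I(X)=\infty$. *)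

(* Defs.v *)
From HB Require Import structures.
From mathcomp Require Import all_boot all_order all_algebra all_classical all_reals all_analysis.
Import numFieldNormedType.Exports.
Import Order.TTheory GRing.Theory Num.Theory.

Set Implicit Arguments.
Unset Strict Implicit.
Unset Printing Implicit Defensive.

Local Open Scope classical_set_scope.
Local Open Scope ring_scope.

Section LSIDefs.
Variables (R : realType) (d : nat).

Definition sqnorm (x : 'rV[R]_d) : R := \sum_(i < d) x ord0 i ^+ 2.

Definition rects : set (set 'rV[R]_d) :=
  [set A | exists B : 'I_d -> set R,
      (forall i, measurable (B i)) /\ A = [set x : 'rV[R]_d | forall i, B i (x ord0 i)]].

Definition Rd := g_sigma_algebraType rects.

Definition phi (x : 'rV[R]_d) : R :=
  (Num.sqrt (2 * pi))^-1 ^+ d * expR (- (sqnorm x / 2)).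

End LSIDefs.

(** Lebesgue integral on R^d of a nonnegative function, as the iterated
    one-dimensional Lebesgue integral (= product Lebesgue measure, by Tonelli). *)
Definition vcons (R : realType) (d : nat) (t : R) (y : 'rV[R]_d) : 'rV[R]_d.+1 :=
  \row_(i < d.+1) (if unlift ord0 i is Some j then y 0 j else t).

Fixpoint iint (R : realType) (d : nat) : ('rV[R]_d -> \bar R) -> \bar R :=
  match d with
  | 0 => fun g => g 0
  | d'.+1 => fun g =>
      (\int[@lebesgue_measure R]_t iint (fun y => g (vcons t y)))%E
  end.

Section LSIDefs2.
Variables (R : realType) (d : nat).
Local Open Scope ereal_scope.

Definition sint (g : 'rV[R]_d -> R) : \bar R :=
  iint (fun x => (Num.max (g x) 0)%:E) - iint (fun x => (Num.max (- g x) 0)%:E).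

Definition is_density (m : set 'rV[R]_d -> \bar R) (f : 'rV[R]_d -> R) : Prop :=
  measurable_fun [set: Rd R d] (f : Rd R d -> R) /\ (forall x, (0 <= f x)%R) /\
  forall A : set (Rd R d), measurable A ->
    m A = iint (fun x => (\1_A x * f x)%:E).

Fixpoint Ck (k : nat) (psi : 'rV[R]_d -> R) : Prop :=
  match k with
  | 0 => continuous psi
  | k'.+1 => continuous psi /\
      forall i : 'I_d, (forall x, derivable psi x (delta_mx ord0 i)) /\
                       Ck k' (fun x => 'D_(delta_mx ord0 i) psi x)
  end.

Definition test_fun (psi : 'rV[R]_d -> R) : Prop :=
  (forall k, Ck k psi) /\
  exists r : R, forall x, (r < sqnorm x)%R -> psi x = 0%R.

Definition weak_grad (f : 'rV[R]_d -> R) (g : 'rV[R]_d -> 'rV[R]_d) : Prop :=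
  (forall i, measurable_fun [set: Rd R d] ((fun x => g x ord0 i) : Rd R d -> R)) /\
  (forall i (r : R), iint (fun x => ((if (sqnorm x <= r)%R then 1 else 0)
                                      * `|g x ord0 i|)%:E) < +oo) /\
  forall psi i, test_fun psi ->
    sint (fun x => (f x * 'D_(delta_mx ord0 i) psi x)%R)
    = - sint (fun x => (g x ord0 i * psi x)%R).

(** Relative entropy D with respect to the standard Gaussian; +oo if there
    is no density (the value does not depend on the version of the density). *)
Definition relD (m : set 'rV[R]_d -> \bar R) : \bar R :=
  ereal_inf [set v | exists f, is_density m f /\
                 v = sint (fun x => (f x * ln (f x / phi x))%R)].

(** Relative Fisher information I = int f |grad log (f/phi)|^2, where
    grad log (f / phi) (x) = grad f (x) / f (x) + x; +oo if it does not exist. *)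
Definition fisherI (m : set 'rV[R]_d -> \bar R) : \bar R :=
  ereal_inf [set v | exists f g, is_density m f /\ weak_grad f g /\
     v = iint (fun x => (if f x == 0%R then 0%R
                        else f x * sqnorm ((f x)^-1 *: g x + x))%:E)].

Definition deltaLSI (m : set 'rV[R]_d -> \bar R) : \bar R :=
  if fisherI m == +oo then +oo else (2^-1)%:E * fisherI m - relD m.

(** Law of S_n = Z_1 + ... + Z_n with Z_k i.i.d. of law mu
    (the n-fold convolution of mu). *)
Fixpoint sumlaw (mu : set (Rd R d) -> \bar R) (n : nat) : set 'rV[R]_d -> \bar R :=
  match n with
  | 0 => fun A => (\1_A (0 : 'rV[R]_d) : R)%:E
  | n'.+1 => fun A => \int[mu]_x sumlaw mu n' [set y | A (x + y)%R]
  end.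

Definition Ulaw (mu : set (Rd R d) -> \bar R) (n : nat) : set 'rV[R]_d -> \bar R :=
  fun A => sumlaw mu n [set y | A ((Num.sqrt n%:R)^-1 *: y)%R].

Definition centered (mu : {measure set (Rd R d) -> \bar R}) : Prop :=
  forall i : 'I_d, mu.-integrable [set: Rd R d] (fun x => (x ord0 i)%:E) /\
                   \int[mu]_x (x ord0 i)%:E = 0.

End LSIDefs2.

(* Main.v *)
(** Let X and Y be independent and centered, with finite Fisher information, let
    c^2 + s^2 = 1, V = c X + s Y and W = s X - c Y. As (x, y) |-> (v, w) is an
    isometry, D(X) + D(Y) is the relative entropy of (V, W), that is, D(V) plus
    the average entropy of W conditionally on V. By the Gaussian logarithmic
    Sobolev inequality for the conditional laws, the latter is at most
    (s^2 I(X) + c^2 I(Y)) / 2. On the other hand the score of V is the conditional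
    expectation of c score(X) + s score(Y) and scores have mean zero, hence
    I(V) <= c^2 I(X) + s^2 I(Y). With c^2 = n / (n + m) the two bounds add up to
    the subadditivity of the deficit; with m = 1 and I(U_n) <= I(Z) they give
    D(U_(n+1)) >= D(U_n) - delta(Z), and the bound on I(U_n) is equivalent to the
    one on D(U_n).

    The one-dimensional logarithmic Sobolev inequality is proved by monotone
    transport to the Gaussian, and the conditional one by induction on the
    dimension, with the chain rule for the entropy and the Cauchy-Schwarz
    inequality for the Fisher information. Weak gradients are only used along
    lines, where a density is almost everywhere a primitive of its weak
    derivative. *)
Require Import Defs.
From HB Require Import structures.
From mathcomp Require Import all_boot all_order all_algebra all_classical all_reals all_analysis.
From mathcomp Require Import measurable_realfun.
From mathcomp Require Import ring lra.
Import numFieldNormedType.Exports.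
Import Order.TTheory GRing.Theory Num.Theory.

Set Implicit Arguments.
Unset Strict Implicit.
Unset Printing Implicit Defensive.

Local Open Scope classical_set_scope.
Local Open Scope ring_scope.

(** * Lebesgue measure on R^d *)

(** Two features of the definitions shape the proof. [fisherI] is an infimum over pairs of a density
    and a weak gradient, and its integrand ignores the gradient where the density vanishes; hence a
    weak gradient is shown to vanish almost everywhere on that set, is then redefined as 0 there,
    and the bounds are proved for near-minimising pairs up to an error [eps]. The entropy has an
    integrand without a sign; it is replaced by [a ln (a / b) - a + b], nonnegative for [b > 0], so
    that Tonelli's theorem applies before any integrability is known.

    No conditional law is constructed: the conditional inequality is stated with a joint density and
    its marginal, and as the integrands [Kf] and [Ff] are homogeneous of degree 1, the slices need
    not be normalised. The pair (V, W) comes from a reflection rather than a rotation because a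
    reflection is its own inverse: one map serves in both directions. *)

Section prodm.
Local Open Scope ereal_scope.
Context d1 d2 (T1 : measurableType d1) (T2 : measurableType d2) (R : realType).
Variables (m1 : {sigma_finite_measure set T1 -> \bar R})
          (m2 : {sigma_finite_measure set T2 -> \bar R}).

(* A sigma-finite instance cannot be inferred for [m1 \x m2]. *)
Definition prodm : set (T1 * T2) -> \bar R := m1 \x m2.

HB.instance Definition _ := Measure.on prodm.

Lemma prodm_sigma_finite : sigma_finite [set: T1 * T2] prodm.
Proof.
have /sigma_finiteP[F [TF ndF Foo]] := sigma_finiteT m1.
have /sigma_finiteP[G [TG ndG Goo]] := sigma_finiteT m2.
exists (fun n => F n `*` G n).
  rewrite -setXTT TF TG predeqE => -[x y]; split.
    move=> [/= [n _ Fnx] [k _ Gky]]; exists (maxn n k) => //; split.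
    - by move: x Fnx; exact/subsetPset/ndF/leq_maxl.
    - by move: y Gky; exact/subsetPset/ndG/leq_maxr.
  by move=> [n _ []/= ? ?]; split; exists n.
move=> k; have [? ?] := Foo k; have [? ?] := Goo k.
split; first exact: measurableX.
by rewrite /prodm product_measure1E// lte_mul_pinfty// ge0_fin_numE.
Qed.

HB.instance Definition _ := Measure_isSigmaFinite.Build _ _ _ prodm prodm_sigma_finite.

Lemma tonelli1 (f : T1 * T2 -> \bar R) :
  measurable_fun setT f -> (forall z, 0 <= f z) ->
  \int[prodm]_z f z = \int[m1]_x \int[m2]_y f (x, y).
Proof. exact: fubini_tonelli1. Qed.

Lemma tonelli2 (f : T1 * T2 -> \bar R) :
  measurable_fun setT f -> (forall z, 0 <= f z) ->
  \int[prodm]_z f z = \int[m2]_y \int[m1]_x f (x, y).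
Proof. exact: fubini_tonelli2. Qed.

End prodm.
Arguments tonelli1 {d1 d2 T1 T2 R m1 m2} f.
Arguments tonelli2 {d1 d2 T1 T2 R m1 m2} f.

Definition pushm d1 d2 (T1 : measurableType d1) (T2 : measurableType d2)
    (R : realType) (f : T1 -> T2) (mf : measurable_fun [set: T1] f)
    (m : {measure set T1 -> \bar R}) : {measure set T2 -> \bar R}.
Proof.
by unshelve refine (pushforward m f : {measure set T2 -> \bar R}).
Defined.

Section rowspace.
Variable R : realType.

Lemma measurable_coord (d : nat) (i : 'I_d) :
  measurable_fun [set: Rd R d] (fun x : Rd R d => (x : 'rV[R]_d) ord0 i).
Proof.
move=> _ B mB; rewrite setTI; apply: sub_sigma_algebra.
exists (fun j => if j == i then B else setT); split.
  by move=> j; case: ifP.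
apply/seteqP; split => x /=.
  by move=> Bx j; case: eqP => // ->.
by move=> /(_ i); rewrite eqxx.
Qed.

Lemma measurable_fun_row d' (T : measurableType d') (d : nat)
    (f : T -> 'rV[R]_d) :
  (forall i, measurable_fun [set: T] (fun x => f x ord0 i)) ->
  measurable_fun [set: T] (f : T -> Rd R d).
Proof.
move=> mf; apply: (@measurability _ _ T (Rd R d) setT f (@rects R d)) => //.
move=> _ [_ [B [mB ->]] <-].
rewrite setTI (_ : _ @^-1` _ = \bigcap_(i in [set: 'I_d]) ((fun x => f x ord0 i) @^-1` B i)).
  apply: fin_bigcap_measurable => //.
  by move=> i _; rewrite -[X in measurable X]setTI; exact: mf.
by apply/seteqP; split => x /= h i; [move=> _|]; exact: h.
Qed.

Lemma vcons0 (d : nat) (t : R) (y : 'rV[R]_d) : vcons t y ord0 ord0 = t.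
Proof. by rewrite mxE unlift_none. Qed.

Lemma vconsS (d : nat) (t : R) (y : 'rV[R]_d) (i : 'I_d) :
  vcons t y ord0 (lift ord0 i) = y ord0 i.
Proof. by rewrite mxE liftK. Qed.

Definition vconsp (d : nat) (p : (R * Rd R d)%type) : Rd R d.+1 :=
  vcons p.1 (p.2 : 'rV[R]_d).

Lemma measurable_vconsp (d : nat) : measurable_fun [set: R * Rd R d] (@vconsp d).
Proof.
apply: measurable_fun_row => i.
have [j ->|->] := unliftP ord0 i.
  rewrite (_ : (fun _ => _) = (fun x : Rd R d => (x : 'rV[R]_d) ord0 j) \o snd).
    by apply: measurableT_comp; [exact: measurable_coord|exact: measurable_snd].
  by apply/funext => x /=; rewrite /vconsp vconsS.
rewrite (_ : (fun _ => _) = fst); first exact: measurable_fst.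
by apply/funext => x; rewrite /vconsp vcons0.
Qed.

Section step.
Variables (d : nat) (m : {sigma_finite_measure set (Rd R d) -> \bar R}).

Definition lam_step : set (Rd R d.+1) -> \bar R :=
  pushforward (prodm (@lebesgue_measure R) m) (@vconsp d).

HB.instance Definition _ := Measure.copy lam_step
  (@pushm _ _ (measurableTypeR R * Rd R d)%type (Rd R d.+1) R _ (@measurable_vconsp d)
    (prodm (@lebesgue_measure R) m)).

Definition vuncons (x : Rd R d.+1) : R * Rd R d :=
  ((x : 'rV[R]_d.+1) ord0 ord0, \row_i (x : 'rV[R]_d.+1) ord0 (lift ord0 i)).

Lemma measurable_vuncons : measurable_fun [set: Rd R d.+1] vuncons.
Proof.
apply: measurable_fun_pair; first exact: measurable_coord.
apply: measurable_fun_row => i.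
by under eq_fun do rewrite mxE; exact: measurable_coord.
Qed.

Lemma vconspK : cancel (@vconsp d) vuncons.
Proof.
case=> a b; rewrite /vuncons /vconsp vcons0; congr pair.
by apply/rowP => i; rewrite mxE vconsS.
Qed.

Lemma lam_step_sigma_finite : sigma_finite [set: Rd R d.+1] lam_step.
Proof.
have [F TF Foo] := sigma_finiteT (prodm (@lebesgue_measure R) m).
exists (fun i => vuncons @^-1` F i).
  by rewrite -preimage_bigcup -TF preimage_setT.
move=> i; have [mF Fi] := Foo i; split.
  by rewrite -[X in measurable X]setTI; exact: measurable_vuncons.
rewrite /lam_step /pushforward (_ : _ @^-1` _ = F i)//.
by apply/seteqP; split => x /=; rewrite vconspK.
Qed.

HB.instance Definition _ :=
  Measure_isSigmaFinite.Build _ _ _ lam_step lam_step_sigma_finite.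

Lemma integral_lam_step (g : Rd R d.+1 -> \bar R) :
  measurable_fun [set: Rd R d.+1] g -> (forall x, 0 <= g x)%E ->
  (\int[lam_step]_x g x = \int[prodm (@lebesgue_measure R) m]_p g (vconsp p))%E.
Proof.
move=> mg g0; rewrite /lam_step ge0_integral_pushforward//.
exact: measurable_vconsp.
Qed.

End step.

(** Built by the recursion of [iint], so that [iintE] is a plain induction; in dimension 0 the space
    is a point and the measure a Dirac mass. *)
Fixpoint lam (d : nat) : {sigma_finite_measure set (Rd R d) -> \bar R} :=
  match d with
  | 0 => @dirac _ (Rd R 0) (0 : 'rV[R]_0) R
  | d'.+1 => lam_step (lam d')
  end.

Lemma integral_lam0 (g : Rd R 0 -> \bar R) :
  measurable_fun setT g -> (\int[lam 0]_x g x)%E = g (0 : 'rV[R]_0).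
Proof. by move=> mg; rewrite integral_dirac// diracT mul1e. Qed.

Lemma integral_lamS (d : nat) (g : Rd R d.+1 -> \bar R) :
  measurable_fun [set: Rd R d.+1] g -> (forall x, 0 <= g x)%E ->
  (\int[lam d.+1]_x g x =
   \int[@lebesgue_measure R]_t \int[lam d]_y g (vcons t y))%E.
Proof.
move=> mg g0.
have mgv : measurable_fun [set: R * Rd R d] (g \o @vconsp d).
  exact: (measurableT_comp mg (@measurable_vconsp d)).
rewrite -[LHS]/(\int[lam_step (lam d)]_x g x)%E integral_lam_step//.
by rewrite tonelli1//= => z; exact: g0.
Qed.

Lemma measurable_vcons (d : nat) (t : R) :
  measurable_fun [set: Rd R d] (fun y : Rd R d => vcons t y : Rd R d.+1).
Proof. exact: (measurableT_comp (@measurable_vconsp d) (pair1_measurable t)). Qed.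

Lemma iintE (d : nat) (g : 'rV[R]_d -> \bar R) :
  measurable_fun [set: Rd R d] (g : Rd R d -> \bar R) -> (forall x, 0 <= g x)%E ->
  iint g = (\int[lam d]_x g x)%E.
Proof.
elim: d g => [|d IHd] g mg g0; first by rewrite integral_lam0.
rewrite integral_lamS//=; apply: eq_integral => t _; rewrite IHd//.
exact: (measurableT_comp mg (measurable_vcons t)).
Qed.

(** The image of Lebesgue measure under the affine map, scaled by [|a|], agrees with Lebesgue
    measure on the intervals []c, d]], which determine it. The sign of [a] decides on which side the
    preimage of such an interval is closed. *)
Lemma lebesgue_affine (a b : R) (g : R -> \bar R) : a != 0 ->
  measurable_fun [set: R] g -> (forall x, 0 <= g x)%E ->
  (`|a|%:E * \int[@lebesgue_measure R]_x g (a * x + b)%R =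
   \int[@lebesgue_measure R]_x g x)%E.
Proof.
move=> a0 mg g0.
have maff : measurable_fun [set: R] (fun x : R => a * x + b).
  by apply: measurable_funD => //; exact: measurable_funM.
pose pf : {measure set (measurableTypeR R) -> \bar R} :=
  @pushm _ _ (measurableTypeR R) (measurableTypeR R) R _ maff (@lebesgue_measure R).
have a_ge0 : 0 <= `|a| by [].
pose ms := mscale (NngNum a_ge0) pf.
have mE A : measurable A -> (@lebesgue_measure R A = ms A)%E.
  move=> mA; apply: lebesgue_measure_unique => // _ [[c d]] _ <-.
  rewrite -[RHS]/(`|a|%:E * (@lebesgue_measure R ((fun x => a * x + b)%R @^-1` `]c, d]%classic)))%E.
  have [a_gt0|a_le0|] := ltgtP 0 a; last by move=> a00; rewrite -a00 eqxx in a0.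
    rewrite (_ : _ @^-1` _ = `](c - b) / a, (d - b) / a]%classic); last first.
      apply/seteqP; split => x /=; rewrite !in_itv/=;
        by rewrite ltr_pdivrMr// ler_pdivlMr// ltrBlDr lerBrDr mulrC.
    rewrite !lebesgue_measure_itv/= !lte_fin ltr_pM2r ?invr_gt0// ltrD2r.
    case: ifPn => // cd; last by rewrite mule0.
    rewrite -!EFinD -EFinM gtr0_norm//; congr EFin.
    by field; rewrite gt_eqF.
  rewrite (_ : _ @^-1` _ = `[(d - b) / a, (c - b) / a[%classic); last first.
    apply/seteqP; split => x /=; rewrite !in_itv/= andbC;
      by rewrite ltr_ndivlMr// ler_ndivrMr// ltrBlDr lerBrDr mulrC.
  rewrite !lebesgue_measure_itv/= !lte_fin ltr_nM2r ?invr_lt0// ltrD2r.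
  case: ifPn => // cd; last by rewrite mule0.
  rewrite -!EFinD -EFinM ltr0_norm//; congr EFin.
  by field; rewrite lt_eqF.
transitivity (\int[ms]_x g x)%E; last first.
  by apply: eq_measure_integral => A mA _; exact/esym/mE.
rewrite ge0_integral_mscale//; congr (_ * _)%E.
by rewrite ge0_integral_pushforward.
Qed.

Lemma measurable_affine (d : nat) (a : R) (b : 'rV[R]_d) :
  measurable_fun [set: Rd R d] (fun x : Rd R d => a *: (x : 'rV[R]_d) + b : Rd R d).
Proof.
apply: measurable_fun_row => i; under eq_fun do rewrite !mxE.
by apply: measurable_funD => //; apply: measurable_funM => //; exact: measurable_coord.
Qed.

Lemma lam_affine (d : nat) (a : R) (b : 'rV[R]_d) (g : Rd R d -> \bar R) :
  a != 0 -> measurable_fun setT g -> (forall x, 0 <= g x)%E ->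
  ((`|a| ^+ d)%:E * \int[lam d]_x g (a *: (x : 'rV[R]_d) + b)%R =
   \int[lam d]_x g x)%E.
Proof.
move=> a0; elim: d b g => [|d IHd] b g mg g0.
  rewrite expr0 mul1e !integral_lam0//.
    by congr g; apply/rowP => -[].
  exact: (measurableT_comp mg (measurable_affine a b)).
rewrite !integral_lamS//; last exact: (measurableT_comp mg (measurable_affine a b)).
have mgv : measurable_fun [set: R * Rd R d] (g \o @vconsp d).
  exact: (measurableT_comp mg (@measurable_vconsp d)).
have mG := measurable_fun_fubini_tonelli_F (m2 := lam d) _ mgv (fun z => g0 (vconsp z)).
rewrite -[RHS](lebesgue_affine (b ord0 ord0) a0 mG); last first.
  by move=> x; apply: integral_ge0 => y _; exact: g0.
rewrite exprS EFinM -muleA; congr (_ * _)%E.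
rewrite -ge0_integralZl//; last 2 first.
- apply: (measurable_fun_fubini_tonelli_F (m2 := lam d)
    (fun p : R * Rd R d => g (a *: (vconsp p : 'rV[R]_d.+1) + b))) => //.
  apply: (measurableT_comp (measurableT_comp mg (measurable_affine a b))).
  exact: measurable_vconsp.
- by move=> x _; apply: integral_ge0.
apply: eq_integral => t _.
pose b' : 'rV[R]_d := \row_i b ord0 (lift ord0 i).
rewrite -[RHS](IHd b' (fun y => g (vcons (a * t + b ord0 ord0) y)))//; last first.
  exact: (measurableT_comp mg (measurable_vcons _)).
congr (_ * _)%E; apply: eq_integral => y _; congr g.
apply/rowP => i; rewrite !mxE; case: unliftP => [j|] -> //.
by rewrite !mxE.
Qed.

Lemma lam_shift (d : nat) (b : 'rV[R]_d) (g : Rd R d -> \bar R) :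
  measurable_fun setT g -> (forall x, 0 <= g x)%E ->
  (\int[lam d]_x g ((x : 'rV[R]_d) + b)%R = \int[lam d]_x g x)%E.
Proof.
move=> mg g0; rewrite -(lam_affine b (oner_neq0 R) mg g0) normr1 expr1n mul1e.
by under [RHS]eq_integral do rewrite scale1r.
Qed.

(** * The isometry (x, y) -> (c x + s y, s x - c y) *)

Section reflection.
Variables (d : nat) (c s : R).
Hypotheses (cs1 : c ^+ 2 + s ^+ 2 = 1) (c0 : c != 0).

Definition refl (p : Rd R d * Rd R d) : Rd R d * Rd R d :=
  (c *: (p.1 : 'rV[R]_d) + s *: (p.2 : 'rV[R]_d),
   s *: (p.1 : 'rV[R]_d) - c *: (p.2 : 'rV[R]_d)).

(** The second component of the reflection in terms of the first one, [c x + s y], and of [y]: it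
    matches the two successive substitutions of [lam_refl]. *)
Lemma refl_alg (x y : R) : s / c * (c * x + s * y) - c^-1 * y = s * x - c * y.
Proof.
transitivity (s * x - c^-1 * y * (c ^+ 2 + s ^+ 2) + s ^+ 2 / c * y).
  by rewrite cs1; field.
by field.
Qed.

Lemma measurable_refl : measurable_fun [set: Rd R d * Rd R d] refl.
Proof.
apply: measurable_fun_pair; apply: measurable_fun_row => i;
  under eq_fun do rewrite !mxE.
- apply: measurable_funD; apply: measurable_funM => //;
  exact: (measurableT_comp (measurable_coord i)).
- apply: measurable_funB; apply: measurable_funM => //;
  exact: (measurableT_comp (measurable_coord i)).
Qed.

Lemma reflK : involutive refl.
Proof.
have c2s2 : c * c + s * s = 1 by rewrite -!expr2.
move=> [x y]; rewrite /refl /=; congr pair; apply/rowP => i; rewrite !mxE.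
- transitivity ((c * c + s * s) * (x : 'rV[R]_d) ord0 i); first by ring.
  by rewrite c2s2 mul1r.
- transitivity ((c * c + s * s) * (y : 'rV[R]_d) ord0 i); first by ring.
  by rewrite c2s2 mul1r.
Qed.

(** The reflection is the substitution [v = c x + s y] at fixed [y], of Jacobian [|c|^d], followed
    by [w = (s / c) v - y / c] at fixed [v], of Jacobian [|c|^-d]. Each one is an instance of
    [lam_affine], and the factors cancel. *)
Lemma lam_refl (g : Rd R d * Rd R d -> \bar R) :
  measurable_fun setT g -> (forall z, 0 <= g z)%E ->
  (\int[prodm (lam d) (lam d)]_z g (refl z) = \int[prodm (lam d) (lam d)]_z g z)%E.
Proof.
move=> mg g0; have mgr := measurableT_comp mg measurable_refl.
have k0 : 0 < `|c| ^+ d by rewrite exprn_gt0// normr_gt0.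
pose h (p : Rd R d * Rd R d) : Rd R d * Rd R d :=
  (p.1, (s / c) *: (p.1 : 'rV[R]_d) - c^-1 *: (p.2 : 'rV[R]_d)).
have mh : measurable_fun setT h.
  apply: measurable_fun_pair; first exact: measurable_fst.
  apply: measurable_fun_row => i; under eq_fun do rewrite !mxE.
  apply: measurable_funB; apply: measurable_funM => //;
  exact: (measurableT_comp (measurable_coord i)).
rewrite tonelli2//.
transitivity (\int[lam d]_w ((`|c| ^+ d)^-1%:E * \int[lam d]_x g (h (x, w))))%E.
  apply: eq_integral => w _; apply/esym.
  pose u x := g (h (x, w)).
  have mu : measurable_fun setT u.
    exact: (measurableT_comp (measurableT_comp mg mh) (pair2_measurable w)).
  have -> := esym (lam_affine (s *: (w : 'rV[R]_d)) c0 mu (fun x => g0 _)).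
  rewrite muleA -EFinM mulVf ?gt_eqF// mul1e.
  apply: eq_integral => v _; rewrite /u /h /refl /=; congr (g (_, _)).
  apply/rowP => i; rewrite !mxE.
  exact: refl_alg.
rewrite ge0_integralZl//; last 2 first.
- exact: (measurable_fun_fubini_tonelli_G (m1 := lam d) (g \o h) (measurableT_comp mg mh) (fun z => g0 _)).
- by move=> w _; apply: integral_ge0 => y _; exact: g0.
have -> := esym (@tonelli2 _ _ _ _ _ (lam d) (lam d) (g \o h) (measurableT_comp mg mh) (fun z => g0 _)).
rewrite (tonelli1 (g \o h) (measurableT_comp mg mh) (fun z => g0 _)) (tonelli1 g mg g0).
rewrite -ge0_integralZl//; last 2 first.
- exact: (measurable_fun_fubini_tonelli_F (m2 := lam d) (g \o h) (measurableT_comp mg mh) (fun z => g0 _)).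
- by move=> w _; apply: integral_ge0 => y _; exact: g0.
apply: eq_integral => x _ /=.
pose u y := g (x, y).
have mu : measurable_fun setT u by exact: (measurableT_comp mg (pair1_measurable x)).
have ci0 : - c^-1 != 0 by rewrite oppr_eq0 invr_eq0.
have e := lam_affine ((s / c) *: (x : 'rV[R]_d)) ci0 mu (fun y => g0 _).
have nE : `|- c^-1| ^+ d = `|c| ^- d by rewrite normrN normfV exprVn.
rewrite nE in e; rewrite -[RHS]/(\int[lam d]_y u y)%E -e.
by congr (_ * _)%E; apply: eq_integral => y _; rewrite /u /h/= addrC scaleNr.
Qed.

End reflection.
End rowspace.

(** * Gaussian density and monotone transport *)

Section gauss.
Variable R : realType.
Local Notation mu := (@lebesgue_measure R).

Definition gauss (x : R) : R := (Num.sqrt (2 * pi))^-1 * expR (- (x ^+ 2 / 2)).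

Lemma gauss_gt0 x : 0 < gauss x.
Proof. by rewrite mulr_gt0 ?expR_gt0// invr_gt0 sqrtr_gt0 mulr_gt0// pi_gt0. Qed.

Lemma gaussE : gauss = normal_pdf 0 1.
Proof.
apply/funext => x; rewrite normal_pdfE ?oner_neq0// /gauss /normal_peak /normal_fun.
rewrite !expr1n mul1r subr0 -[pi *+ 2]mulr_natl mulNr; congr (_ * expR _).
Qed.

Lemma continuous_gauss : continuous gauss.
Proof. by rewrite gaussE; apply: continuous_normal_pdf; rewrite oner_neq0. Qed.

Lemma integral_gauss : (\int[mu]_x (gauss x)%:E = 1)%E.
Proof. by rewrite gaussE; exact: integral_normal_pdf. Qed.

Lemma integrable_gauss : mu.-integrable [set: R] (EFin \o gauss).
Proof. by rewrite gaussE; exact: integrable_normal_pdf. Qed.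

Lemma measurable_gauss : measurable_fun [set: R] gauss.
Proof. exact: continuous_measurable_fun continuous_gauss. Qed.

Lemma is_derive_gauss (x : R) : is_derive x 1 gauss (- x * gauss x).
Proof.
have h : is_derive x 1 (fun y : R => - (y ^+ 2 / 2)) (- x).
  apply: is_derive_eq.
  by rewrite /GRing.scale /=; field.
rewrite /gauss; apply: is_derive_eq.
by rewrite /GRing.scale /=; ring.
Qed.

End gauss.

(** * Distribution functions of positive continuous densities *)

Section cdf.
Variable R : realType.
Local Notation mu := (@lebesgue_measure R).
Variable p : R -> R.
Hypotheses (cp : continuous p) (p_gt0 : forall x, 0 < p x).
Hypotheses (ip : mu.-integrable [set: R] (EFin \o p)).
Hypothesis p1 : (\int[mu]_x (p x)%:E = 1)%E.

Definition cdfn (x : R) : R := \int[mu]_(t in `]-oo, x]) p t.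

Lemma is_derive_cdfn (x : R) : is_derive x 1 cdfn (p x).
Proof.
have [|||D <-] := @continuous_FTC1 _ p -oo%O x (x + 1) _ _ _ (@cp x).
- by rewrite ltrDl.
- exact: integrableS ip.
- by rewrite ltNyr.
by rewrite derive1E; exact: DeriveDef.
Qed.

Lemma cdfn_ge0 x : 0 <= cdfn x.
Proof. by apply: Rintegral_ge0 => t _; exact: ltW. Qed.

Lemma cdfnB x : \int[mu]_(t in `]x, +oo[) p t = 1 - cdfn x.
Proof.
rewrite -(@Rintegral_itvB _ p -oo%O +oo%O x)//; last first.
  exact: integrableS ip.
by rewrite set_itvE /Rintegral p1.
Qed.

Lemma cdfn_le1 x : cdfn x <= 1.
Proof. by rewrite -subr_ge0 -cdfnB; apply: Rintegral_ge0 => t _; exact: ltW. Qed.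

Lemma cdfn_lt a b : a < b -> cdfn a < cdfn b.
Proof.
move=> ab; have [||c _ ce] := @MVT _ cdfn p a b ab.
- by move=> x _; exact: is_derive_cdfn.
- apply: continuous_subspaceT => x.
  apply/differentiable_continuous/derivable1_diffP.
  exact: (@ex_derive _ _ _ _ _ _ _ (is_derive_cdfn x)).
by rewrite -subr_gt0 ce mulr_gt0// subr_gt0.
Qed.

Lemma cdfn_inj : injective cdfn.
Proof.
move=> a b ab; case: (ltgtP a b) => // /cdfn_lt; by rewrite ab ltxx.
Qed.

Lemma cdfn_continuous : continuous cdfn.
Proof.
move=> x; apply/differentiable_continuous/derivable1_diffP.
exact: (@ex_derive _ _ _ _ _ _ _ (is_derive_cdfn x)).
Qed.

Lemma cdfn_gt0 x : 0 < cdfn x.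
Proof. by apply: le_lt_trans (cdfn_ge0 (x - 1)) _; apply: cdfn_lt; rewrite ltrBlDr ltrDl. Qed.

Lemma cdfn_lt1 x : cdfn x < 1.
Proof. by apply: lt_le_trans (cdfn_le1 (x + 1)); apply: cdfn_lt; rewrite ltrDl. Qed.

(** Monotone convergence: sets that exhaust the line end up with more than any given mass below 1.
    Half-lines on both sides then bracket a level for the intermediate value theorem. *)
Let exhaust (F : nat -> set R) (u : R) : nondecreasing_seq F ->
  (forall i, measurable (F i)) -> \bigcup_i F i = setT -> u < 1 ->
  exists n, u < \int[mu]_(t in F n) p t.
Proof.
move=> ndF mF UF u1; apply: contrapT => /forallNP h.
have mp : measurable_fun setT (EFin \o p) by exact: measurable_int ip.
have := @ge0_nondecreasing_set_cvg_integral _ (measurableTypeR R) R F (EFin \o p) mu ndF mF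
  (fun i => measurable_funTS mp) (fun i x _ => ltW (p_gt0 x)).
rewrite UF [X in _ --> X]p1 => cv.
suff : (1 <= u%:E)%E by rewrite leNgt lte_fin u1.
rewrite -(cvg_lim _ cv)//; apply: lime_le; first by apply/cvg_ex; exists 1%E.
apply: nearW => n.
have In : mu.-integrable (F n) (EFin \o p) by apply: (integrableS _ _ _ ip) => //; exact: mF.
rewrite -[X in (X <= _)%E]fineK ?lee_fin ?leNgt; last by apply: integrable_fin_num => //; exact: mF.
exact/negP/h.
Qed.

Lemma cdfn_onto u : 0 < u < 1 -> exists x, cdfn x = u.
Proof.
move=> /andP[u0 u1].
have [n nu] : exists n, u < cdfn n%:R.
  apply: exhaust => //.
  - by move=> i j ij; apply/subsetPset; apply: subset_itvl; rewrite bnd_simp ler_nat.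
  - apply/seteqP; split => // x _; exists (Num.truncn `|x|).+1 => //=.
    rewrite in_itv/= (le_trans (ler_norm _))//; apply/ltW; exact: truncnS_gt.
(* A small left tail is a large complement: [exhaust] is used for the half-lines []-i, +oo[] at the
   level [1 - u]. *)
have [m mlt] : exists m, cdfn (- m%:R) < u.
  have [||||m] := @exhaust (fun i => `]- i%:R, +oo[%classic) (1 - u).
  - by move=> i j ij; apply/subsetPset; apply: subset_itvr; rewrite bnd_simp lerN2 ler_nat.
  - by move=> i.
  - apply/seteqP; split => // x _; exists (Num.truncn `|x|).+1 => //=.
    rewrite in_itv/= andbT ltrNl (le_lt_trans (ler_norm _))// normrN; exact: truncnS_gt.
  - by rewrite ltrBlDr ltrDl.
  by rewrite cdfnB ltrD2l ltrN2 => ?; exists m.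
have mn : - m%:R <= n%:R :> R by rewrite (@le_trans _ _ 0)// oppr_le0.
have [||c _ cu] := @IVT _ cdfn (- m%:R) n%:R u mn.
- by apply: continuous_subspaceT; exact: cdfn_continuous.
- rewrite ge_min le_max (ltW mlt) (ltW nu) orbT//.
by exists c.
Qed.

End cdf.

(** * Monotone transport to the Gaussian *)

Section transport.
Variable R : realType.
Local Notation mu := (@lebesgue_measure R).
Variable p : R -> R.
Hypotheses (cp : continuous p) (p_gt0 : forall x, 0 < p x).
Hypotheses (ip : mu.-integrable [set: R] (EFin \o p)).
Hypothesis p1 : (\int[mu]_x (p x)%:E = 1)%E.

Local Notation G := (cdfn (@gauss R)).

Let Gonto u : 0 < u < 1 -> exists x, G x = u.
Proof.
exact: (cdfn_onto (@continuous_gauss R) (@gauss_gt0 R) (integrable_gauss R) (integral_gauss R)).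
Qed.

Let Ginj : injective G.
Proof.
exact: (cdfn_inj (@continuous_gauss R) (@gauss_gt0 R) (integrable_gauss R)).
Qed.

(** The Gaussian quantile function; [xget] returns 0 at the levels that [G] does not reach. *)
Definition Ginv (u : R) : R := xget 0 [set x | G x = u].

Lemma GinvK x : Ginv (G x) = x.
Proof.
apply: Ginj; rewrite /Ginv.
exact: (@xgetPex _ 0 [set y | G y = G x] (ex_intro _ x erefl)).
Qed.

Definition trans (x : R) : R := Ginv (cdfn p x).

Lemma transE x : G (trans x) = cdfn p x.
Proof.
rewrite /trans; have [|y <-] := @Gonto (cdfn p x); last by rewrite GinvK.
by rewrite (cdfn_gt0 cp)// (cdfn_lt1 cp).
Qed.

(** Differentiating [G (trans x) = cdfn p x] gives the Monge-Ampere equation in one dimension. The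
    inverse function is differentiable because the Gaussian density is positive. *)
Lemma is_derive_trans (x : R) : is_derive x 1 trans (p x / gauss (trans x)).
Proof.
have h : is_derive (cdfn p x) 1 Ginv (gauss (trans x))^-1.
  rewrite -transE; apply: is_derive_inverse.
  - by near=> y; exact: GinvK.
  - near=> y; exact: (cdfn_continuous (@continuous_gauss R) (integrable_gauss R)).
  - exact: (is_derive_cdfn (@continuous_gauss R) (integrable_gauss R)).
  - by rewrite gt_eqF// gauss_gt0.
have := is_derive1_comp h (is_derive_cdfn cp ip x).
by rewrite mulrC.
Unshelve. all: by end_near. Qed.

Lemma continuous_trans : continuous trans.
Proof.
move=> x; apply/differentiable_continuous/derivable1_diffP.
exact: (@ex_derive _ _ _ _ _ _ _ (is_derive_trans x)).
Qed.

Definition disp (x : R) : R := trans x - x.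
Definition ddisp (x : R) : R := p x / gauss (trans x) - 1.

Lemma is_derive_disp (x : R) : is_derive x 1 disp (ddisp x).
Proof. by have h := is_derive_trans x; rewrite /disp /ddisp; exact: is_deriveB. Qed.

Lemma continuous_ddisp : continuous ddisp.
Proof.
move=> x; apply: cvgB; last exact: cvg_cst.
apply: cvgM; first exact: cp.
apply: cvgV; first by rewrite gt_eqF// gauss_gt0.
by apply: continuous_comp; [exact: continuous_trans|exact: continuous_gauss].
Qed.

(* [log T' <= T' - 1] and AM-GM *)
Lemma entropy_pointwise (x c : R) :
  p x * ln (p x / gauss x) <=
  p x * ddisp x + c * disp x + (c + x * p x) ^+ 2 / p x / 2.
Proof.
have g0 := gauss_gt0 x; have gT0 := gauss_gt0 (trans x); have px0 := p_gt0 x.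
have -> : p x / gauss x = p x / gauss (trans x) * expR ((x ^+ 2 - trans x ^+ 2) / 2).
  have -> : gauss (trans x) = gauss x * expR ((x ^+ 2 - trans x ^+ 2) / 2).
    rewrite /gauss -[RHS]mulrA -expRD; congr (_ * expR _); by field.
  by field; rewrite !gt_eqF ?expR_gt0.
rewrite lnM ?posrE ?expR_gt0 ?divr_gt0// expRK.
have lnle : ln (p x / gauss (trans x)) <= ddisp x.
  rewrite /ddisp -[leLHS](_ : ln (1 + (p x / gauss (trans x) - 1)) = _); last first.
    by rewrite addrC subrK.
  by apply: le_ln1Dx; rewrite ltrBrDr addrC subrr divr_gt0.
have -> : (x ^+ 2 - trans x ^+ 2) / 2 = - (x * disp x) - disp x ^+ 2 / 2.
  by rewrite /disp; field.
have : p x * ln (p x / gauss (trans x)) <= p x * ddisp x by rewrite ler_pM2l.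
set L := p x * ln _; set D := p x * ddisp x => LD.
rewrite mulrDr -/L.
(* The square is completed in [disp x]. The parameter [c] will be the derivative [q] of [p], so that
   [p * ddisp + c * disp] integrates to a boundary term. *)
have -> : (c + x * p x) ^+ 2 / p x / 2 =
  - c * disp x - x * p x * disp x - p x * disp x ^+ 2 / 2 +
  (c + x * p x + p x * disp x) ^+ 2 / p x / 2.
  by field; rewrite gt_eqF.
have : 0 <= (c + x * p x + p x * disp x) ^+ 2 / p x / 2.
  by rewrite !divr_ge0// ?sqr_ge0// ltW.
set S := (c + x * p x + p x * disp x) ^+ 2 / p x / 2.
by lra.
Qed.

Lemma is_derive_gauss_trans (x : R) :
  is_derive x 1 (@gauss R \o trans) (- (trans x * p x)).
Proof.
have := is_derive1_comp (is_derive_gauss (trans x)) (is_derive_trans x).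
congr (is_derive _ _ _ _); field; by rewrite gt_eqF// gauss_gt0.
Qed.

Let cgt : continuous (@gauss R \o trans).
Proof.
move=> x; apply/differentiable_continuous/derivable1_diffP.
exact: (@ex_derive _ _ _ _ _ _ _ (is_derive_gauss_trans x)).
Qed.

(* otherwise [@gauss R \o trans] would decrease at least linearly to negative values *)
Lemma boundary_right (N eta : R) : 0 < eta -> exists2 b, N < b & p b * disp b <= eta.
Proof.
move=> eta0; apply: contrapT => H.
have H' b : N < b -> eta < p b * disp b.
  by move=> Nb; rewrite ltNge; apply/negP => h; apply: H; exists b.
(* Beyond a nonnegative [M] one has [trans c * p c >= p c * disp c], so the assumed lower bound on
   the boundary term becomes a bound on the slope of [gauss \o trans]. *)
pose M := Num.max N 0; pose u := (@gauss R \o trans) M.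
have u0 : 0 < u by exact: gauss_gt0.
(* Decreasing at rate [eta] over this length amounts to a loss of [u + 1], more than the initial
   value [u]. *)
pose L := (u + 1) / eta.
have L0 : 0 < L by rewrite divr_gt0// addr_gt0.
have [|||c + ce] := @MVT _ (@gauss R \o trans) (fun x => - (trans x * p x)) M (M + L).
- by rewrite ltrDl.
- by move=> x _; exact: is_derive_gauss_trans.
- exact: continuous_subspaceT.
rewrite in_itv/= => /andP[Mc _].
have := gauss_gt0 (trans (M + L)).
rewrite -[gauss _]/((@gauss R \o trans) (M + L)) -(subrK ((@gauss R \o trans) M) ((@gauss R \o trans) (M + L))) ce -/u.
apply/negP; rewrite -leNgt.
have Nc : N < c by apply: le_lt_trans Mc; rewrite le_max lexx.
have c0 : 0 <= c by apply: ltW; apply: le_lt_trans Mc; rewrite le_max lexx orbT.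
have cT : eta <= trans c * p c.
  have := H' _ Nc; rewrite /disp mulrBr => h.
  by apply: (le_trans (ltW h)); rewrite [leRHS]mulrC gerBl mulr_ge0// ltW.
have -> : M + L - M = L by ring.
rewrite mulNr addrC subr_le0.
apply: (@le_trans _ _ (eta * L)); last by rewrite ler_pM2r.
by rewrite /L mulrC divfK ?gt_eqF// lerDl.
Qed.

(** Otherwise [gauss \o trans] would have slope at least [eta] on a whole left half-line and become
    negative far to the left. *)
Lemma boundary_left (N eta : R) : 0 < eta -> exists2 a, a < N & - (p a * disp a) <= eta.
Proof.
move=> eta0; apply: contrapT => H.
have H' b : b < N -> eta < - (p b * disp b).
  by move=> Nb; rewrite ltNge; apply/negP => h; apply: H; exists b.
pose M := Num.min N 0; pose u := (@gauss R \o trans) M.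
have u0 : 0 < u by exact: gauss_gt0.
pose L := (u + 1) / eta.
have L0 : 0 < L by rewrite divr_gt0// addr_gt0.
have [|||c + ce] := @MVT _ (@gauss R \o trans) (fun x => - (trans x * p x)) (M - L) M.
- by rewrite ltrBlDr ltrDl.
- by move=> x _; exact: is_derive_gauss_trans.
- exact: continuous_subspaceT.
rewrite in_itv/= => /andP[_ cM].
have := gauss_gt0 (trans (M - L)).
rewrite -[gauss _]/((@gauss R \o trans) (M - L)) => h.
have Nc : c < N by apply: lt_le_trans cM _; rewrite ge_min lexx.
have c0 : c <= 0 by apply: ltW; apply: lt_le_trans cM _; rewrite ge_min lexx orbT.
have cT : eta <= - (trans c * p c).
  have := H' _ Nc; rewrite /disp mulrBr => h'.
  apply: (le_trans (ltW h')); rewrite [trans c * _]mulrC lerN2 lerBrDr gerDl.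
  by rewrite pmulr_rle0.
have e : M - (M - L) = L by ring.
rewrite e in ce.
have : eta * L <= - (trans c * p c) * L by rewrite ler_pM2r.
rewrite -ce /L mulrC divfK ?gt_eqF// -/u lerD2l leNgt => /negP; apply.
by rewrite (lt_trans _ ltr01)// oppr_lt0.
Qed.

End transport.

(** * Real-valued integrals *)

Section ae.
Context d (T : measurableType d) (R : realType) (mu : {measure set T -> \bar R}).
Implicit Types P Q : T -> Prop.

Lemma ae_imp P Q : {ae mu, forall x, P x} -> (forall x, P x -> Q x) ->
  {ae mu, forall x, Q x}.
Proof. by move=> aP PQ; apply: filterS aP => x /PQ. Qed.

Lemma ae_imp2 P1 P2 Q : {ae mu, forall x, P1 x} -> {ae mu, forall x, P2 x} ->
  (forall x, P1 x -> P2 x -> Q x) -> {ae mu, forall x, Q x}.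
Proof. by move=> a1 a2 PQ; apply: filterS2 a1 a2 => x; exact: PQ. Qed.

End ae.

Section real_integrable.
Context d (T : measurableType d) (R : realType) (mu : {measure set T -> \bar R}).
Implicit Types f g : T -> R.

Lemma ge0_integrable f : measurable_fun setT f -> (forall x, 0 <= f x) ->
  (\int[mu]_x (f x)%:E < +oo)%E -> mu.-integrable setT (EFin \o f).
Proof.
move=> mf f0 foo; apply/integrableP; split; first exact/measurable_EFinP.
by rewrite (eq_integral (EFin \o f))// => x _; rewrite /= ger0_norm.
Qed.

Lemma Rintegrable_measurable f : mu.-integrable setT (EFin \o f) -> measurable_fun setT f.
Proof. by move=> /measurable_int /measurable_EFinP. Qed.

Lemma Rintegrable_le f g : measurable_fun setT f -> (forall x, `|f x| <= g x) ->
  mu.-integrable setT (EFin \o g) -> mu.-integrable setT (EFin \o f).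
Proof.
move=> mf fg; apply: le_integrable => //; first exact/measurable_EFinP.
by move=> x _; rewrite lee_fin (le_trans (fg x))// ler_norm.
Qed.

Lemma RintegrableZ (k : R) f : mu.-integrable setT (EFin \o f) ->
  mu.-integrable setT (EFin \o (fun x => k * f x)).
Proof. exact: integrableZl. Qed.

Lemma RintegrableD f g : mu.-integrable setT (EFin \o f) ->
  mu.-integrable setT (EFin \o g) -> mu.-integrable setT (EFin \o (fun x => f x + g x)).
Proof. exact: integrableD. Qed.

Lemma RintegrableB f g : mu.-integrable setT (EFin \o f) ->
  mu.-integrable setT (EFin \o g) -> mu.-integrable setT (EFin \o (fun x => f x - g x)).
Proof. exact: integrableB. Qed.

Lemma Rintegrable_norm f : mu.-integrable setT (EFin \o f) ->
  mu.-integrable setT (EFin \o (fun x => `|f x|)).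
Proof. exact: integrable_norm. Qed.

Lemma RintegralE f : mu.-integrable setT (EFin \o f) ->
  (\int[mu]_x (f x)%:E = (\int[mu]_x f x)%:E)%E.
Proof. by move=> fi; rewrite fineK//; exact: integrable_fin_num. Qed.

Lemma ae_eq_integrable f g : measurable_fun setT g -> {ae mu, forall x, f x = g x} ->
  mu.-integrable setT (EFin \o f) -> mu.-integrable setT (EFin \o g).
Proof.
move=> mg fg /integrableP[mf foo]; apply/integrableP; split; first exact/measurable_EFinP.
apply: le_lt_trans foo; rewrite le_eqVlt; apply/orP; left; apply/eqP.
apply: ae_eq_integral => //; [|exact: measurableT_comp|].
- by apply: measurableT_comp => //; exact/measurable_EFinP.
- by apply: filterS fg => x /= ->.
Qed.

Lemma ae_eq_Rintegral f g : measurable_fun setT f -> measurable_fun setT g ->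
  {ae mu, forall x, f x = g x} -> \int[mu]_x f x = \int[mu]_x g x.
Proof.
move=> mf mg fg; rewrite /Rintegral; congr fine.
apply: ae_eq_integral => //; try exact/measurable_EFinP.
by apply: filterS fg => x /= ->.
Qed.

Lemma ge0_RZl (k : R) f : measurable_fun setT f -> (forall x, 0 <= f x) -> 0 <= k ->
  (\int[mu]_x (k * f x)%:E = k%:E * \int[mu]_x (f x)%:E)%E.
Proof.
move=> mf f0 k0; under eq_integral do rewrite EFinM.
rewrite ge0_integralZl//; first exact/measurable_EFinP.
by move=> x _; rewrite lee_fin.
Qed.

Lemma ge0_RD f g : measurable_fun setT f -> (forall x, 0 <= f x) ->
  measurable_fun setT g -> (forall x, 0 <= g x) ->
  (\int[mu]_x (f x + g x)%:E = \int[mu]_x (f x)%:E + \int[mu]_x (g x)%:E)%E.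
Proof.
move=> mf f0 mg g0; under eq_integral do rewrite EFinD.
rewrite ge0_integralD//; try exact/measurable_EFinP.
by move=> x _; rewrite lee_fin.
by move=> x _; rewrite lee_fin.
Qed.

Lemma ge0_Rle f g : measurable_fun setT f -> (forall x, 0 <= f x) ->
  measurable_fun setT g -> (forall x, f x <= g x) ->
  (\int[mu]_x (f x)%:E <= \int[mu]_x (g x)%:E)%E.
Proof.
move=> mf f0 mg fg; apply: ge0_le_integral => //; try exact/measurable_EFinP.
by move=> x _; rewrite lee_fin.
by move=> x _; rewrite lee_fin fg.
Qed.

Lemma ae_ge0_Rle f g : measurable_fun setT f -> (forall x, 0 <= f x) ->
  measurable_fun setT g -> (forall x, 0 <= g x) -> {ae mu, forall x, f x <= g x} ->
  (\int[mu]_x (f x)%:E <= \int[mu]_x (g x)%:E)%E.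
Proof.
move=> mf f0 mg g0 fg; apply: ae_ge0_le_integral => //; try exact/measurable_EFinP.
by move=> x _; rewrite lee_fin.
by move=> x _; rewrite lee_fin.
by apply: filterS fg => x /= fgx _; rewrite lee_fin.
Qed.

End real_integrable.

Section real_fubini.
Context d1 d2 (T1 : measurableType d1) (T2 : measurableType d2) (R : realType).
Variables (m1 : {sigma_finite_measure set T1 -> \bar R})
          (m2 : {sigma_finite_measure set T2 -> \bar R}).

Lemma integrable_tensor (f : T1 -> R) (g : T2 -> R) :
  m1.-integrable setT (EFin \o f) -> m2.-integrable setT (EFin \o g) ->
  (prodm m1 m2).-integrable setT (fun z => (f z.1 * g z.2)%:E).
Proof.
move=> fi gi; have mf := measurable_int _ fi; have mg := measurable_int _ gi.
have mfg : measurable_fun setT (fun z : T1 * T2 => (f z.1 * g z.2)%:E).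
  apply/measurable_EFinP; apply: measurable_funM.
    by apply: measurableT_comp => //; exact/measurable_EFinP.
  by apply: measurableT_comp => //; exact/measurable_EFinP.
apply/integrableP; split => //.
rewrite tonelli1//; last exact: measurableT_comp.
under eq_integral => x _.
  under eq_integral => y _ do rewrite /= normrM EFinM.
  rewrite ge0_integralZl//; last first.
    by apply/measurable_EFinP; apply: measurableT_comp => //; exact/measurable_EFinP.
  over.
have /integrableP[_ ifoo] := fi; have /integrableP[_ igoo] := gi.
under eq_integral do rewrite muleC.
rewrite ge0_integralZl//.
- by rewrite lte_mul_pinfty// ?integral_ge0// ge0_fin_numE ?integral_ge0.
- by apply/measurable_EFinP; apply: measurableT_comp => //; exact/measurable_EFinP.
- exact: integral_ge0.
Qed.

Variable h : T1 * T2 -> R.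
Hypothesis hi : (prodm m1 m2).-integrable setT (EFin \o h).

Lemma ae_integrable_fst : {ae m1, forall x, m2.-integrable setT (fun y => (h (x, y))%:E)}.
Proof. exact: (ae_integrable1 hi). Qed.

Lemma ae_integrable_snd : {ae m2, forall y, m1.-integrable setT (fun x => (h (x, y))%:E)}.
Proof. exact: (ae_integrable2 hi). Qed.

Lemma integrable_Rint_snd :
  m1.-integrable setT (EFin \o (fun x => \int[m2]_y h (x, y))).
Proof.
have Fi := integrable_fubini_F hi; have mF := measurable_int _ Fi.
apply: le_integrable Fi => //.
  by apply/measurable_EFinP; apply: measurableT_comp mF.
(* [fine] sends infinite values to 0, which can only decrease the absolute value. *)
move=> x _; rewrite /= /Rintegral -/(fubini_F m2 (EFin \o h) x).
by case: (fubini_F _ _ _) => [r||] /=; rewrite ?normr0 ?leey ?lee_fin.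
Qed.

Lemma Rfubini1 : \int[prodm m1 m2]_z h z = \int[m1]_x \int[m2]_y h (x, y).
Proof.
have Fi := integrable_fubini_F hi; have mF := measurable_int _ Fi.
rewrite /Rintegral; congr fine.
rewrite -[LHS](integral12_prod_meas1 hi); apply: ae_eq_integral => //.
  exact: measurable_int integrable_Rint_snd.
have := integrable_ae measurableT Fi; apply: filterS => x /= /(_ I) Fx _.
by rewrite -/(Rintegral m2 setT (fun y => h (x, y))) /Rintegral /= fineK.
Qed.

Lemma integrable_Rint_fst :
  m2.-integrable setT (EFin \o (fun y => \int[m1]_x h (x, y))).
Proof.
have Fi : m2.-integrable setT (fubini_G m1 (EFin \o h)).
  have mh := measurable_int _ hi.
  apply/integrableP; split; first exact: measurable_fubini_G hi.
  have := (integrable21ltyP m1 m2 mh).1 hi; apply: le_lt_trans.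
  apply: ge0_le_integral => //.
  - by apply: measurableT_comp => //; exact: measurable_fubini_G hi.
  - apply: (measurable_fun_fubini_tonelli_G (m1 := m1) (abse \o (EFin \o h))); first exact: measurableT_comp.
    by move=> z; exact: abse_ge0.
  - move=> y _; apply: le_abse_integral => //.
    exact: (measurableT_comp mh (pair2_measurable y)).
have mF := measurable_int _ Fi.
apply: le_integrable Fi => //.
  by apply/measurable_EFinP; apply: measurableT_comp mF.
move=> x _; rewrite /= /Rintegral -/(fubini_G m1 (EFin \o h) x).
by case: (fubini_G _ _ _) => [r||] /=; rewrite ?normr0 ?leey ?lee_fin.
Qed.

Lemma Rfubini2 : \int[prodm m1 m2]_z h z = \int[m2]_y \int[m1]_x h (x, y).
Proof.
rewrite /Rintegral; congr fine.
rewrite -[LHS](integral21_prod_meas1 hi); apply: ae_eq_integral => //.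
- exact: measurable_fubini_G hi.
- exact: measurable_int integrable_Rint_fst.
have := ae_integrable_snd; apply: filterS => x /= ix _.
by rewrite /fubini_G fineK//; exact: integrable_fin_num.
Qed.

End real_fubini.

(** * Integration by parts on a segment *)

Section ibp.
Variable R : realType.
Local Notation mu := (@lebesgue_measure R).

Lemma continuous_integrable (f : R -> R) (a b : R) :
  continuous f -> mu.-integrable `[a, b] (EFin \o f).
Proof.
move=> cf; apply: continuous_compact_integrable; first exact: segment_compact.
exact: continuous_subspaceT.
Qed.

Lemma Rint_derive (F f : R -> R) (a b : R) : a <= b ->
  (forall x : R, is_derive x 1 F (f x)) -> continuous f ->
  \int[mu]_(x in `[a, b]) f x = F b - F a.
Proof.
rewrite le_eqVlt => /predU1P[<- _ _|ab dF cf].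
  by rewrite set_itv1 Rintegral_set1 subrr.
rewrite /Rintegral (@continuous_FTC2 _ f F)//.
- exact: continuous_subspaceT.
- have cF : continuous F.
    move=> x; apply/differentiable_continuous/derivable1_diffP.
    exact: (@ex_derive _ _ _ _ _ _ _ (dF x)).
  split.
  + by move=> x _; exact: (@ex_derive _ _ _ _ _ _ _ (dF x)).
  + by apply: cvg_at_right_filter; exact: cF.
  + by apply: cvg_at_left_filter; exact: cF.
- by move=> x _; rewrite derive1E; exact: (@derive_val _ _ _ _ _ _ _ (dF x)).
Qed.

Lemma Rint_indic (D : set R) (f : R -> R) : measurable D ->
  \int[mu]_x (f x * \1_D x) = \int[mu]_(x in D) f x.
Proof.
move=> mD; rewrite [RHS]Rintegral_mkcond; apply: eq_Rintegral => x _.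
by rewrite patchE indicE; case: (x \in D); rewrite ?mulr1 ?mulr0.
Qed.

Lemma integrable_indic_mul (D : set R) (f : R -> R) : measurable D ->
  mu.-integrable D (EFin \o f) <->
  mu.-integrable setT (EFin \o (fun x => f x * \1_D x)).
Proof.
move=> mD; rewrite (_ : EFin \o (fun x => f x * \1_D x) = (EFin \o f) \_ D); last first.
  apply/funext => x /=; rewrite patchE indicE; case: (x \in D); by rewrite ?mulr1 ?mulr0.
exact: (@integrable_mkcond _ (measurableTypeR R) R mu D (EFin \o f) mD).
Qed.

Variables (p q th dth : R -> R) (a b : R).
Hypotheses (ab : a <= b) (iq : mu.-integrable `[a, b] (EFin \o q)).
Hypothesis pE : forall r, a <= r <= b -> p r = p a + \int[mu]_(x in `[a, r]) q x.
Hypotheses (dthP : forall x : R, is_derive x 1 th (dth x)) (cdth : continuous dth).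

Let cth : continuous th.
Proof.
move=> x; apply/differentiable_continuous/derivable1_diffP.
exact: (@ex_derive _ _ _ _ _ _ _ (dthP x)).
Qed.

(** Both sides are the integral of [dth r * q s] over the triangle [a <= s <= r <= b]. As [p] is
    merely a primitive of an integrable function, Fubini's theorem stands in for the product
    rule. *)
Lemma ibp_double :
  \int[mu]_(r in `[a, b]) (dth r * (p r - p a)) =
  \int[mu]_(s in `[a, b]) (q s * (th b - th s)).
Proof.
pose D r := dth r * \1_`[a, b] r; pose Q s := q s * \1_`[a, b] s.
have mI r : measurable (`[a, r]%classic : set R) by [].
have mJ r : measurable (`[r, b]%classic : set R) by [].
have Di : mu.-integrable setT (EFin \o D).
  exact: ((integrable_indic_mul dth (mI b)).1 (continuous_integrable a b cdth)).
have Qi : mu.-integrable setT (EFin \o Q) by exact: ((integrable_indic_mul q (mI b)).1 iq).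
pose h (z : measurableTypeR R * measurableTypeR R) : R :=
  D z.1 * Q z.2 * (if (z.2 <= z.1 :> R) then 1 else 0).
have DQi := integrable_tensor Di Qi.
have mh : measurable_fun setT h.
  apply: measurable_funM; first by apply/measurable_EFinP; exact: measurable_int DQi.
  apply: measurable_fun_ifT => //.
  by apply: measurable_fun_ler; [exact: measurable_snd|exact: measurable_fst].
have hi : (prodm mu mu).-integrable setT (EFin \o h).
  apply: le_integrable DQi => //; first exact/measurable_EFinP.
  move=> z _; rewrite /h /= lee_fin normrM.
  by case: ifP => _; rewrite ?normr1 ?mulr1// normr0 mulr0.
have := Rfubini1 hi; rewrite (Rfubini2 hi) => /esym.
rewrite -[X in X = _ -> _]/(\int[mu]_x _) -[X in _ = X -> _]/(\int[mu]_x _).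
have -> : \int[mu]_x \int[mu]_y h (x, y) = \int[mu]_(r in `[a, b]) (dth r * (p r - p a)).
  rewrite -[RHS]Rint_indic//; apply: eq_Rintegral => r _.
  rewrite /h /D /=; have [rab|rab] := boolP (r \in `[a, b]%classic); last first.
    rewrite indicE (negbTE rab) mulr0 (mulr0 (_ * _)) /Rintegral.
    by rewrite integral0_eq// => s _; rewrite !mul0r.
  rewrite indicE rab !mulr1.
  move: (rab); rewrite inE /= in_itv/= => /andP[ar rb].
  rewrite (pE (r:=r)) ?ar// addrC addKr -Rint_indic// -RintegralZl//; last first.
    apply: ((integrable_indic_mul q (mI r)).1 _); apply: integrableS iq => //.
    by apply: subset_itvl; rewrite bnd_simp.
  apply: eq_Rintegral => s _; rewrite -mulrA; congr (_ * _).
  rewrite /Q -mulrA; congr (_ * _); rewrite !indicE !mem_setE !in_itv/=.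
  have [as_|] := leP a s; rewrite ?mul0r//=.
  have [sr|] := leP s r; rewrite ?mulr0// (le_trans sr rb) mulr1//.
have -> // : \int[mu]_y \int[mu]_x h (x, y) = \int[mu]_(s in `[a, b]) (q s * (th b - th s)).
rewrite -[RHS]Rint_indic//; apply: eq_Rintegral => s _.
rewrite /h /Q /=; have [sab|sab] := boolP (s \in `[a, b]%classic); last first.
  rewrite indicE (negbTE sab) mulr0 (mulr0 (_ * _)) /Rintegral.
  by rewrite integral0_eq// => r _; rewrite mulr0 mul0r.
rewrite indicE sab !mulr1.
move: (sab); rewrite inE /= in_itv/= => /andP[as_ sb].
rewrite -(Rint_derive sb dthP cdth) -Rint_indic// -RintegralZl//; last first.
  exact: ((integrable_indic_mul dth (mJ s)).1 (continuous_integrable s b cdth)).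
apply: eq_Rintegral => r _; rewrite mulrAC mulrC; congr (_ * _).
rewrite /D -mulrA; congr (_ * _); rewrite !indicE !mem_setE !in_itv/=.
have [sr|rs] := leP s r; rewrite ?mulr0//= mulr1 (le_trans as_ sr)//.
Qed.

Hypothesis cp : continuous p.

Lemma ibp_integrable1 : mu.-integrable `[a, b] (EFin \o (fun x => p x * dth x)).
Proof. by apply: continuous_integrable => x; apply: cvgM; [exact: cp|exact: cdth]. Qed.

Lemma ibp_integrable2 : mu.-integrable `[a, b] (EFin \o (fun x => q x * th x)).
Proof.
apply: (@integrableMl _ (measurableTypeR R) R mu `[a, b]%classic _ (EFin \o q) th) => //.
  exact: measurable_funTS (continuous_measurable_fun cth).
have /compact_bounded[M [_ mrt]] :
    compact (th @` `[a, b]%classic).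
  by apply: continuous_compact; [exact: continuous_subspaceT|exact: segment_compact].
exists (M + 1); split; first by rewrite num_real.
move=> N MN x xab; apply: mrt => //.
  by rewrite (lt_trans _ MN)// ltrDl.
Qed.

Lemma ibp_weak : \int[mu]_(x in `[a, b]) (p x * dth x + q x * th x) =
  p b * th b - p a * th a.
Proof.
have i1 := ibp_integrable1; have i2 := ibp_integrable2.
have ic k : mu.-integrable `[a, b] (EFin \o (fun x => k * dth x)).
  apply: continuous_integrable => x; apply: cvgM; [exact: cvg_cst|exact: cdth].
have iqk k : mu.-integrable `[a, b] (EFin \o (fun x => k * q x)).
  exact: (@integrableZl _ (measurableTypeR R) R mu _ (measurable_itv _) k _ iq).
have := ibp_double.
under eq_Rintegral do rewrite mulrBr [_ * p _]mulrC [_ * p a]mulrC.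
rewrite RintegralB//.
under [RHS]eq_Rintegral do rewrite mulrBr [_ * th b]mulrC.
rewrite [RHS]RintegralB//.
rewrite RintegralZl//; last exact: continuous_integrable.
rewrite RintegralZl// (Rint_derive ab dthP cdth) RintegralD//.
have -> : \int[mu]_(x in `[a, b]) q x = p b - p a.
  by rewrite [p b]pE ?lexx ?ab// addrC addKr.
by lra.
Qed.

End ibp.

(** * One-dimensional logarithmic Sobolev inequality *)

Section lsi_pos.
Variable R : realType.
Local Notation mu := (@lebesgue_measure R).

(** The integrand of the entropy of [a] relative to [b], corrected by the difference of the masses:
    this makes it nonnegative and keeps it homogeneous of degree 1 in [(a, b)]. *)
Definition Kf (a b : R) : R := a * ln (a / b) - a + b.
(** The Fisher integrand when [a] is the density and [c] is [a] times the score. The value 0 at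
    [a = 0] follows the convention of [fisherI]. *)
Definition Ff (a c : R) : R := if a == 0 then 0 else c ^+ 2 / a.

Lemma Kf_ge0 (a b : R) : 0 <= a -> 0 < b -> 0 <= Kf a b.
Proof.
rewrite le_eqVlt => /predU1P[<-|a0] b0.
  by rewrite /Kf mul0r subr0 add0r ltW.
rewrite /Kf -[a / b]invf_div lnV ?posrE ?divr_gt0// mulrN.
have : a * ln (b / a) <= a * (b / a - 1).
  rewrite ler_pM2l// -[X in ln X](subrK 1) addrC.
  by apply: le_ln1Dx; rewrite ltrBrDr addrC subrr divr_gt0.
have -> : a * (b / a - 1) = b - a by field; rewrite gt_eqF.
by lra.
Qed.

Lemma Kf0 (b : R) : Kf 0 b = b. Proof. by rewrite /Kf mul0r subr0 add0r. Qed.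

Lemma Ff_ge0 (a c : R) : 0 <= a -> 0 <= Ff a c.
Proof. by move=> a0; rewrite /Ff; case: ifP => // _; rewrite divr_ge0// sqr_ge0. Qed.

Variables p q : R -> R.
Hypotheses (cp : continuous p) (p_gt0 : forall x, 0 < p x).
Hypotheses (ip : mu.-integrable [set: R] (EFin \o p)).
Hypothesis p1 : (\int[mu]_x (p x)%:E = 1)%E.
Hypothesis mq : measurable_fun [set: R] q.
Hypothesis iq : forall a b, mu.-integrable `[a, b] (EFin \o q).
Hypothesis pE : forall a b, a <= b -> p b = p a + \int[mu]_(x in `[a, b]) q x.

Let S (x : R) : R := (q x + x * p x) ^+ 2 / p x.

Let mp : measurable_fun [set: R] p. Proof. exact: continuous_measurable_fun. Qed.

Let mS : measurable_fun [set: R] S.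
Proof.
apply: measurable_funM.
  apply: measurable_funX; apply: measurable_funD => //.
  by apply: measurable_funM.
apply: continuous_measurable_fun => x.
by apply: cvgV; [rewrite gt_eqF|exact: cp].
Qed.

Let S0 x : 0 <= S x. Proof. by rewrite /S divr_ge0 ?sqr_ge0// ltW. Qed.

Let cln : continuous (fun x => p x * ln (p x / gauss x)).
Proof.
move=> x; have g0 := gauss_gt0 x; apply: cvgM; first exact: cp.
apply: continuous_comp.
  apply: cvgM; first exact: cp.
  by apply: cvgV; [rewrite gt_eqF|exact: continuous_gauss].
by apply: continuous_ln; rewrite divr_gt0.
Qed.

(** Over a segment, [entropy_pointwise] with [c = q] integrates to the variation of [p * disp] plus
    half the Fisher information. The endpoints can be chosen outside [[-n, n]] with a boundary term
    of at most [2 * eta]. *)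
Lemma lsi_pos :
  (\int[mu]_x (Kf (p x) (gauss x))%:E <=
   2^-1%:E * \int[mu]_x ((q x + x * p x) ^+ 2 / p x)%:E)%E.
Proof.
have S0' x : (0 <= (S x)%:E)%E by rewrite lee_fin.
rewrite -[X in (_ * X)%E]/(\int[mu]_x (S x)%:E)%E.
have [->|Jfin] := eqVneq (\int[mu]_x (S x)%:E)%E +oo%E.
  by rewrite mulry gtr0_sg ?invr_gt0// mul1e leey.
have SI : mu.-integrable setT (EFin \o S).
  by apply: (@ge0_integrable _ (measurableTypeR R)) => //; rewrite ltey.
pose J := \int[mu]_x S x.
have JE : (\int[mu]_x (S x)%:E)%E = J%:E by rewrite fineK//; exact: integrable_fin_num.
rewrite JE.
(* Adding [p] leaves [p ln (p / gauss) + gauss], still nonnegative, so that enlarging [[-n, n]] to a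
   segment with good endpoints only increases the integral. *)
pose W x := Kf (p x) (gauss x) + p x.
have W0 x : 0 <= W x by rewrite addr_ge0 ?Kf_ge0 ?gauss_gt0// ltW.
have WE x : W x = p x * ln (p x / gauss x) + gauss x by rewrite /W /Kf; ring.
have cW : continuous W.
  rewrite (_ : W = fun x => p x * ln (p x / gauss x) + gauss x); last exact/funext.
  by move=> x; apply: cvgD; [exact: cln|exact: continuous_gauss].
have mW := continuous_measurable_fun cW.
have mK : measurable_fun setT (fun x => Kf (p x) (gauss x)).
  rewrite (_ : (fun x => _) = (fun x => W x - p x)); last by apply/funext => x; rewrite /W addrK.
  exact: measurable_funB.
have bound eta n : 0 < eta ->
    (\int[mu]_(x in `[(- n%:R)%R, (n%:R)%R]) (W x)%:E <= (2^-1 * J + 1 + 2 * eta)%:E)%E.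
  move=> eta0.
  have [b nb bb] := boundary_right cp p_gt0 ip p1 n%:R eta0.
  have [a na aa] := boundary_left cp p_gt0 ip p1 (- n%:R) eta0.
  have ab : a <= b.
    by rewrite ltW// (lt_trans na)// (le_lt_trans _ nb)// (@le_trans _ _ 0)// oppr_le0.
  have dP := is_derive_disp cp p_gt0 ip p1.
  have cd := continuous_ddisp cp p_gt0 ip p1.
  apply: (@le_trans _ _ (\int[mu]_(x in `[a, b]) (W x)%:E)%E).
    apply: ge0_subset_integral => //.
    - by apply/measurable_funTS/measurable_EFinP.
    - by move=> x _; rewrite lee_fin.
    - by apply: subset_itv; rewrite bnd_simp ltW.
  rewrite -[leLHS]fineK; last first.
    by apply: integrable_fin_num => //; exact: (continuous_integrable a b cW).
  rewrite lee_fin -/(Rintegral mu `[a, b] W).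
  have -> : \int[mu]_(x in `[a, b]) W x =
      \int[mu]_(x in `[a, b]) (p x * ln (p x / gauss x) + gauss x).
    by apply: eq_Rintegral => x _; exact: WE.
  have il := continuous_integrable a b cln.
  have ig := continuous_integrable a b (@continuous_gauss R).
  have i1 : mu.-integrable `[a, b] (EFin \o (fun x => p x * ddisp p x)).
    exact: (ibp_integrable1 _ _ cd cp).
  have i2 : mu.-integrable `[a, b] (EFin \o (fun x => q x * disp p x)).
    exact: (ibp_integrable2 (iq a b) dP).
  have i3 : mu.-integrable `[a, b] (EFin \o (fun x => S x / 2)).
    have : mu.-integrable `[a, b] (EFin \o S) by apply: integrableS SI.
    move/(@integrableZl _ (measurableTypeR R) R mu _ (measurable_itv _) 2^-1).
    by apply: eq_integrable => // x _; rewrite /= mulrC.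
  have i12 : mu.-integrable `[a, b] (EFin \o (fun x => p x * ddisp p x + q x * disp p x)).
    exact: (@integrableD _ (measurableTypeR R) R mu _ _ _ _ i1 i2).
  have i123 : mu.-integrable `[a, b]
      (EFin \o (fun x => p x * ddisp p x + q x * disp p x + S x / 2)).
    exact: (@integrableD _ (measurableTypeR R) R mu _ _ _ _ i12 i3).
  rewrite RintegralD//.
  have : \int[mu]_(x in `[a, b]) (p x * ln (p x / gauss x)) <=
      \int[mu]_(x in `[a, b]) (p x * ddisp p x + q x * disp p x + S x / 2).
    apply: le_Rintegral => // x _; exact: entropy_pointwise.
  rewrite RintegralD// (ibp_weak ab (iq a b) _ dP cd cp); last first.
    by move=> r /andP[ar _]; exact: pE.
  have : \int[mu]_(x in `[a, b]) (S x / 2) <= 2^-1 * J.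
    rewrite -lee_fin EFinM -JE -ge0_integralZl//; last exact/measurable_EFinP.
    rewrite fineK; last by apply: integrable_fin_num.
    under eq_integral do rewrite mulrC EFinM.
    apply: ge0_subset_integral => //.
    - by apply: measurable_funTS; apply/measurable_EFinP; exact: measurable_funM.
    - by move=> x _; rewrite -EFinM lee_fin mulr_ge0.
  have : \int[mu]_(x in `[a, b]) gauss x <= 1.
    rewrite -lee_fin -(integral_gauss R) fineK; last by apply: integrable_fin_num.
    apply: ge0_subset_integral => //.
    - by apply/measurable_EFinP; exact: measurable_gauss.
    - by move=> x _; rewrite lee_fin ltW// gauss_gt0.
  by lra.
have bound2 eta : 0 < eta ->
    (\int[mu]_x (W x)%:E <= (2^-1 * J + 1 + 2 * eta)%:E)%E.
  move=> eta0.
  pose F (n : nat) : set R := `[- n%:R, n%:R]%classic.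
  have UF : \bigcup_n F n = [set: R].
    apply/seteqP; split => // x _; exists (Num.truncn `|x|).+1 => //=.
    by rewrite /F /= in_itv/= -ler_norml; apply/ltW; exact: truncnS_gt.
  have ndF : nondecreasing_seq F.
    by move=> i j ij; apply/subsetPset; apply: subset_itv; rewrite bnd_simp ?lerN2 ler_nat.
  have := @ge0_nondecreasing_set_cvg_integral _ (measurableTypeR R) R F (EFin \o W) mu ndF
    (fun i => measurable_itv _) (fun i => measurable_funTS (measurableT_comp (@EFin_measurable R setT) mW)) (fun i x _ => W0 x).
  rewrite UF => cv; rewrite -(cvg_lim _ cv)//; apply: lime_le.
    by apply/cvg_ex; eexists; exact: cv.
  by apply: nearW => n; exact: bound.
(* [W] exceeds [Kf] by [p], of integral 1; the same 1 comes on the right from the integral of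
   [gauss], and both cancel. *)
have : (\int[mu]_x (Kf (p x) (gauss x))%:E + 1 <= 2^-1%:E * J%:E + 1)%E.
  have K0 x : 0 <= Kf (p x) (gauss x) by rewrite Kf_ge0 ?gauss_gt0// ltW.
  rewrite -[X in (_ + X <= _)%E]p1.
  rewrite -(@ge0_RD _ (measurableTypeR R) R mu _ _ mK K0 mp (fun x => ltW (p_gt0 x))).
  apply/lee_addgt0Pr => e e0.
  have e20 : 0 < e / 2 by rewrite divr_gt0.
  apply: (le_trans (bound2 _ e20)).
  have -> : 2 * (e / 2) = e by field.
  by rewrite !EFinD EFinM.
by rewrite leeD2rE.
Qed.

End lsi_pos.

(** Inversion is continuous away from 0, and the single point 0 is harmless. *)
Lemma measurable_inv (R : realType) : measurable_fun setT (@GRing.inv R).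
Proof.
have -> : [set: R] = [set 0] `|` ~` [set 0] by rewrite setUv.
apply/measurable_funU => //; first exact: measurableC.
split; first exact: measurable_fun_set1.
apply: open_continuous_measurable_fun => //; first by apply: closed_openC; apply: accessible_closed_set1; apply: hausdorff_accessible; exact: Rhausdorff.
by move=> x; rewrite inE /= => /eqP x0; exact: inv_continuous.
Qed.

Section lsi1.
Variable R : realType.
Local Notation mu := (@lebesgue_measure R).

(** Mixing lowers the relative entropy by no more than the entropy of the weights: [(1 - e) a] and
    [e b] are both at most the mixture [m], and the logarithm is increasing. *)
Lemma Kf_mix (e a b : R) : 0 < e < 1 -> 0 <= a -> 0 < b ->
  (1 - e) * Kf a b <=
  Kf ((1 - e) * a + e * b) b - (1 - e) * ln (1 - e) * a - e * ln e * b.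
Proof.
move=> /andP[e0 e1] a0 b0; have e10 : 0 < 1 - e by rewrite subr_gt0.
set m := (1 - e) * a + e * b.
have m0 : 0 < m by rewrite ltr_wpDl ?mulr_ge0 ?mulr_gt0// ltW.
have h2 : e * b * ln e <= e * b * ln (m / b).
  rewrite ler_pM2l ?mulr_gt0// ler_ln ?posrE ?divr_gt0// ler_pdivlMr//.
  by rewrite lerDr mulr_ge0// ltW.
have h1 : (1 - e) * a * ln ((1 - e) * (a / b)) <= (1 - e) * a * ln (m / b).
  move: a0; rewrite le_eqVlt => /predU1P[<-|a0]; first by rewrite mulr0 !mul0r.
  rewrite ler_pM2l ?mulr_gt0// ler_ln ?posrE ?mulr_gt0 ?invr_gt0//.
  by rewrite mulrA ler_pM2r ?invr_gt0// lerDl mulr_ge0// ltW.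
have h3 : (1 - e) * a * ln ((1 - e) * (a / b)) =
    (1 - e) * a * ln (1 - e) + (1 - e) * (a * ln (a / b)).
  move: a0; rewrite le_eqVlt => /predU1P[<-|a0]; first by rewrite !(mulr0,mul0r) addr0.
  by rewrite [ln ((1 - e) * _)]lnM ?posrE ?divr_gt0// mulrDr mulrA.
have mE : m * ln (m / b) = (1 - e) * a * ln (m / b) + e * b * ln (m / b).
  by rewrite -mulrDl.
rewrite /Kf mE; move: h1 h2; rewrite h3.
set X := (1 - e) * a * ln (m / b); set Y := e * b * ln (m / b).
set Z := a * ln (a / b); rewrite /m.
by set U := ln e; set V := ln (1 - e); lra.
Qed.

(** The weight [t ^+ 2] instead of [t] absorbs the logarithm: [- ln t <= t^-1 - 1] yields a bound
    that is linear in [t]. *)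
Lemma entropy_bound (t : R) : 0 < t < 1 ->
  - ((1 - t ^+ 2) * ln (1 - t ^+ 2)) - t ^+ 2 * ln (t ^+ 2) <= 3 * t.
Proof.
move=> /andP[t0 t1].
have t20 : 0 < t ^+ 2 by rewrite exprn_gt0.
have t21 : 0 < 1 - t ^+ 2 by rewrite subr_gt0 expr_lt1// ltW.
have lnV_le (y : R) : 0 < y -> - ln y <= y^-1 - 1.
  move=> y0; rewrite -lnV ?posrE// -[X in ln X](subrK 1) addrC.
  by apply: le_ln1Dx; rewrite ltrBrDr addrC subrr invr_gt0.
have h1 : - ((1 - t ^+ 2) * ln (1 - t ^+ 2)) <= t ^+ 2.
  rewrite -mulrN; apply: (@le_trans _ _ ((1 - t ^+ 2) * ((1 - t ^+ 2)^-1 - 1))).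
    by rewrite ler_pM2l// lnV_le.
  by rewrite mulrBr divff ?gt_eqF// mulr1 subKr.
have h2 : - (t ^+ 2 * ln (t ^+ 2)) <= 2 * t - 2 * t ^+ 2.
  rewrite lnXn// -mulrN -mulNrn.
  apply: (@le_trans _ _ (t ^+ 2 * ((t^-1 - 1) *+ 2))).
    by rewrite ler_pM2l// lerMn2r lnV_le// orbT.
  by rewrite le_eqVlt; apply/orP; left; apply/eqP; field; rewrite gt_eqF.
have t2t : t ^+ 2 <= t by rewrite expr2 ger_pMl// ltW.
by lra.
Qed.

Variables p q : R -> R.
Hypotheses (mp : measurable_fun setT p) (p0 : forall x, 0 <= p x).
Hypotheses (ip : mu.-integrable setT (EFin \o p)) (iq : mu.-integrable setT (EFin \o q)).
Hypothesis pq0 : forall x, p x = 0 -> q x = 0.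
Hypothesis pE : {ae mu, forall x, p x = \int[mu]_(t in `]-oo, x]) q t}.

(** The continuous representative of [p]. *)
Let pt (x : R) : R := \int[mu]_(t in `]-oo, x]) q t.

Let mq : measurable_fun setT q. Proof. exact: (Rintegrable_measurable iq). Qed.

Let iqS (A : set R) : measurable A -> mu.-integrable A (EFin \o q).
Proof. by move=> mA; apply: integrableS iq. Qed.

Let ptB a b : a <= b -> pt b = pt a + \int[mu]_(x in `[a, b]) q x.
Proof.
move=> ab; have := @Rintegral_itvB _ q -oo%O (BRight b) a (iqS (measurable_itv _)) isT.
rewrite bnd_simp => /(_ ab); rewrite -/(pt b) -/(pt a) Rintegral_itv_obnd_cbnd.
  by move=> <-; rewrite addrC subrK.
exact: iqS.
Qed.

Let cpt : continuous pt.
Proof.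
move=> x.
have x1 : x - 1 < x + 1 by rewrite ltrBlDr -addrA ltrDl.
have := parameterized_integral_continuous (ltW x1) (iqS (measurable_itv `[x - 1, x + 1])).
move=> /(continuous_within_itvP _ x1)[+ _ _] => /(_ x).
rewrite in_itv/= ltrBlDr !ltrDl ltr01 /= => /(_ isT) c.
have c' : pt (x - 1) + parameterized_integral mu (x - 1) y q @[y --> x] -->
    pt (x - 1) + parameterized_integral mu (x - 1) x q.
  by apply: cvgD; [exact: cvg_cst|exact: c].
have ptx : pt x = pt (x - 1) + parameterized_integral mu (x - 1) x q.
  by apply: ptB; rewrite lerBlDr lerDl.
rewrite /continuous_at ptx; apply: cvg_trans c'; apply: near_eq_cvg; near=> y.
apply/esym/ptB/ltW; near: y; apply: lt_nbhsr; by rewrite ltrBlDr ltrDl.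
Unshelve. all: by end_near. Qed.

(** By continuity a negative value would persist on a ball, which is not negligible, whereas [pt]
    agrees almost everywhere with the nonnegative [p]. *)
Let pt0 x : 0 <= pt x.
Proof.
rewrite leNgt; apply/negP => ptx.
have /cvgrPdist_lt /(_ (- pt x)) := @cpt x.
rewrite oppr_gt0 => /(_ ptx) [r /= r0 rP].
have : mu.-negligible (ball x r).
  apply: negligibleS pE => y xy /= pyE.
  have := rP y xy; rewrite /= distrC => /(le_lt_trans (ler_norm _)).
  by rewrite ltrBlDr addNr /pt -pyE ltNge p0.
move=> /((negligibleP mu (measurable_ball x r)).1) h.
have : (r *+ 2)%:E = 0%E by rewrite -(lebesgue_measure_ball x (ltW r0)); exact: h.
by move=> [] /eqP; rewrite mulrn_eq0/= gt_eqF.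
Qed.

Let ptp : {ae mu, forall x, p x = pt x} := pE.

Let mpt : measurable_fun setT pt. Proof. exact: continuous_measurable_fun. Qed.

Let ipt : mu.-integrable setT (EFin \o pt).
Proof. exact: (@ae_eq_integrable _ (measurableTypeR R) R mu p pt mpt ptp ip). Qed.

Let P : R := \int[mu]_x p x.

Let PE : \int[mu]_x pt x = P.
Proof. by apply/esym; exact: (@ae_eq_Rintegral _ (measurableTypeR R) R mu p pt mp mpt ptp). Qed.

Let J := (\int[mu]_x (Ff (p x) (q x + x * p x))%:E)%E.

Lemma measurable_Ff d (T : measurableType d) (a c : T -> R) :
  measurable_fun setT a -> measurable_fun setT c ->
  measurable_fun setT (fun x => Ff (a x) (c x)).
Proof.
move=> ma mc; apply: measurable_fun_ifT => //.
  exact: measurable_fun_eqr.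
apply: measurable_funM; first exact: measurable_funX.
exact: (measurableT_comp (@measurable_inv R) ma).
Qed.

Lemma measurable_Kf d (T : measurableType d) (a b : T -> R) :
  measurable_fun setT a -> measurable_fun setT b ->
  measurable_fun setT (fun x => Kf (a x) (b x)).
Proof.
move=> ma mb; apply: measurable_funD => //; apply: measurable_funB => //.
apply: measurable_funM => //; apply: (measurableT_comp (@measurable_ln R)).
apply: measurable_funM => //.
exact: (measurableT_comp (@measurable_inv R) mb).
Qed.

Let mJ : measurable_fun setT (fun x => Ff (p x) (q x + x * p x)).
Proof. by apply: measurable_Ff => //; apply: measurable_funD => //; exact: measurable_funM. Qed.

Let J0 : (0 <= J)%E.
Proof. by apply: integral_ge0 => x _; rewrite lee_fin Ff_ge0. Qed.

(* The mixture of [p] with the Gaussian of the same mass is positive, so that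
   [lsi_pos] applies; [e] then tends to 0. *)
Section mixture.
Hypothesis P_gt0 : 0 < P.
Variable e : R.
Hypothesis e01 : 0 < e < 1.

Let e0 : 0 < e. Proof. by case/andP: e01. Qed.
Let e1 : 0 < 1 - e. Proof. by case/andP: e01; rewrite subr_gt0. Qed.

Let pe (x : R) : R := (1 - e) * (pt x / P) + e * gauss x.
Let qe (x : R) : R := (1 - e) / P * q x + e * (- x * gauss x).

Let pe_gt0 x : 0 < pe x.
Proof.
apply: ltr_wpDl; last by rewrite mulr_gt0 ?gauss_gt0.
by rewrite mulr_ge0 ?divr_ge0// ltW.
Qed.

Let cpe : continuous pe.
Proof.
move=> x; apply: cvgD; apply: cvgM; try exact: cvg_cst; last exact: continuous_gauss.
by apply: cvgM; [exact: cpt|exact: cvg_cst].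
Qed.

Let ipe1 : mu.-integrable setT (EFin \o (fun x => (1 - e) * (pt x / P))).
Proof.
apply: (@RintegrableZ _ (measurableTypeR R)).
under eq_fun do rewrite mulrC.
exact: (@RintegrableZ _ (measurableTypeR R)).
Qed.

Let ipe2 : mu.-integrable setT (EFin \o (fun x => e * gauss x)).
Proof. by apply: (@RintegrableZ _ (measurableTypeR R)); exact: integrable_gauss. Qed.

Let ipe : mu.-integrable setT (EFin \o pe).
Proof. exact: (@RintegrableD _ (measurableTypeR R)). Qed.

Let intptP : (\int[mu]_x (pt x / P)%:E = 1)%E.
Proof.
under eq_integral do rewrite mulrC EFinM.
rewrite integralZl// (@RintegralE _ (measurableTypeR R))// PE -EFinM mulVf// gt_eqF//.
Qed.

Let mptP : measurable_fun setT (fun x => pt x / P). Proof. exact: measurable_funM. Qed.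

Let ptP0 x : 0 <= pt x / P. Proof. by rewrite divr_ge0// ltW. Qed.

Let g0 x : 0 <= gauss x :> R. Proof. by rewrite ltW// gauss_gt0. Qed.

Let mg := @measurable_gauss R.

Let leZl := @ge0_RZl _ (measurableTypeR R) R mu.
Let leD := @ge0_RD _ (measurableTypeR R) R mu.

Let lin_int (u v : R) : 0 <= u -> 0 <= v ->
  (\int[mu]_x (u * (pt x / P) + v * gauss x)%:E = (u + v)%:E)%E.
Proof.
move=> u0 v0; rewrite leD//.
- by rewrite (leZl mptP ptP0 u0) (leZl mg g0 v0) intptP integral_gauss !mule1.
- exact: measurable_funM.
- by move=> x; rewrite mulr_ge0.
- exact: measurable_funM.
- by move=> x; rewrite mulr_ge0.
Qed.

Let pe1 : (\int[mu]_x (pe x)%:E = 1)%E.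
Proof. by rewrite lin_int ?subrK// ltW. Qed.

Let cxg : continuous (fun x : R => - x * gauss x).
Proof.
by move=> x; apply: cvgM; [apply: cvgN; exact: cvg_id|exact: continuous_gauss].
Qed.

Let mqe : measurable_fun setT qe.
Proof.
apply: measurable_funD; apply: measurable_funM => //.
exact: continuous_measurable_fun.
Qed.

Let iqeS a b : mu.-integrable `[a, b] (EFin \o qe).
Proof.
apply: (@integrableD _ (measurableTypeR R) R mu _ (measurable_itv _)
  (EFin \o (fun x => (1 - e) / P * q x)) (EFin \o (fun x => e * (- x * gauss x)))).
  exact: (@integrableZl _ (measurableTypeR R) R mu _ (measurable_itv _) _ _ (iqS (measurable_itv _))).
by apply: continuous_integrable => x; apply: cvgM; [exact: cvg_cst|exact: cxg].
Qed.

Let peB a b : a <= b -> pe b = pe a + \int[mu]_(x in `[a, b]) qe x.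
Proof.
move=> ab; rewrite RintegralD//; last 2 first.
- exact: (@integrableZl _ (measurableTypeR R) R mu _ (measurable_itv _) _ _ (iqS (measurable_itv _))).
- by apply: continuous_integrable => x; apply: cvgM; [exact: cvg_cst|exact: cxg].
have iqab : mu.-integrable `[a, b] (EFin \o q) := iqS (measurable_itv _).
have igab := continuous_integrable a b cxg.
rewrite RintegralZl//.
rewrite RintegralZl//.
rewrite (Rint_derive ab (@is_derive_gauss R) cxg) /pe (ptB ab).
by field; rewrite gt_eqF.
Qed.

(** Relative to the Gaussian, the Gaussian part has score zero. Hence the mixture multiplies
    [q + x p] by [(1 - e) / P] while its density is at least [(1 - e) / P] times [p]: its Fisher
    information is at most that of [p / P]. The entropy side is [Kf_mix]. *)
Lemma mixture_bound : ((1 - e)%:E * \int[mu]_x (Kf (pt x / P) (gauss x))%:E <=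
  (2^-1 * P^-1)%:E * J + (- ((1 - e) * ln (1 - e)) - e * ln e)%:E)%E.
Proof.
have mpe : measurable_fun setT pe by exact: continuous_measurable_fun.
have h1 : 0 <= - ((1 - e) * ln (1 - e)).
  by rewrite -mulrN mulr_ge0 ?oppr_ge0 ?ln_le0 ?gerBl// ltW.
have h2 : 0 <= - (e * ln e).
  by rewrite -mulrN mulr_ge0 ?oppr_ge0 ?ln_le0// ltW//; case/andP: e01.
have K0 x : 0 <= Kf (pt x / P) (gauss x) by rewrite Kf_ge0 ?gauss_gt0.
have Ke0 x : 0 <= Kf (pe x) (gauss x) by rewrite Kf_ge0 ?gauss_gt0// ltW.
have mK : measurable_fun setT (fun x => Kf (pt x / P) (gauss x)) by exact: measurable_Kf.
have mKe : measurable_fun setT (fun x => Kf (pe x) (gauss x)) by exact: measurable_Kf.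
pose lin x := - ((1 - e) * ln (1 - e)) * (pt x / P) + - (e * ln e) * gauss x.
have mlin : measurable_fun setT lin by apply: measurable_funD; exact: measurable_funM.
have lin0 x : 0 <= lin x by rewrite addr_ge0// mulr_ge0.
rewrite -(leZl mK K0 (ltW e1)).
apply: (@le_trans _ _ (\int[mu]_x (Kf (pe x) (gauss x) + lin x)%:E)%E).
  apply: (@ge0_Rle _ (measurableTypeR R)).
  - exact: measurable_funM.
  - by move=> x; rewrite mulr_ge0// ltW.
  - exact: measurable_funD.
  - move=> x; have := Kf_mix e01 (ptP0 x) (gauss_gt0 x); rewrite -/(pe x) => /le_trans; apply.
    by rewrite -addrA /lin !mulNr.
rewrite (leD mKe Ke0 mlin lin0) (lin_int h1 h2); apply: leeD2r.
apply: le_trans (lsi_pos cpe pe_gt0 ipe pe1 mqe iqeS peB) _.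
rewrite EFinM -muleA; apply: lee_wpmul2l; first by rewrite lee_fin invr_ge0.
have iP0 : 0 <= P^-1 by rewrite invr_ge0 ltW.
rewrite -(leZl mJ (fun x => Ff_ge0 _ (p0 x)) iP0).
apply: (@ae_ge0_Rle _ (measurableTypeR R)).
- apply: measurable_funM.
    by apply: measurable_funX; apply: measurable_funD => //; exact: measurable_funM.
  exact: (measurableT_comp (@measurable_inv R) mpe).
- by move=> x; rewrite divr_ge0 ?sqr_ge0// ltW.
- exact: measurable_funM.
- by move=> x; rewrite mulr_ge0 ?Ff_ge0.
apply: (@ae_imp _ (measurableTypeR R) R mu _ _ ptp) => x px.
have -> : qe x + x * pe x = (1 - e) / P * (q x + x * p x).
  by rewrite /qe /pe px; field; rewrite gt_eqF.
rewrite /Ff; case: ifPn => [/eqP pz|pn0].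
  by rewrite pq0// pz !mulr0 addr0 mulr0 expr0n mul0r.
have px0 : 0 < p x by rewrite lt_neqAle eq_sym pn0 p0.
set c := q x + x * p x.
have k0 : 0 < (1 - e) / P by rewrite divr_gt0.
apply: (@le_trans _ _ (((1 - e) / P * c) ^+ 2 / ((1 - e) / P * p x))).
  apply: ler_wpM2l; first exact: sqr_ge0.
  rewrite lef_pV2; [|by rewrite posrE|by rewrite posrE mulr_gt0].
  rewrite px /pe.
  have -> : (1 - e) / P * pt x = (1 - e) * (pt x / P) by rewrite mulrAC mulrA.
  by rewrite lerDl mulr_ge0 ?ltW// gauss_gt0.
have -> : ((1 - e) / P * c) ^+ 2 / ((1 - e) / P * p x) = (1 - e) * (P^-1 * (c ^+ 2 / p x)).
  by field; rewrite !gt_eqF.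
apply: ler_piMl; last by rewrite gerBl ltW.
by rewrite mulr_ge0// divr_ge0 ?sqr_ge0// ltW.
Qed.

End mixture.

Lemma lsi1 : (\int[mu]_x (Kf (p x) (P * gauss x))%:E <=
  2^-1%:E * \int[mu]_x (Ff (p x) (q x + x * p x))%:E)%E.
Proof.
have mPg : measurable_fun setT (fun x => P * gauss x).
  by apply: measurable_funM => //; exact: measurable_gauss.
have P0 : 0 <= P by exact: Rintegral_ge0.
have [Pz|Pn0] := eqVneq P 0.
  rewrite (_ : integral _ _ _ = 0)%E ?mule_ge0 ?lee_fin ?invr_ge0//.
  rewrite -[RHS](@integral0 _ (measurableTypeR R) R mu setT).
  apply: ae_eq_integral => //.
    by apply/measurable_EFinP; exact: measurable_Kf.
  have mEp : measurable_fun setT (EFin \o p) by exact/measurable_EFinP.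
  have := (@ae_eq_integral_abs _ (measurableTypeR R) R mu setT measurableT _ mEp).1.
  have -> : (\int[mu]_x `|(EFin \o p) x| = 0)%E.
    rewrite -[RHS]/(0%:E) -Pz /P -(@RintegralE _ (measurableTypeR R))//.
    by apply: eq_integral => x _; rewrite /= ger0_norm.
  move=> /(_ erefl) /(@ae_imp _ (measurableTypeR R) R mu); apply => x /= /(_ I)[] px _.
  by rewrite px Pz mul0r Kf0.
have P_gt0 : 0 < P by rewrite lt_neqAle eq_sym Pn0.
rewrite -/J; have [->|Jfin] := eqVneq J +oo%E.
  by rewrite mulry gtr0_sg ?invr_gt0// mul1e leey.
have [j jE] : exists j, J = j%:E.
  by exists (fine J); rewrite fineK// ge0_fin_numE// ltey.
have j0 : 0 <= j by rewrite -lee_fin -jE.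
pose X := (\int[mu]_x (Kf (pt x / P) (gauss x))%:E)%E.
have ptP0 x : 0 <= pt x / P by rewrite divr_ge0.
have mptP : measurable_fun setT (fun x => pt x / P) by exact: measurable_funM.
have K0 x : 0 <= Kf (pt x / P) (gauss x) by rewrite Kf_ge0 ?gauss_gt0.
have mK : measurable_fun setT (fun x => Kf (pt x / P) (gauss x)).
  by apply: measurable_Kf => //; exact: measurable_gauss.
have X0 : (0 <= X)%E by apply: integral_ge0 => x _; rewrite lee_fin.
have Xt (t : R) : 0 < t < 1 ->
    ((1 - t ^+ 2)%:E * X <= (2^-1 * P^-1 * j + 3 * t)%:E)%E.
  move=> t01; have /andP[t0 t1] := t01.
  have e01 : 0 < t ^+ 2 < 1 by rewrite exprn_gt0//= expr_lt1// ltW.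
  apply: le_trans (mixture_bound P_gt0 e01) _.
  by rewrite jE -EFinM -EFinD lee_fin lerD2l entropy_bound.
have [x xE] : exists x, X = x%:E.
  exists (fine X); rewrite fineK// ge0_fin_numE//.
  (* The single value [t = 1/2] already shows that [X] is finite. *)
  have h0 : (0 : R) < 2^-1 by rewrite invr_gt0.
  have h1 : (2^-1 : R) < 1 by rewrite invf_lt1// ltr1n.
  have := Xt 2^-1; rewrite h0 h1 => /(_ isT); rewrite ltNge leye_eq.
  apply: contraL => /eqP ->; rewrite mulry gtr0_sg ?mul1e ?leye_eq//.
  by rewrite subr_gt0 expr_lt1// ltW.
have x0 : 0 <= x by rewrite -lee_fin -xE.
have xle : x <= 2^-1 * P^-1 * j.
  set Y := 2^-1 * P^-1 * j; rewrite leNgt; apply/negP => Yx.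
  have Y0 : 0 <= Y by rewrite !mulr_ge0// invr_ge0.
  (* Chosen so that [t * (x + 3) = (x - Y) / 2]: as [t ^+ 2 <= t], the bound
     [(1 - t ^+ 2) x <= Y + 3 t] would give [x - Y <= (x - Y) / 2]. *)
  pose t := (x - Y) / (2 * (x + 3)).
  have x3 : 0 < x + 3 by rewrite ltr_wpDl.
  have t0 : 0 < t by rewrite divr_gt0 ?subr_gt0// mulr_gt0.
  have t1 : t < 1.
    by rewrite ltr_pdivrMr ?mulr_gt0// mul1r; lra.
  have := Xt t; rewrite t0 t1 => /(_ isT); rewrite xE -EFinM lee_fin.
  have t2 : t ^+ 2 * x <= t * x by rewrite ler_wpM2r// expr2 ger_pMl// ltW.
  have te : t * (x + 3) = (x - Y) / 2 by rewrite /t; field; rewrite gt_eqF.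
  rewrite -/Y [(1 - _) * x]mulrBl mul1r; move: te t2; rewrite mulrDr.
  by set A := t ^+ 2 * x; set B := t * x; lra.
(* Homogeneity of [Kf] undoes the normalisation by the mass [P]. *)
have -> : (\int[mu]_x (Kf (p x) (P * gauss x))%:E = P%:E * X)%E.
  rewrite -(@ge0_RZl _ (measurableTypeR R))//.
  apply: ae_eq_integral => //.
  - by apply/measurable_EFinP; exact: measurable_Kf.
  - by apply/measurable_EFinP; exact: measurable_funM.
  apply: (@ae_imp _ (measurableTypeR R) R mu _ _ ptp) => y /= -> _; rewrite /Kf invfM mulrA; congr (_%:E).
  by rewrite !mulrDr mulrN !mulrA [P * pt y]mulrC mulfK.
rewrite xE jE -!EFinM lee_fin.
apply: (@le_trans _ _ (P * (2^-1 * P^-1 * j))); first by rewrite ler_pM2l.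
by rewrite le_eqVlt; apply/orP; left; apply/eqP; field.
Qed.

End lsi1.

(** * Smooth bumps *)

Section smooth1.
Variable R : realType.
Implicit Types f g : R -> R.
Local Notation mu := (@lebesgue_measure R).

Lemma is_derive1P f (x : R) : derivable f x 1 -> is_derive x 1 f (derive1 f x).
Proof. by move=> /derivableP; rewrite derive1E. Qed.

Lemma derive1_eq f (x df : R) : is_derive x 1 f df -> derive1 f x = df.
Proof. by move=> h; rewrite derive1E; exact: (@derive_val _ _ _ _ _ _ _ h). Qed.

Lemma is_derive_derivable f (x df : R) : is_derive x 1 f df -> derivable f x 1.
Proof. by move=> h; exact: (@ex_derive _ _ _ _ _ _ _ h). Qed.

Lemma derivable_continuous1 f : (forall x : R, derivable f x 1) -> continuous f.
Proof. by move=> df x; apply/differentiable_continuous/derivable1_diffP. Qed.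

Fixpoint smoothk (k : nat) f : Prop :=
  match k with
  | 0 => continuous f
  | k'.+1 => (forall x : R, derivable f x 1) /\ smoothk k' (derive1 f)
  end.

Definition smooth f := forall k, smoothk k f.

Lemma smooth_derivable f : smooth f -> forall x : R, derivable f x 1.
Proof. by move=> /(_ 1%N)[]. Qed.

Lemma smooth_continuous f : smooth f -> continuous f.
Proof. by move=> /(_ 0%N). Qed.

Lemma smooth_derive f : smooth f -> smooth (derive1 f).
Proof. by move=> sf k; have [] := sf k.+1. Qed.

Lemma smoothkS k f : smoothk k.+1 f -> smoothk k f.
Proof.
elim: k f => [|k IHk] f [df sf]; first exact: derivable_continuous1.
by split => //; exact: IHk.
Qed.

Lemma smoothkD k f g : smoothk k f -> smoothk k g -> smoothk k (fun x => f x + g x).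
Proof.
elim: k f g => [|k IHk] f g.
  by move=> cf cg x; apply: cvgD; [exact: cf|exact: cg].
move=> [df sf] [dg sg].
have dfg (x : R) : is_derive x 1 (fun x => f x + g x) (derive1 f x + derive1 g x).
  by apply: is_deriveD; exact: is_derive1P.
split; first by move=> x; exact: is_derive_derivable (dfg x).
rewrite (_ : derive1 _ = fun x => derive1 f x + derive1 g x); first exact: IHk.
by apply/funext => x; exact: derive1_eq.
Qed.

Lemma smoothkM k f g : smoothk k f -> smoothk k g -> smoothk k (fun x => f x * g x).
Proof.
elim: k f g => [|k IHk] f g.
  by move=> cf cg x; apply: cvgM; [exact: cf|exact: cg].
move=> /[dup] /smoothkS sf' [df sf] /[dup] /smoothkS sg' [dg sg].
have dfg (x : R) : is_derive x 1 (fun x => f x * g x) (derive1 f x * g x + f x * derive1 g x).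
  have := is_deriveM (is_derive1P (df x)) (is_derive1P (dg x)).
  by move=> h; apply: (is_derive_eq h); rewrite /GRing.scale /= addrC [g x * _]mulrC.
split; first by move=> x; exact: is_derive_derivable (dfg x).
rewrite (_ : derive1 _ = fun x => derive1 f x * g x + f x * derive1 g x).
  by apply: smoothkD; exact: IHk.
by apply/funext => x; exact: derive1_eq.
Qed.

Lemma smoothk_affine k f (c a b : R) : smoothk k f -> smoothk k (fun x => c * f (a * x + b)).
Proof.
elim: k f c => [|k IHk] f c.
  move=> cf x; apply: cvgM; first exact: cvg_cst.
  apply: (@continuous_comp _ _ _ (fun x => a * x + b) f); last exact: cf.
  by apply: cvgD; [apply: cvgM; [exact: cvg_cst|exact: cvg_id]|exact: cvg_cst].
move=> [df sf].
have dfa (x : R) : is_derive x 1 (fun x => c * f (a * x + b)) (c * a * derive1 f (a * x + b)).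
  have h1 : is_derive x 1 (fun x : R => a * x + b) a.
    by apply: is_derive_eq; rewrite /GRing.scale /=; ring.
  have h2 := @is_derive1_comp _ f (fun x : R => a * x + b) x _ _ (is_derive1P (df (a * x + b))) h1.
  have h3 := is_deriveZ c h2.
  by apply: (is_derive_eq h3); rewrite /GRing.scale /=; ring.
split; first by move=> x; exact: is_derive_derivable (dfa x).
rewrite (_ : derive1 _ = fun x => c * a * derive1 f (a * x + b)); first exact: IHk.
by apply/funext => x; exact: derive1_eq.
Qed.

Lemma smoothM f g : smooth f -> smooth g -> smooth (fun x => f x * g x).
Proof. by move=> sf sg k; exact: smoothkM. Qed.

Lemma smoothB f g : smooth f -> smooth g -> smooth (fun x => f x - g x).
Proof.
move=> sf sg k; apply: smoothkD; first exact: sf.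
have := smoothk_affine (-1) 1 0 (sg k).
by congr smoothk; apply/funext => x; rewrite mulN1r mul1r addr0.
Qed.

Lemma smooth_affine f (a b : R) : smooth f -> smooth (fun x => f (a * x + b)).
Proof.
move=> sf k; have := smoothk_affine 1 a b (sf k).
by congr smoothk; apply/funext => x; rewrite mul1r.
Qed.

(** For [n = 0] this is the classical flat function [exp (- 1 / x)]. The factors [x ^- n] make the
    span of the family stable under derivation, so that smoothness is an induction over all [n] at
    once. *)
Definition flat (n : nat) (x : R) : R := if 0 < x then x ^- n * expR (- x^-1) else 0.

Lemma flat_ge0 n x : 0 <= flat n x.
Proof.
by rewrite /flat; case: ifP => // x0; rewrite mulr_ge0 ?expR_ge0// invr_ge0 exprn_ge0 ?ltW.
Qed.

(** One term of the exponential series at [x^-1] is enough: [exp y >= y^(n+2) / (n+2)!]. The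
    quadratic bound makes the derivative at 0 vanish. *)
Lemma flat_bound n (x : R) : 0 < x -> flat n x <= (n.+2)`!%:R * x ^+ 2.
Proof.
move=> x0; rewrite /flat x0 expRN.
have y0 : 0 < x^-1 by rewrite invr_gt0.
have := expR_ge1Dxn n.+1 (ltW y0).
set F := (n.+2)`!%:R; have F0 : 0 < F :> R by rewrite ltr0n fact_gt0.
move=> h; have h' : x^-1 ^+ n.+2 / F <= expR x^-1.
  by apply: le_trans h; rewrite lerDr.
have e0 := expR_gt0 x^-1.
rewrite ler_pdivrMr//; apply: (@le_trans _ _ (F * x ^+ 2 * (x^-1 ^+ n.+2 / F))); last first.
  by rewrite ler_pM2l// mulr_gt0// exprn_gt0.
rewrite le_eqVlt; apply/orP; left; apply/eqP.
have -> : x^-1 ^+ n.+2 = x ^- n * x ^- 2 by rewrite exprVn -addn2 exprD invfM.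
set X := x ^- n; field.
by rewrite !gt_eqF.
Qed.

Lemma is_derive_flat n (x : R) :
  is_derive x 1 (flat n) (flat n.+2 x - n%:R * flat n.+1 x).
Proof.
have [x0|x0|->] := ltgtP x 0.
- rewrite /flat !ltNge !(ltW x0)/= mulr0 subr0.
  have h : is_derive x 1 (fun _ : R => 0 : R) 0 by exact: is_derive_cst.
  apply: (near_eq_is_derive _ h).
  near=> y; rewrite ifF//; apply/negbTE; rewrite -leNgt ltW//.
  by near: y; exact: lt_nbhsl.
- have xn0 : x != 0 by rewrite gt_eqF.
  have h1 : is_derive x 1 (fun y : R => y^-1) (- x ^- 2).
    apply: is_derive_eq; first exact: (is_deriveV xn0 (is_derive_id x 1)).
    by rewrite /GRing.scale/= mulr1.
  have h2 : is_derive x 1 (fun y : R => expR (- y^-1)) (expR (- x^-1) * x ^- 2).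
    have := @is_derive1_comp _ expR (fun y : R => - y^-1) x _ _ (is_derive_expR (- x^-1)) (is_deriveN h1).
    by rewrite opprK.
  have h3 : is_derive x 1 (fun y : R => (y^-1) ^+ n * expR (- y^-1))
      (flat n.+2 x - n%:R * flat n.+1 x).
    have E m : is_derive x 1 (fun y : R => (y^-1) ^+ m * expR (- y^-1))
        ((x^-1 ^+ m.+2 - m%:R * x^-1 ^+ m.+1) * expR (- x^-1)).
      elim: m => [|m IHm].
        rewrite (_ : (fun y => _) = (fun y => expR (- y^-1))); last first.
          by apply/funext => y; rewrite expr0 mul1r.
        by apply: (is_derive_eq h2); rewrite mul0r subr0 exprVn mulrC.
      rewrite (_ : (fun y => _) = (fun y => y^-1 * (y^-1 ^+ m * expR (- y^-1)))); last first.
        by apply/funext => y; rewrite exprS mulrA.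
      have h := is_deriveM h1 IHm; apply: (is_derive_eq h).
      rewrite -!exprVn !exprS expr0 /GRing.scale /= -[m.+1]addn1 natrD.
      set X := x^-1 ^+ m; set u := expR _; ring.
    by apply: (is_derive_eq (E n)); rewrite /flat x0 -!exprVn; ring.
  apply: (near_eq_is_derive _ h3).
  near=> y; rewrite /flat exprVn ifT//.
  by near: y; exact: lt_nbhsr.
rewrite [X in is_derive _ _ _ X](_ : _ = 0); last first.
  by rewrite /flat ltxx mulr0 subrr.
(* At 0 the difference quotient is at most [(n+2)! * z] by [flat_bound]. *)
apply/is_derive1_caratheodory; exists (fun z => flat n z / z); split.
- move=> z; rewrite subr0 [flat n 0]/flat ltxx subr0.
  have [->|z0] := eqVneq z 0; first by rewrite mulr0 /flat ltxx.
  by rewrite divfK.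
- apply/cvgrPdist_lt => e e0; rewrite /= invr0 mulr0.
  pose F : R := (n.+2)`!%:R; have F0 : 0 < F by rewrite ltr0n fact_gt0.
  near=> z; have [z0|z0] := leP z 0.
    have -> : flat n z = 0 by rewrite /flat ltNge z0.
    by rewrite mul0r subrr normr0.
  rewrite sub0r normrN ger0_norm; last by rewrite divr_ge0 ?flat_ge0// ltW.
  rewrite ltr_pdivrMr//; apply: le_lt_trans (flat_bound n z0) _.
  rewrite expr2 mulrA ltr_pM2r// mulrC -ltr_pdivlMr//.
  by near: z; apply: lt_nbhsl; rewrite divr_gt0.
- by rewrite invr0 mulr0.
Unshelve. all: by end_near. Qed.

Lemma smooth_flat n : smooth (flat n).
Proof.
move=> k; elim: k n => [|k IHk] n.
  by apply: derivable_continuous1 => x; exact: is_derive_derivable (is_derive_flat n x).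
split; first by move=> x; exact: is_derive_derivable (is_derive_flat n x).
rewrite (_ : derive1 _ = fun x => flat n.+2 x + (- n%:R) * flat n.+1 (1 * x + 0)).
  by apply: smoothkD => //; exact: smoothk_affine.
by apply/funext => x; rewrite (derive1_eq (is_derive_flat n x)) mul1r addr0 mulNr.
Qed.

(** A smooth function below the indicator of []a, b[] that converges to it as [n] grows: by
    dominated convergence, products of bumps lead from test functions to indicators of boxes. *)
Definition bump (a b : R) (n : nat) (x : R) : R :=
  flat 0 (n.+1%:R * (x - a)) * flat 0 (n.+1%:R * (b - x)).

Lemma smooth_bump a b n : smooth (bump a b n).
Proof.
have h1 := @smooth_affine _ n.+1%:R (- (n.+1%:R * a)) (smooth_flat 0).
have h2 := @smooth_affine _ (- n.+1%:R) (n.+1%:R * b) (smooth_flat 0).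
have := smoothM h1 h2; congr smooth; apply/funext => x; rewrite /bump.
by congr (flat _ _ * flat _ _); ring.
Qed.

Lemma flat0_le1 x : flat 0 x <= 1.
Proof.
rewrite /flat; case: ifP => // x0; rewrite expr0 invr1 mul1r -expR0 ler_expR.
by rewrite oppr_le0 invr_ge0 ltW.
Qed.

Lemma flat0_eq0 x : x <= 0 -> flat 0 x = 0.
Proof. by rewrite /flat ltNge => ->. Qed.

Lemma bump_ge0 a b n x : 0 <= bump a b n x.
Proof. by rewrite mulr_ge0 ?flat_ge0. Qed.

Lemma bump_out a b n x : ~~ (a < x < b) -> bump a b n x = 0.
Proof.
rewrite negb_and -!leNgt /bump => /orP[xa|bx].
  by rewrite flat0_eq0 ?mul0r// pmulr_rle0// subr_le0.
by rewrite [X in _ * X]flat0_eq0 ?mulr0// pmulr_rle0// subr_le0.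
Qed.

Lemma bump_le a b n x : bump a b n x <= (a < x < b)%R%:R.
Proof.
have [abx|abx] := boolP (a < x < b); last by rewrite bump_out.
by rewrite -[leRHS]mulr1 ler_pM ?flat_ge0// flat0_le1.
Qed.

Lemma cvg_flat0 (x : R) : 0 < x -> flat 0 (n.+1%:R * x) @[n --> \oo] --> (1 : R).
Proof.
move=> x0; rewrite (_ : (fun n => _) = (fun n => expR (- (n.+1%:R^-1 * x^-1)))); last first.
  by apply/funext => n; rewrite /flat mulr_gt0// expr0 invr1 mul1r invfM.
have h : - (n.+1%:R^-1 * x^-1) @[n --> \oo] --> (0 : R).
  rewrite -[X in _ --> X]oppr0; apply: cvgN; rewrite -[X in _ --> X](mul0r x^-1).
  by apply: cvgM; [exact: cvg_harmonic|exact: cvg_cst].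
by rewrite -[X in _ --> X]expR0; exact: (cvg_comp _ _ h (@continuous_expR R 0)).
Qed.

Lemma cvg_bump a b x : bump a b n x @[n --> \oo] --> ((a < x < b)%R%:R : R).
Proof.
have [/andP[ax xb]|abx] := boolP (a < x < b).
  rewrite -[X in _ --> X]mulr1; apply: cvgM; apply: cvg_flat0; by rewrite subr_gt0.
rewrite (_ : (fun n => _) = fun=> 0); first exact: cvg_cst.
by apply/funext => n; rewrite bump_out.
Qed.

Lemma continuous_bump a b n : continuous (bump a b n).
Proof. exact: smooth_continuous (smooth_bump a b n). Qed.

Lemma integrable_bump a b n : mu.-integrable setT (EFin \o bump a b n).
Proof.
have mb : measurable_fun [set: R] (bump a b n).
  exact: (continuous_measurable_fun (@continuous_bump a b n)).
apply: (@Rintegrable_le _ (measurableTypeR R) R mu _ (\1_`[a, b])).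
- exact: mb.
- move=> x; rewrite ger0_norm ?bump_ge0// (le_trans (bump_le _ _ _ _))// indicE mem_setE in_itv/=.
  by rewrite ler_nat; case: (boolP (a < x < b)) => // /andP[/ltW -> /ltW ->].
- exact: integrable_indic_itv.
Qed.

Definition bump_prim a b n (x : R) : R := \int[mu]_(t in `]-oo, x]) bump a b n t.

Lemma is_derive_bump_prim a b n (x : R) :
  is_derive x 1 (bump_prim a b n) (bump a b n x).
Proof.
have [|||D <-] := @continuous_FTC1 _ (bump a b n) -oo%O x (x + 1) _ _ _
  (@continuous_bump a b n x).
- by rewrite ltrDl.
- by apply: integrableS (integrable_bump a b n).
- by rewrite ltNyr.
by rewrite derive1E; exact: DeriveDef.
Qed.

Lemma smooth_bump_prim a b n : smooth (bump_prim a b n).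
Proof.
have dV x := is_derive_bump_prim a b n x.
case=> [|k]; first by apply: derivable_continuous1 => x; exact: is_derive_derivable (dV x).
split; first by move=> x; exact: is_derive_derivable (dV x).
rewrite (_ : derive1 _ = bump a b n); first exact: smooth_bump.
by apply/funext => x; exact: derive1_eq.
Qed.

(** A primitive of a bump does not have compact support. Subtracting it from its translate restores
    the support, at the price of a second bump, on []a - n, b - n[], in the derivative. *)
Definition ramp a b n (x : R) : R := bump_prim a b n (x + n%:R) - bump_prim a b n x.

Lemma smooth_ramp a b n : smooth (ramp a b n).
Proof.
apply: smoothB; last exact: smooth_bump_prim.
have := @smooth_affine _ 1 n%:R (smooth_bump_prim a b n).
by congr smooth; apply/funext => x; rewrite mul1r.
Qed.

(** As a superposition of translates of the bump, the ramp turns the weak identity into integrals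
    along a line. *)
Lemma rampE a b n x : ramp a b n x = \int[mu]_(s in `[(- n%:R)%R, 0]) bump a b n (x - s).
Proof.
have nn : - n%:R <= 0 :> R by rewrite oppr_le0.
have dF (s : R) : is_derive s 1 (fun s => - bump_prim a b n (x - s)) (bump a b n (x - s)).
  have h1 : is_derive s 1 (fun s : R => x - s) (-1).
    have h := is_deriveB (is_derive_cst x s 1) (is_derive_id s (1 : R)).
    by apply: (is_derive_eq h); rewrite sub0r.
  have := is_deriveN (@is_derive1_comp _ (bump_prim a b n) (fun s : R => x - s) s _ _ (is_derive_bump_prim a b n (x - s)) h1).
  by rewrite mulrN1 opprK.
rewrite (Rint_derive nn dF); first by rewrite subr0 !opprK /ramp addrC.
move=> s; apply: (@continuous_comp _ _ _ (fun s => x - s) (bump a b n)).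
  by apply: cvgB; [exact: cvg_cst|exact: cvg_id].
exact: continuous_bump.
Qed.

Lemma derive_ramp a b n x : derive1 (ramp a b n) x = bump a b n (x + n%:R) - bump a b n x.
Proof.
apply: derive1_eq; apply: is_deriveB.
  have h1 : is_derive x 1 (fun x : R => x + n%:R) 1.
  by apply: is_derive_eq; rewrite addr0.
  by have := @is_derive1_comp _ (bump_prim a b n) (fun x : R => x + n%:R) x _ _ (is_derive_bump_prim a b n (x + n%:R)) h1; rewrite mulr1.
exact: is_derive_bump_prim.
Qed.

Definition compact_supp f := exists M : R, forall x, M < `|x| -> f x = 0.

Lemma bump_compact a b n : compact_supp (bump a b n).
Proof.
exists (Num.max `|a| `|b|) => x; rewrite gt_max => /andP[ax bx]; apply: bump_out.
apply/negP => /andP[a_x x_b]; have [x0|x0] := leP 0 x.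
  by move: bx; rewrite ltNge (ger0_norm x0) (le_trans (ltW x_b))// ler_norm.
by move: ax; rewrite ltNge (ltr0_norm x0) lerNl (le_trans _ (ltW a_x))// lerNl -normrN ler_norm.
Qed.

Lemma ramp_compact a b n : compact_supp (ramp a b n).
Proof.
have [M MP] := bump_compact a b n; exists (M + n%:R) => x Mx.
rewrite rampE /Rintegral integral0_eq// => s; rewrite /= in_itv/= => /andP[sn s0].
rewrite MP// -(ltrD2r n%:R); apply: (lt_le_trans Mx).
rewrite -[X in `|X|](subrK s) (le_trans (ler_normD _ _))// lerD2l.
by rewrite ler0_norm// lerNl.
Qed.

End smooth1.

(** * Measure-preserving maps and boxes *)

Section tools.
Context d1 d2 (T1 : measurableType d1) (T2 : measurableType d2) (R : realType).

Lemma measurable_boolr (b : T1 -> bool) : measurable_fun setT b ->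
  measurable_fun setT (fun x => (b x)%:R : R).
Proof.
move=> mb; rewrite (_ : (fun x => _) = fun x => if b x then 1 else 0); last first.
  by apply/funext => x; case: (b x).
exact: measurable_fun_ifT.
Qed.

Lemma measurable_Rint (m2 : {sigma_finite_measure set T2 -> \bar R}) (h : T1 * T2 -> R) :
  measurable_fun setT h -> measurable_fun setT (fun x => \int[m2]_y h (x, y)).
Proof.
move=> mh; rewrite /Rintegral.
have meh : measurable_fun setT (EFin \o h) by exact/measurable_EFinP.
rewrite (_ : (fun x => _) = fun x => fine (fubini_F m2 ((EFin \o h)^\+)%E x -
    fubini_F m2 ((EFin \o h)^\-)%E x)); last first.
  apply/funext => x; congr fine; rewrite integralE; congr (_ - _)%E.
    by apply: eq_integral => y _; rewrite !funeposE.
  by apply: eq_integral => y _; rewrite !funenegE.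
apply: measurableT_comp; first exact: (fine_measurable measurableT).
apply: emeasurable_funB; apply: measurable_fun_fubini_tonelli_F => //.
- exact: measurable_funepos.
- exact: measurable_funeneg.
Qed.

Lemma Rdct (m : {measure set T1 -> \bar R}) (f_ : nat -> T1 -> R) (f g : T1 -> R) :
  (forall n, measurable_fun setT (f_ n)) -> measurable_fun setT f ->
  (forall x, f_ n x @[n --> \oo] --> f x) ->
  m.-integrable setT (EFin \o g) -> (forall n x, `|f_ n x| <= g x) ->
  m.-integrable setT (EFin \o f) /\
  \int[m]_x f_ n x @[n --> \oo] --> \int[m]_x f x.
Proof.
move=> mf_ mf cf ig fg.
have [|||||fi _ cv] := @dominated_convergence _ T1 R m setT measurableT
  (fun n => EFin \o f_ n) (EFin \o f) (EFin \o g).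
- by move=> n; exact/measurable_EFinP.
- exact/measurable_EFinP.
- by apply: aeW => x _; apply: cvg_EFin; [exact: nearW|exact: cf].
- exact: ig.
- by apply: aeW => x n _; rewrite lee_fin.
split=> //; apply: fine_cvg; rewrite fineK//; exact: integrable_fin_num fi.
Qed.

(** Phrased with integrals of nonnegative functions rather than measures of sets: this is the form
    that Tonelli's theorem and the changes of variables deliver. *)
Definition mpres (mX : {measure set T1 -> \bar R}) (mY : {measure set T2 -> \bar R})
    (h : T1 -> T2) :=
  measurable_fun setT h /\
  forall g : T2 -> \bar R, measurable_fun setT g -> (forall y, 0 <= g y)%E ->
    (\int[mX]_x g (h x) = \int[mY]_y g y)%E.

Variables (mX : {measure set T1 -> \bar R}) (mY : {measure set T2 -> \bar R}) (h : T1 -> T2).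
Hypothesis hP : mpres mX mY h.

Lemma mpres_ae (P : T2 -> Prop) : {ae mY, forall y, P y} -> {ae mX, forall x, P (h x)}.
Proof.
have [mh hh] := hP => -[A [mA A0 PA]]; exists (h @^-1` A).
have mhA : measurable (h @^-1` A) by rewrite -[X in measurable X]setTI; exact: mh.
split=> //; last by move=> x nP; exact: PA.
rewrite -(setIT (h @^-1` A)) -integral_indic// -A0 -[in RHS](setIT A) -integral_indic//.
rewrite -hh//.
by apply/measurable_EFinP; exact: measurable_indic.
Qed.

Lemma mpres_integral (g : T2 -> \bar R) : measurable_fun setT g ->
  (\int[mX]_x g (h x) = \int[mY]_y g y)%E.
Proof.
move=> mg; have [mh hh] := hP; rewrite integralE [RHS]integralE.
congr (_ - _)%E.
- by rewrite (funepos_comp g h); apply: (hh (g^\+)%E); [exact: measurable_funepos|].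
- by rewrite (funeneg_comp g h); apply: (hh (g^\-)%E); [exact: measurable_funeneg|].
Qed.

Lemma mpres_Rintegral (g : T2 -> R) : measurable_fun setT g ->
  \int[mX]_x g (h x) = \int[mY]_y g y.
Proof.
by move=> mg; rewrite /Rintegral (mpres_integral (g := EFin \o g))//; exact/measurable_EFinP.
Qed.

Lemma mpres_integrable (g : T2 -> R) : mY.-integrable setT (EFin \o g) ->
  mX.-integrable setT (EFin \o (fun x => g (h x))).
Proof.
move=> ig; have [mh hh] := hP; have mg := measurable_int _ ig.
apply/integrableP; split; first exact: (measurableT_comp mg mh).
have /integrableP[_] := ig; rewrite (hh (fun y => `|(g y)%:E|)%E)//.
exact: measurableT_comp.
Qed.

End tools.

Section box.
Context dT (T : measurableType dT) (R : realType) (m : {measure set T -> \bar R}).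
Variables (I : finType) (c : I -> T -> R).
Hypothesis mc : forall i, measurable_fun setT (c i).
Hypothesis gen : forall d' (T' : measurableType d') (h : T' -> T),
  (forall i, measurable_fun setT (fun x => c i (h x))) -> measurable_fun setT h.

(** The coordinates are an abstract finite family that generates the sigma-algebra ([gen]), so as to
    cover both [Rd R d] and pairs of such vectors, which have [2 d] coordinates. *)
Definition box (a b : I -> R) : set T := [set x | forall i, a i < c i x < b i].

Lemma indic_box a b x : \1_(box a b) x = \prod_i (a i < c i x < b i)%R%:R :> R.
Proof.
rewrite indicE; have [/[!inE] xB|xB] := boolP (x \in box a b).
  by rewrite big1// => i _; rewrite xB.
have : ~~ [forall i, a i < c i x < b i].
  by apply: contra xB => /forallP xB; rewrite inE.
rewrite negb_forall => /existsP[i /negbTE xi].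
by rewrite (bigD1 i)//= xi mul0r.
Qed.

Lemma measurable_box a b : measurable (box a b).
Proof.
rewrite (_ : box a b = \bigcap_(i in [set: I]) (c i @^-1` `]a i, b i[%classic)).
  apply: fin_bigcap_measurable => // i _.
  by rewrite -[X in measurable X]setTI; apply: mc.
by apply/seteqP; split => x /= xB i; [move=> _|]; have := xB i; rewrite /= in_itv/=; exact.
Qed.

Definition boxes : set (set T) := [set A | exists a b, A = box a b].

(** [gen] is applied to the identity, read as a map from the space equipped with [<<s boxes >>];
    half-spaces are countable unions of boxes. *)
Lemma measurable_boxes : @measurable _ T = <<s boxes >>.
Proof.
apply/seteqP; split; last first.
  apply: smallest_sub; first exact: sigma_algebra_measurable.
  by move=> _ [a [b ->]]; exact: measurable_box.
move=> A mA.
have mid : measurable_fun [set: g_sigma_algebraType boxes] (id : g_sigma_algebraType boxes -> T).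
  apply: gen => i; apply: (measurability (@RGenOInfty.G R)); first exact: RGenOInfty.measurableE.
  move=> _ [_ [x ->] <-]; rewrite setTI.
  rewrite (_ : _ @^-1` _ = \bigcup_n box (fun j => if j == i then x else - n%:R) (fun=> n%:R)).
    apply: bigcup_measurable => n _; apply: sub_sigma_algebra; by do 2 eexists.
  apply/seteqP; split => y /=.
    rewrite in_itv/= andbT => xy.
    pose M := \sum_j `|c j y|.
    exists (Num.truncn M).+1 => // j /=.
    have jM : `|c j y| < (Num.truncn M).+1%:R.
      apply: le_lt_trans (truncnS_gt _).
      by rewrite /M (bigD1 j)//= lerDl sumr_ge0.
    have := jM; rewrite ltr_norml => /andP[j1 j2]; rewrite j2 andbT.
    by case: eqP => [->//|_].
  by move=> [n _ /(_ i)]; rewrite eqxx in_itv/= andbT => /andP[].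
by have := mid (measurableT) A mA; rewrite setTI.
Qed.

Lemma setI_boxes : setI_closed boxes.
Proof.
move=> _ _ [a [b ->]] [a' [b' ->]].
exists (fun i => Num.max (a i) (a' i)), (fun i => Num.min (b i) (b' i)).
apply/seteqP; split => x /= => [[h1 h2] i|h].
  by rewrite gt_max lt_min; have /andP[-> ->] := h1 i; have /andP[-> ->] := h2 i.
by split => i; have := h i; rewrite gt_max lt_min => /andP[/andP[? ?] /andP[? ?]]; apply/andP.
Qed.

(** The pi-lambda theorem: boxes generate and are stable under intersection, so an integrable
    function of zero integral on boxes has zero integral on all measurable sets. As [u] is
    integrable on boxes only, it is first truncated to the cubes [B n]. *)
Lemma box_ae0 (u : T -> R) : measurable_fun setT u ->
  (forall a b, m.-integrable setT (fun x => (\1_(box a b) x * u x)%:E)) ->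
  (forall a b, \int[m]_x (\1_(box a b) x * u x) = 0) ->
  {ae m, forall x, u x = 0}.
Proof.
move=> mu iu u0.
pose B n := box (fun=> - n%:R) (fun=> n%:R).
pose w n x := \1_(B n) x * u x.
have wE n A : measurable A -> (\int[m]_(x in A) (w n x)%:E = \int[m]_x (\1_A x * w n x)%:E)%E.
  move=> mA; rewrite integral_mkcond; apply: eq_integral => x _.
  by rewrite patchE indicE; case: (x \in A); rewrite ?mul1r ?mul0r.
suff wA n A : measurable A -> (\int[m]_(x in A) (w n x)%:E = 0)%E.
  have w0 n : {ae m, forall x, w n x = 0}.
    have := @integral_ae_eq _ T R m setT measurableT (cst 0%E) (EFin \o w n) (iu _ _) (measurable_cst _).
    have h E : E `<=` setT -> measurable E ->
        (\int[m]_(x in E) (EFin \o w n) x = \int[m]_(x in E) cst 0 x)%E.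
      by move=> _ mE; rewrite wA// integral0.
    by move=> /(_ h); apply: filterS => x /(_ Logic.I)[].
  apply: (ae_imp (ae_foralln w0)) => x wx.
  pose M := \sum_j `|c j x|.
  have := wx (Num.truncn M).+1; rewrite /w indicE mem_set ?mul1r// => j /=.
  rewrite -ltr_norml; apply: le_lt_trans (truncnS_gt _).
  by rewrite /M (bigD1 j)//= lerDl sumr_ge0.
move=> mA; have sA : <<s boxes >> A by rewrite -measurable_boxes.
have iw : m.-integrable setT (EFin \o w n) by exact: iu.
have wT : (\int[m]_x (w n x)%:E = 0)%E.
  by rewrite (RintegralE iw) u0.
apply: (@dynkin_induction _ T boxes (fun A => \int[m]_(x in A) (w n x)%:E = 0)%E _ _ wT _ _ _ A sA).
- exact: measurable_boxes.
- exact: setI_boxes.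
- move=> S [a [b Sab]]; rewrite wE; last by rewrite Sab; exact: measurable_box.
  have /setI_boxes : boxes S by exists a, b.
  move=> /(_ (B n)); case; first by exists (fun=> - n%:R), (fun=> n%:R).
  move=> a' [b' SB].
  rewrite (_ : (fun x => _) = (fun x => (\1_(box a' b') x * u x)%:E)).
    by rewrite (RintegralE (iu _ _)) u0.
  by apply/funext => x; rewrite /w mulrA -SB indicI.
- move=> S mS S0; have := wT; rewrite -(setUv S) integral_setU//.
  + by rewrite S0 add0e.
  + exact: measurableC.
  + by rewrite setUv; exact/measurable_int/iw.
  + by apply/disj_setPS; rewrite setICr.
- move=> F mF tF F0; rewrite integral_bigcup//.
    by rewrite eseries0.
  by apply: integrableS iw => //; exact: bigcup_measurable.
Qed.

End box.

(** * Primitives along lines *)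

Section ae_integral0.
Context d (T : measurableType d) (R : realType) (m : {measure set T -> \bar R}).

Lemma ge0_integral0_ae (f : T -> \bar R) : measurable_fun setT f -> (forall x, 0 <= f x)%E ->
  (\int[m]_x f x = 0)%E -> {ae m, forall x, f x = 0%E}.
Proof.
move=> mf f0 if0; have := (ae_eq_integral_abs m measurableT mf).1.
under eq_integral => x _ do rewrite gee0_abs//.
by move=> /(_ if0); apply: filterS => x; exact.
Qed.

Lemma ae_notin (A : set T) : measurable A -> (m A = 0)%E -> {ae m, forall x, ~ A x}.
Proof. by move=> mA A0; exists A; split => // x /contrapT. Qed.

Lemma integral_indicT (A : set T) : measurable A -> (\int[m]_x (\1_A x)%:E = m A)%E.
Proof. by move=> mA; rewrite integral_indic// setIT. Qed.

End ae_integral0.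

Section ae_product.
Context d1 d2 (T1 : measurableType d1) (T2 : measurableType d2) (R : realType).
Variables (m1 : {sigma_finite_measure set T1 -> \bar R})
          (m2 : {sigma_finite_measure set T2 -> \bar R}).

Lemma ae_fst (P : T1 -> Prop) : {ae m1, forall x, P x} -> {ae prodm m1 m2, forall z, P z.1}.
Proof.
move=> -[A [mA A0 PA]]; exists (A `*` setT); split.
- exact: measurableX.
- by rewrite /prodm product_measure1E// [X in (X * _)%E]A0 mul0e.
- by move=> z nP; split => //; exact: PA.
Qed.

Lemma ae_snd (P : T2 -> Prop) : {ae m2, forall x, P x} -> {ae prodm m1 m2, forall z, P z.2}.
Proof.
move=> -[A [mA A0 PA]]; exists (setT `*` A); split.
- exact: measurableX.
- by rewrite /prodm product_measure1E// [X in (_ * X)%E]A0 mule0.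
- by move=> z nP; split => //; exact: PA.
Qed.


Lemma ae_slice1 (P : T1 * T2 -> Prop) : {ae prodm m1 m2, forall z, P z} ->
  {ae m1, forall x, {ae m2, forall y, P (x, y)}}.
Proof.
move=> -[A [mA A0 PA]].
have m1A : measurable_fun setT (fun z => (\1_A z : R)%:E).
  by apply/measurable_EFinP; exact: measurable_indic.
have mF : measurable_fun setT (fun x => \int[m2]_y (\1_A (x, y) : R)%:E)%E.
  by apply: (measurable_fun_fubini_tonelli_F _ m1A) => z; rewrite lee_fin.
have F0 x : (0 <= \int[m2]_y (\1_A (x, y) : R)%:E)%E by apply: integral_ge0 => y _; rewrite lee_fin.
have : (\int[m1]_x \int[m2]_y (\1_A (x, y) : R)%:E = 0)%E.
  transitivity (\int[prodm m1 m2]_z (\1_A z : R)%:E)%E; last by rewrite integral_indicT.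
  by rewrite tonelli1// => z; rewrite lee_fin.
move=> /(ge0_integral0_ae mF F0); apply: filterS => x Ax.
have mAx : measurable_fun setT (fun y => (\1_A (x, y) : R)%:E).
  exact: (measurableT_comp m1A (measurable_pair1 x)).
have A0x y : (0 <= (\1_A (x, y) : R)%:E)%E by rewrite lee_fin.
have := ge0_integral0_ae mAx A0x Ax; apply: filterS => y /eqP.
rewrite eqe indicE pnatr_eq0 eqb0 => /negP nA; apply: contrapT => nP.
by apply: nA; rewrite inE; exact: PA.
Qed.

Lemma ae_of_slice1 (P : T1 * T2 -> Prop) : measurable [set z | ~ P z] ->
  {ae m1, forall x, {ae m2, forall y, P (x, y)}} -> {ae prodm m1 m2, forall z, P z}.
Proof.
move=> mA aP; set A := [set z | ~ P z] in mA.
suff A0 : (prodm m1 m2 A = 0)%E by apply: (ae_imp (ae_notin mA A0)) => x /contrapT.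
have m1A : measurable_fun setT (fun z => (\1_A z : R)%:E).
  by apply/measurable_EFinP; exact: measurable_indic.
have A0z z : (0 <= (\1_A z : R)%:E)%E by rewrite lee_fin.
rewrite -integral_indicT// tonelli1// -(integral0 m1 setT); apply: ae_eq_integral => //.
  exact: (measurable_fun_fubini_tonelli_F _ m1A).
apply: (ae_imp aP) => x Px _; rewrite -(integral0 m2 setT); apply: ae_eq_integral => //.
  exact: (measurableT_comp m1A (measurable_pair1 x)).
apply: (ae_imp Px) => y Pxy _; rewrite indicE; case: (boolP (_ \in A)) => // /[!inE].
by move=> /(_ Pxy).
Qed.

Lemma measurable_zero_imp d (T : measurableType d) (f g : T -> R) :
  measurable_fun setT f -> measurable_fun setT g ->
  measurable [set x | ~ (f x = 0 -> g x = 0)].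
Proof.
move=> mf mg; rewrite (_ : [set x | _] = (f @^-1` [set 0]) `&` ~` (g @^-1` [set 0])).
  apply: measurableI; last apply: measurableC.
    by rewrite -[X in measurable X]setTI; exact: mf.
  by rewrite -[X in measurable X]setTI; exact: mg.
apply/seteqP; split => x /=; last by move=> [fx gx] /(_ fx).
by move=> h; split; apply: contrapT => k; apply: h => // fx; exact: contrapT.
Qed.

(** On a slice of zero integral a nonnegative function vanishes almost everywhere. This is what
    later allows logarithms of quotients by a marginal to be split. *)
Lemma zero_marginal (p : T1 * T2 -> R) : (prodm m1 m2).-integrable setT (EFin \o p) ->
  (forall z, 0 <= p z) -> {ae prodm m1 m2, forall z, \int[m2]_y p (z.1, y) = 0 -> p z = 0}.
Proof.
move=> ip p0; apply: ae_of_slice1.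
  apply: measurable_zero_imp; last exact: Rintegrable_measurable ip.
  exact: (measurableT_comp (Rintegrable_measurable (integrable_Rint_snd ip)) measurable_fst).
apply: (ae_imp (ae_integrable_fst ip)) => x ipx /=.
have [P0|P0] := eqVneq (\int[m2]_y p (x, y)) 0; last by apply: aeW => y /eqP; rewrite (negbTE P0).
have px0 y : (0 <= (p (x, y))%:E)%E by rewrite lee_fin.
have h : (\int[m2]_y (p (x, y))%:E = 0)%E by rewrite (RintegralE ipx) P0.
by apply: (ae_imp (ge0_integral0_ae (measurable_int _ ipx) px0 h)) => y [].
Qed.

End ae_product.

(** * Zeros of nonnegative primitives *)

Section primitive_zero.
Variable R : realType.
Local Notation leb := (@lebesgue_measure R).

Lemma Rint_shift (h : R -> R) (s : R) : measurable_fun setT h ->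
  \int[leb]_(t in `]-oo, 0%R]) h (t + s) = \int[leb]_(u in `]-oo, s]) h u.
Proof.
move=> mh; rewrite -(Rint_indic (fun t => h (t + s)) (measurable_itv _)) -(Rint_indic h (measurable_itv _)).
have trans_mpres : mpres (leb : {measure set (measurableTypeR R) -> \bar R}) leb (fun t => 1 * t + s).
  split; first by apply: measurable_funD => //; exact: measurable_funM.
  by move=> g mg g0; rewrite -(lebesgue_affine s (oner_neq0 R) mg g0) normr1 mul1e.
rewrite -(mpres_Rintegral trans_mpres (g := fun u => h u * \1_(`]-oo, s]) u)); last first.
  by apply: measurable_funM => //; exact: measurable_indic.
apply: eq_Rintegral => t _; rewrite mul1r !indicE; congr (_ * (_ : bool)%:R).
by apply/idP/idP; rewrite !inE/= !in_itv/= gerDr.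
Qed.

Lemma ae_itv (P : R -> Prop) (a b : R) : a < b -> {ae leb, forall x, P x} ->
  exists2 x, a < x < b & P x.
Proof.
move=> ab [A [mA A0 PA]]; apply: contrapT => nP.
have : (leb `]a, b[%classic <= leb A)%E.
  apply: le_measure; rewrite ?inE// => x /=; rewrite in_itv/= => xab.
  by apply: PA => Px; apply: nP; exists x.
by rewrite A0 lebesgue_measure_itv/= lte_fin ab -EFinB lee_fin subr_le0 leNgt ab.
Qed.

Lemma primitive_zero (h : R -> R) : leb.-integrable setT (EFin \o h) ->
  {ae leb, forall s, 0 <= \int[leb]_(t in `]-oo, s]) h t} ->
  {ae leb, forall s, \int[leb]_(t in `]-oo, s]) h t = 0 -> h s = 0}.
Proof.
move=> ih F0;
have mh := Rintegrable_measurable ih.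
have loch : locally_integrable setT h.
  split => //; first exact: openT.
  move=> K _ cK; have mK := compact_measurable cK.
  have /integrableP[_] : leb.-integrable K (EFin \o h) by exact: integrableS ih.
  exact.
have ihy (y : R) : leb.-integrable `]-oo, y] (EFin \o h) by exact: integrableS ih.
(* At a zero of [F] where [F' = h] exists, [h != 0] would make [F] negative on
   one side. *)
pose F s := \int[leb]_(t in `]-oo, s]) h t.
apply: (@ae_imp _ (measurableTypeR R) R leb _ _ (FTC1Ny ihy loch)) => s [dF hs] Fs.
have := is_derive1P dF; rewrite hs => {}dF.
have [g [gE cg gs]] := (is_derive1_caratheodory F s (h s)).1 dF.
have {}gE z : F z = g z * (z - s) by rewrite -gE [F s]Fs subr0.
apply/eqP; apply: contrapT => /negP h0.
have : \forall z \near s, 0 < g z * h s.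
  have c2 : g z * h s @[z --> s] --> h s * h s.
    by apply: cvgM; [by rewrite -gs; exact: cg|exact: cvg_cst].
  by apply: (cvgr_gt _ c2); rewrite -expr2 exprn_even_gt0.
move=> /nbhs_ballP[e /= e0 eP].
have {h0} [hs0|hs0] := orP (lt_total h0).
  have se : s < s + e by rewrite ltrDl.
  have [z /andP[sz zse]] := ae_itv se F0; rewrite -/(F z) gE leNgt => /negP; apply.
  have : 0 < g z * h s by apply: eP; rewrite /ball/= ltr_norml; apply/andP; split; lra.
  by rewrite nmulr_lgt0// => gz; rewrite nmulr_rlt0// subr_gt0.
have se : s - e < s by rewrite ltrBlDr ltrDl.
have [z /andP[sz zse]] := ae_itv se F0; rewrite -/(F z) gE leNgt => /negP; apply.
have : 0 < g z * h s by apply: eP; rewrite /ball/= ltr_norml; apply/andP; split; lra.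
by rewrite pmulr_lgt0// => gz; rewrite pmulr_rlt0// subr_lt0.
Qed.

End primitive_zero.

(** * Orbits of measure-preserving shifts *)

Section shift_zero.
Context dT (T : measurableType dT) (R : realType) (m : {sigma_finite_measure set T -> \bar R}).
Variables (tau : R -> T -> T).
Local Notation leb := (@lebesgue_measure R).
Hypothesis mtau : measurable_fun [set: T * R] (fun z => tau z.2 z.1).
Hypothesis tau_mpres : forall s, mpres m m (tau s).
Hypothesis tauD : forall s t x, tau s (tau t x) = tau (s + t) x.
Let mleb : {sigma_finite_measure set (measurableTypeR R) -> \bar R} := leb.
Let TR := (T * measurableTypeR R)%type.
Let sg (z : TR) : TR := (tau z.2 z.1, z.2).

Lemma shift_mpres : mpres (prodm m mleb) (prodm m mleb) sg.
Proof.
have msg : measurable_fun setT sg.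
  by apply: measurable_fun_pair => //; exact: measurable_snd.
split=> // g mg g0; rewrite tonelli2//; last exact: (measurableT_comp mg msg).
rewrite tonelli2//; apply: eq_integral => s _.
have [_ h] := tau_mpres s; rewrite -(h (fun x => g (x, s)))//.
exact: (measurableT_comp mg (measurable_pair2 s)).
Qed.

Lemma ae_shift (P : T -> Prop) : {ae m, forall x, P x} ->
  {ae m, forall x, {ae leb, forall s, P (tau s x)}}.
Proof. by move=> /(ae_fst mleb) /(mpres_ae shift_mpres) /ae_slice1. Qed.

(** Every [tau s] preserves [m], so the measure of the exceptional set is also the product measure
    of the pairs [(x, s)], [0 <= s <= 1], with [tau s x] in it, and almost all slices of the latter
    are null. *)
Lemma ae_of_shift (P : T -> Prop) : measurable [set x | ~ P x] ->
  {ae m, forall x, {ae leb, forall s, P (tau s x)}} -> {ae m, forall x, P x}.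
Proof.
move=> mA aP; set A := [set x | ~ P x] in mA.
suff A0 : (m A = 0)%E by apply: (ae_imp (ae_notin mA A0)) => x /contrapT.
have m1A : measurable_fun setT (\1_A : T -> R) by exact: measurable_indic.
pose g (z : TR) : \bar R := (\1_A z.1 * \1_(`[0%R, 1%R]%classic : set R) z.2)%:E.
have mg : measurable_fun setT g.
  apply/measurable_EFinP; apply: measurable_funM; first exact: measurableT_comp.
  by apply: measurableT_comp; [exact: measurable_indic|exact: measurable_snd].
have g0 z : (0 <= g z)%E by rewrite lee_fin mulr_ge0.
have -> : m A = (\int[prodm m mleb]_z g z)%E.
  rewrite tonelli1// -integral_indicT//; apply: eq_integral => x _.
  rewrite /g/= (@ge0_RZl _ (measurableTypeR R) R mleb)//.
  rewrite (@integral_indicT _ (measurableTypeR R) R mleb)//.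
  by rewrite /mleb/= lebesgue_measure_itv/= lte_fin ltr01 sube0 mule1.
have [msg hsg] := shift_mpres; rewrite -hsg// tonelli1//; last exact: (measurableT_comp mg msg).
rewrite -(integral0 m setT); apply: ae_eq_integral => //.
  apply: (measurable_fun_fubini_tonelli_F (m2 := mleb) (g \o sg)); last by move=> z; exact: g0.
  exact: (measurableT_comp mg msg).
apply: (ae_imp aP) => x Px _.
rewrite -(integral0 mleb setT); apply: ae_eq_integral => //.
  exact: (measurableT_comp (measurableT_comp mg msg) (measurable_pair1 x)).
apply: (@ae_imp _ (measurableTypeR R) R leb _ _ Px) => s Ps _.
rewrite /g/= indicE; case: (boolP (_ \in A)) => [/[!inE] //|_].
by rewrite mul0r.
Qed.

(** Along almost every orbit [p] is a nonnegative primitive of [q], so [primitive_zero] applies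
    there, and [ae_of_shift] goes from orbits back to points. *)
Lemma shift_zero (p q : T -> R) : measurable_fun setT p -> measurable_fun setT q ->
  (forall x, 0 <= p x) ->
  {ae m, forall x, leb.-integrable setT (fun s => (q (tau s x))%:E)} ->
  {ae m, forall x, p x = \int[leb]_(s in `]-oo, 0%R]) q (tau s x)} ->
  {ae m, forall x, p x = 0 -> q x = 0}.
Proof.
move=> mp mq p0 iq pE; apply: ae_of_shift.
  exact: measurable_zero_imp.
apply: (ae_imp2 iq (ae_shift pE)) => x iqx pxE.
have mqx := Rintegrable_measurable iqx.
have pF : {ae leb, forall s, p (tau s x) = \int[leb]_(u in `]-oo, s]) q (tau u x)}.
  apply: (@ae_imp _ (measurableTypeR R) R leb _ _ pxE) => s ->.
  by rewrite -Rint_shift//; apply: eq_Rintegral => t _; rewrite tauD.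
have F0 : {ae leb, forall s, 0 <= \int[leb]_(u in `]-oo, s]) q (tau u x)}.
  by apply: (@ae_imp _ (measurableTypeR R) R leb _ _ pF) => s <-.
apply: (@ae_imp2 _ (measurableTypeR R) R leb _ _ _ pF (primitive_zero iqx F0)) => s <-.
exact.
Qed.

End shift_zero.

(** * From weak derivatives to primitives along orbits *)

Section shift.
Context dT (T : measurableType dT) (R : realType) (m : {sigma_finite_measure set T -> \bar R}).
Variables (I : finType) (c : I -> T -> R) (i : I) (tau : R -> T -> T).
Local Notation leb := (@lebesgue_measure R).
Hypothesis mc : forall j, measurable_fun setT (c j).
Hypothesis gen : forall d' (T' : measurableType d') (h : T' -> T),
  (forall j, measurable_fun setT (fun x => c j (h x))) -> measurable_fun setT h.
Hypothesis mtau : measurable_fun [set: T * R] (fun z => tau z.2 z.1).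
Hypothesis tau_mpres : forall s, mpres m m (tau s).
Hypothesis tauN : forall s x, tau (- s) (tau s x) = x.
Hypothesis c_tau : forall j s x, c j (tau s x) = c j x + (if j == i then s else 0).

Let mleb : {sigma_finite_measure set (measurableTypeR R) -> \bar R} := leb.
Let TR := (T * measurableTypeR R)%type.
Let sg (z : TR) : TR := (tau z.2 z.1, z.2).

Let sg_mpres : mpres (prodm m mleb) (prodm m mleb) sg := shift_mpres mtau tau_mpres.

Variables p q : T -> R.
Hypotheses (ip : m.-integrable setT (EFin \o p)) (iq : m.-integrable setT (EFin \o q)).
Hypothesis weak : forall b : I -> R -> R, (forall j, smooth (b j) /\ compact_supp (b j)) ->
  \int[m]_x (p x * ((\prod_(j | j != i) b j (c j x)) * derive1 (b i) (c i x))) =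
  - \int[m]_x (q x * \prod_j b j (c j x)).

Let mp : measurable_fun setT p := Rintegrable_measurable ip.
Let mq : measurable_fun setT q := Rintegrable_measurable iq.

(* The weak identity is tested against bumps in the coordinates [j != i] and
   against a ramp in the coordinate [i]: its derivative is the difference of a
   bump far away and of a bump on ]a i, b i[. *)
Section onebox.
Variables a b : I -> R.

(** Composed with [sg], this becomes the indicator of the box at [x] times [q (tau s x)]: the values
    of [q] along the orbit of a point of the box. *)
Let k (z : TR) : R := q z.1 * \1_(box c a b) (tau (- z.2) z.1).

Let mtauN : measurable_fun [set: TR] (fun z => tau (- z.2) z.1).
Proof.
apply: (@measurableT_comp _ _ _ _ _ _ (fun z : T * R => tau z.2 z.1) _ (fun z : TR => (z.1, - z.2))) => //.
apply: measurable_fun_pair => //; apply: measurableT_comp => //; exact: oppr_measurable.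
Qed.

Let m1B : measurable_fun setT (\1_(box c a b) : T -> R).
Proof. by apply: measurable_indic; exact: measurable_box. Qed.

Let mk : measurable_fun setT k.
Proof.
apply: measurable_funM; first exact: measurableT_comp.
exact: (measurableT_comp m1B mtauN).
Qed.

(** An orbit stays in the box for a time of at most its width in the direction [i]. Hence [k] is
    integrable, although the orbits have infinite length. *)
Let slice_le x : (\int[mleb]_s (\1_(box c a b) (tau (- s) x))%:E <= `|b i - a i|%:E)%E.
Proof.
apply: (@le_trans _ _ (\int[mleb]_s (\1_(`]c i x - b i, c i x - a i[%classic : set R) s)%:E)%E).
  apply: ge0_Rle => //.
  - exact: (measurableT_comp (measurableT_comp m1B mtauN) (measurable_pair1 x)).
  - move=> s; rewrite !indicE ler_nat; case: (boolP (_ \in box c a b)) => // /[!inE] xB.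
    rewrite mem_set//= in_itv/=; have := xB i; rewrite c_tau eqxx.
    by move=> /andP[h1 h2]; apply/andP; split; lra.
rewrite integral_indic//= setIT lebesgue_measure_itv/= lte_fin.
case: ifP => _; last by rewrite lee_fin.
rewrite -EFinB lee_fin (_ : c i x - a i - _ = b i - a i) ?ler_norm//.
ring.
Qed.

Let ik : (prodm m mleb).-integrable setT (EFin \o k).
Proof.
apply/integrableP; split; first exact/measurable_EFinP.
rewrite tonelli1//; last by apply: measurableT_comp => //; exact/measurable_EFinP.
apply: (@le_lt_trans _ _ (\int[m]_x (`|b i - a i| * `|q x|)%:E)%E); last first.
  have /integrableP[_] := RintegrableZ `|b i - a i| (Rintegrable_norm iq).
  by under eq_integral => x _ do rewrite /= ger0_norm ?mulr_ge0//.
apply: ge0_le_integral => //.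
- by move=> x _; exact: integral_ge0.
- apply: (measurable_fun_fubini_tonelli_F (m2 := mleb) (abse \o (EFin \o k))); last by move=> z; exact: abse_ge0.
  by apply: measurableT_comp => //; exact/measurable_EFinP.
- by apply/measurable_EFinP; apply: measurable_funM => //; exact: measurableT_comp.
- move=> x _.
  under eq_integral => s _ do rewrite /k/= normrM [`|\1_ _ _|]ger0_norm//.
  rewrite (@ge0_RZl _ (measurableTypeR R) R mleb)//.
    by rewrite mulrC EFinM lee_wpmul2l// lee_fin.
  exact: (measurableT_comp (measurableT_comp m1B mtauN) (measurable_pair1 x)).
Qed.

Let iK : (prodm m mleb).-integrable setT (fun z : TR => (\1_(box c a b) z.1 * q (tau z.2 z.1))%:E).
Proof.
have := mpres_integrable sg_mpres ik; congr (integrable _ _ _).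
by apply/funext => -[x s]; rewrite /= /k /sg/= tauN mulrC.
Qed.

Lemma ae_integrable_line : {ae m, forall x, \1_(box c a b) x = 1 :> R ->
  leb.-integrable setT (fun s => (q (tau s x))%:E)}.
Proof.
apply: (ae_imp (ae_integrable_fst iK)) => x h x1; move: h.
by under eq_fun => s do rewrite /= x1 mul1r.
Qed.

Let bm n j := bump (a j) (b j) n.
Let bf n j := if j == i then ramp (a i) (b i) n else bm n j.

Let bf_weak n :
  \int[m]_x (p x * ((\prod_(j | j != i) bm n j (c j x)) * (bm n i (c i x + n%:R) - bm n i (c i x)))) =
  - \int[m]_x (q x * ((\prod_(j | j != i) bm n j (c j x)) * ramp (a i) (b i) n (c i x))).
Proof.
have bfi : bf n i = ramp (a i) (b i) n by rewrite /bf eqxx.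
have bfj x : \prod_(j | j != i) bf n j (c j x) = \prod_(j | j != i) bm n j (c j x).
  by apply: eq_bigr => j /negbTE ji; rewrite /bf ji.
transitivity (\int[m]_x (p x * ((\prod_(j | j != i) bf n j (c j x)) * derive1 (bf n i) (c i x)))).
  by apply: eq_Rintegral => x _; rewrite bfj bfi derive_ramp.
rewrite weak; last first.
  move=> j; rewrite /bf; case: eqP => _.
    by split; [exact: smooth_ramp|exact: ramp_compact].
  by split; [exact: smooth_bump|exact: bump_compact].
congr (- _); apply: eq_Rintegral => x _.
by rewrite (bigD1 i)//= bfi bfj mulrC [X in _ = _ * X]mulrC mulrC.
Qed.

Let mbm n j : measurable_fun setT (fun x => bm n j (c j x)).
Proof.
apply: measurableT_comp => //.
by apply: continuous_measurable_fun; exact: continuous_bump.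
Qed.

Let mbmt n j t : measurable_fun setT (fun x => bm n j (c j x + t)).
Proof.
apply: (@measurableT_comp _ _ _ _ _ _ (bm n j) _ (fun x => c j x + t)).
  by apply: continuous_measurable_fun; exact: continuous_bump.
exact: measurable_funD.
Qed.

Let mbms n : measurable_fun [set: TR] (fun z => bm n i (c i z.1 - z.2)).
Proof.
apply: (@measurableT_comp _ _ _ _ _ _ (bm n i) _ (fun z : TR => c i z.1 - z.2)).
  by apply: continuous_measurable_fun; exact: continuous_bump.
apply: measurable_funB; last exact: measurable_snd.
exact: measurableT_comp.
Qed.

Let mprod n : measurable_fun setT (fun x => \prod_(j | j != i) bm n j (c j x)).
Proof.
under eq_fun => x do rewrite big_mkcond.
by apply: (@measurable_prod _ T R setT I) => j _; case: (j != i).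
Qed.

(** The integrand [q * test] of the weak identity once [rampE] has made the ramp an integral over
    [s] in [[-n, 0]]. It is dominated by [|k|], and its limit [k1] is the restriction of [k] to
    [s <= 0]. *)
Let kn n (z : TR) := q z.1 * ((\prod_(j | j != i) bm n j (c j z.1)) *
  (\1_(`[(- n%:R)%R, 0%R]%classic : set R) z.2 * bm n i (c i z.1 - z.2))).
Let k1 (z : TR) := k z * \1_(`]-oo, 0%R]%classic : set R) z.2.

Let kE z : k z = q z.1 * ((\prod_(j | j != i) (a j < c j z.1 < b j)%R%:R) *
  (a i < c i z.1 - z.2 < b i)%R%:R).
Proof.
rewrite /k indic_box (bigD1 i)//= mulrC [RHS]mulrC; congr (_ * _).
rewrite mulrC c_tau eqxx; congr (_ * _); apply: eq_bigr => j /negbTE ji.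
by rewrite c_tau ji addr0.
Qed.

Let prod_bm_le n x : 0 <= \prod_(j | j != i) bm n j (c j x) <=
  \prod_(j | j != i) (a j < c j x < b j)%R%:R.
Proof.
rewrite prodr_ge0 => [/=|j _]; last exact: bump_ge0.
by apply: ler_prod => j _; rewrite bump_ge0 bump_le.
Qed.

Let kn_le n z : `|kn n z| <= `|k z|.
Proof.
rewrite kE /kn normrM [leRHS]normrM ler_wpM2l//.
have /andP[h1 h2] := prod_bm_le n z.1.
have i0 : 0 <= \1_(`[(- n%:R)%R, 0%R]%classic : set R) z.2 :> R by [].
rewrite ger0_norm; last exact: (mulr_ge0 h1 (mulr_ge0 i0 (bump_ge0 _ _ _ _))).
rewrite ger0_norm; last by rewrite mulr_ge0 ?prodr_ge0.
apply: ler_pM => //; first exact: (mulr_ge0 i0 (bump_ge0 _ _ _ _)).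
rewrite -[leRHS]mul1r ler_pM ?bump_ge0// ?bump_le//.
Qed.

Let mkn n : measurable_fun setT (kn n).
Proof.
apply: measurable_funM; first exact: measurableT_comp.
apply: measurable_funM; first exact: (measurableT_comp (mprod n)).
apply: measurable_funM => //; apply: measurableT_comp; last exact: measurable_snd.
exact: measurable_indic.
Qed.

Let mk1 : measurable_fun setT k1.
Proof.
apply: measurable_funM => //; apply: measurableT_comp; last exact: measurable_snd.
exact: measurable_indic.
Qed.

Let ikn n : (prodm m mleb).-integrable setT (EFin \o kn n).
Proof. exact: (Rintegrable_le (mkn n) (kn_le n) (Rintegrable_norm ik)). Qed.

Let int_kn n : \int[prodm m mleb]_z kn n z =
  \int[m]_x (q x * ((\prod_(j | j != i) bm n j (c j x)) * ramp (a i) (b i) n (c i x))).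
Proof.
rewrite Rfubini1//; apply: eq_Rintegral => x _; rewrite /kn/=.
under eq_Rintegral => s _ do rewrite mulrA [\1_ _ _ * _]mulrC.
rewrite (@RintegralZl _ (measurableTypeR R) R mleb)//.
  by rewrite (Rint_indic (fun s => bm n i (c i x - s)))// rampE mulrA.
apply/(integrable_indic_mul (fun s => bm n i (c i x - s))) => //.
apply: (@continuous_integrable _ (fun s => bm n i (c i x - s))) => s.
apply: (@continuous_comp _ _ _ (fun s => c i x - s) (bm n i)).
  by apply: cvgB; [exact: cvg_cst|exact: cvg_id].
exact: continuous_bump.
Qed.

Let cvg_prod (x : T) : \prod_(j | j != i) bm n j (c j x) @[n --> \oo] -->
  \prod_(j | j != i) ((a j < c j x < b j)%R%:R : R).
Proof.
elim: (index_enum I) => [|j s IHs].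
  rewrite big_nil (_ : (fun n => _) = cst 1); first exact: cvg_cst.
  by apply/funext => n; rewrite big_nil.
rewrite big_cons (_ : (fun n => _) = (fun n => if j != i then
  bm n j (c j x) * \prod_(j <- s | j != i) bm n j (c j x) else
  \prod_(j <- s | j != i) bm n j (c j x))); last by apply/funext => n; rewrite big_cons.
by case: ifP => // _; apply: cvgM => //; exact: cvg_bump.
Qed.

Let cvg_kn z : kn n z @[n --> \oo] --> k1 z.
Proof.
rewrite /k1 kE -mulrA; apply: cvgM; first exact: cvg_cst.
rewrite -mulrA; apply: cvgM; first exact: cvg_prod.
rewrite mulrC; apply: cvgM; last exact: cvg_bump.
apply: cvg_near_cst; near=> n; rewrite !indicE; congr ((_ : bool)%:R); apply/idP/idP.
  by rewrite !inE/= !in_itv/= => /andP[].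
rewrite !inE/= !in_itv/= => ->; rewrite andbT lerNl; near: n; exact: nbhs_infty_ger.
Unshelve. all: by end_near. Qed.

Let cvg_int_kn : \int[prodm m mleb]_z kn n z @[n --> \oo] --> \int[prodm m mleb]_z k1 z.
Proof. by have [] := Rdct mkn mk1 cvg_kn (Rintegrable_norm ik) kn_le. Qed.

Let ip1 : m.-integrable setT (fun x => (\1_(box c a b) x * p x)%:E).
Proof.
apply: (Rintegrable_le _ _ (Rintegrable_norm ip)); first exact: measurable_funM.
by move=> x; rewrite normrM indicE; case: (_ \in _); rewrite ?normr1 ?normr0 ?mul1r ?mul0r.
Qed.

Let cvg_int_p :
  \int[m]_x (p x * ((\prod_(j | j != i) bm n j (c j x)) * (bm n i (c i x + n%:R) - bm n i (c i x))))
    @[n --> \oo] --> - \int[m]_x (\1_(box c a b) x * p x).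
Proof.
rewrite [X in _ --> X](_ : _ = \int[m]_x (- (\1_(box c a b) x * p x))); last first.
  rewrite -mulN1r -RintegralZl//; apply: eq_Rintegral => x _; by rewrite mulN1r.
have [||||//|] := @Rdct _ T R m (fun n x => p x * ((\prod_(j | j != i) bm n j (c j x)) *
    (bm n i (c i x + n%:R) - bm n i (c i x))))
  (fun x => - (\1_(box c a b) x * p x)) (fun x => `|p x|).
- move=> n; apply: measurable_funM => //; apply: measurable_funM; first exact: mprod.
  exact: measurable_funB.
- by apply: measurableT_comp => //; exact: measurable_funM.
- move=> x; rewrite indic_box (bigD1 i)//= -mulNr -mulrN mulrC; apply: cvgM; first exact: cvg_cst.
  rewrite mulrN -mulNr mulrC; apply: cvgM; first exact: cvg_prod.
  rewrite -[X in _ --> X]sub0r; apply: cvgB; last exact: cvg_bump.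
  (* Once [n] exceeds [b i - c i x], the point has left the support of the shifted bump, and only
     the bump on []a i, b i[] remains. *)
  apply: cvg_near_cst; near=> n; rewrite /bm bump_out// negb_and -!leNgt; apply/orP; right.
  rewrite -lerBlDl; near: n; exact: nbhs_infty_ger.
- exact: Rintegrable_norm.
- move=> n x; rewrite normrM -[leRHS]mulr1 ler_wpM2l// normrM -[leRHS]mulr1.
  have /andP[h1 h2] := prod_bm_le n x.
  rewrite ler_pM// ?(ger0_norm h1).
    by apply: le_trans h2 _; apply: prodr_ile1 => j _; case: (_ < _ < _)%R; rewrite ?lexx ?ler01.
  have := bump_ge0 (a i) (b i) n (c i x + n%:R); have := bump_le (a i) (b i) n (c i x + n%:R).
  have := bump_ge0 (a i) (b i) n (c i x); have := bump_le (a i) (b i) n (c i x).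
  have b1 (e : bool) : e%:R <= 1 :> R by case: e.
  move: (b1 (a i < c i x + n%:R < b i)) (b1 (a i < c i x < b i)).
  by rewrite /bm ler_norml; lra.
- by [].
Unshelve. all: by end_near. Qed.

Let Q x := \int[leb]_(s in `]-oo, 0%R]) q (tau s x).

Let iK1 : (prodm m mleb).-integrable setT (EFin \o (fun z : TR => k1 (sg z))).
Proof.
apply: (mpres_integrable sg_mpres); apply: (Rintegrable_le mk1 _ (Rintegrable_norm ik)) => z.
by rewrite /k1 normrM indicE; case: (_ \in _); rewrite ?normr1 ?normr0 ?mulr1 ?mulr0.
Qed.

Let K1E x : \int[mleb]_s k1 (sg (x, s)) = \1_(box c a b) x * Q x.
Proof.
rewrite /Q -Rint_indic// /k1 /k /sg/=.
under eq_Rintegral => s _ do rewrite tauN.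
rewrite indicE; case: (_ \in _); rewrite ?mul1r ?mul0r.
  by apply: eq_Rintegral => s _; rewrite mulr1.
by under eq_Rintegral => s _ do rewrite mulr0 mul0r; rewrite Rintegral_cst// mul0r.
Qed.

Lemma shift_box : m.-integrable setT (fun x => (\1_(box c a b) x * (p x - Q x))%:E) /\
  \int[m]_x (\1_(box c a b) x * (p x - Q x)) = 0.
Proof.
have iQ : m.-integrable setT (fun x => (\1_(box c a b) x * Q x)%:E).
  have := integrable_Rint_snd iK1; congr (integrable _ _ _).
  by apply/funext => x /=; rewrite K1E.
have E : (fun x => \1_(box c a b) x * (p x - Q x)) =
    (fun x => \1_(box c a b) x * p x - \1_(box c a b) x * Q x).
  by apply/funext => x; rewrite mulrBr.
split; first by have := RintegrableB ip1 iQ; rewrite -E.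
rewrite E RintegralB//; apply/eqP; rewrite subr_eq0; apply/eqP/oppr_inj.
have := cvg_int_p; under eq_cvg => n do rewrite bf_weak -int_kn.
move=> h; apply: (cvg_unique _ h) => //.
rewrite /= (_ : \int[m]_x (\1_(box c a b) x * Q x) = \int[prodm m mleb]_z k1 z); first exact: cvgN.
rewrite -(mpres_Rintegral sg_mpres mk1) (Rfubini1 iK1).
by apply: eq_Rintegral => x _; rewrite K1E.
Qed.

End onebox.

(** Integrability along the orbits is known from each box, and the cubes []-n, n[] exhaust the
    space. The equality holds after integration over every box by [shift_box], hence almost
    everywhere by [box_ae0]. *)
Lemma shift_rep : {ae m, forall x, leb.-integrable setT (fun s => (q (tau s x))%:E)} /\
  {ae m, forall x, p x = \int[leb]_(s in `]-oo, 0%R]) q (tau s x)}.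
Proof.
split.
  have h n := ae_integrable_line (fun=> - n%:R) (fun=> n%:R).
  apply: (ae_imp (ae_foralln h)) => x {}h.
  pose M := \sum_j `|c j x|.
  apply: (h (Num.truncn M).+1); rewrite indicE mem_set// => j /=.
  rewrite -ltr_norml; apply: le_lt_trans (truncnS_gt _).
  by rewrite /M (bigD1 j)//= lerDl sumr_ge0.
apply: (@ae_imp _ _ _ m (fun x => p x - \int[leb]_(s in `]-oo, 0%R]) q (tau s x) = 0)); last first.
  by move=> x /eqP; rewrite subr_eq0 => /eqP.
apply: (box_ae0 mc gen).
- apply: measurable_funB => //.
  rewrite (_ : (fun x => _) = (fun x => \int[mleb]_s (q (tau s x) * \1_(`]-oo, 0%R]%classic : set R) s))).
    apply: (@measurable_Rint _ _ _ _ _ mleb (fun z : TR => q (tau z.2 z.1) * \1_(`]-oo, 0%R]%classic : set R) z.2)).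
    apply: measurable_funM; first exact: measurableT_comp.
    by apply: measurableT_comp; [exact: measurable_indic|exact: measurable_snd].
  by apply/funext => x; rewrite Rint_indic.
- by move=> a b; have [] := shift_box a b.
- by move=> a b; have [] := shift_box a b.
Qed.

End shift.

(** * Conditional logarithmic Sobolev inequality *)

Section cauchy_schwarz.
Context d (T : measurableType d) (R : realType) (m : {measure set T -> \bar R}).

(** Cauchy-Schwarz in linearised form: [a^2 / b >= 2 c a - c^2 b] for every constant [c], and at
    [c = A / B] the right-hand side integrates to [A^2 / B]. *)
Lemma Ff_integral (b a : T -> R) : m.-integrable setT (EFin \o b) ->
  m.-integrable setT (EFin \o a) -> (forall x, 0 <= b x) ->
  {ae m, forall x, b x = 0 -> a x = 0} ->
  ((Ff (\int[m]_x b x) (\int[m]_x a x))%:E <= \int[m]_x (Ff (b x) (a x))%:E)%E.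
Proof.
move=> ib ia b0 ba.
have mb := Rintegrable_measurable ib; have ma := Rintegrable_measurable ia.
set B := \int[m]_x b x; set A := \int[m]_x a x.
have F0 x : 0 <= Ff (b x) (a x) by exact: Ff_ge0.
have mF : measurable_fun setT (fun x => Ff (b x) (a x)) by exact: measurable_Ff.
rewrite {1}/Ff; have [_|B0] := eqVneq B 0.
  by apply: integral_ge0 => x _; rewrite lee_fin.
have [Foo|Foo] := eqVneq (\int[m]_x (Ff (b x) (a x))%:E)%E +oo%E; first by rewrite Foo leey.
have iF : m.-integrable setT (EFin \o (fun x => Ff (b x) (a x))).
  by apply: ge0_integrable => //; rewrite ltey.
pose c := A / B.
have i1 : m.-integrable setT (EFin \o (fun x => 2 * c * a x)) by exact: RintegrableZ.
have i2 : m.-integrable setT (EFin \o (fun x => c ^+ 2 * b x)) by exact: RintegrableZ.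
have -> : A ^+ 2 / B = \int[m]_x (2 * c * a x - c ^+ 2 * b x).
  rewrite RintegralB// !RintegralZl// -/A -/B /c; by field.
rewrite -(RintegralE (RintegrableB i1 i2)).
have mf := Rintegrable_measurable (RintegrableB i1 i2).
(* The positive part is inserted because the almost everywhere comparison is between nonnegative
   functions. *)
apply: (@le_trans _ _ (\int[m]_x (Num.max (2 * c * a x - c ^+ 2 * b x) 0)%:E)%E).
  apply: le_integral => //; first exact: RintegrableB.
    apply: (Rintegrable_le _ _ (Rintegrable_norm (RintegrableB i1 i2))).
      by apply: measurable_maxr => //; exact: mf.
    by move=> x; rewrite ger0_norm ?le_max ?lexx ?orbT// ge_max ler_norm normr_ge0.
  by move=> x _; rewrite lee_fin le_max lexx.
apply: ae_ge0_Rle => //; first by apply: measurable_maxr => //; exact: mf.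
  by move=> x; rewrite le_max lexx orbT.
apply: (ae_imp ba) => x bax; rewrite ge_max F0 andbT /Ff.
case: eqP => [bx|/eqP bx]; first by rewrite bx bax// !mulr0 subrr.
rewrite -subr_ge0 (_ : _ - _ = (a x - c * b x) ^+ 2 / b x); last by field.
by rewrite divr_ge0// sqr_ge0.
Qed.

End cauchy_schwarz.

(** * Conditional inequality for a one-dimensional fibre *)

Section lsi_slice.
Context d (W : measurableType d) (R : realType) (m : {sigma_finite_measure set W -> \bar R}).
Local Notation leb := (@lebesgue_measure R).
Let mleb : {sigma_finite_measure set (measurableTypeR R) -> \bar R} := leb.
Let WR := (W * measurableTypeR R)%type.
Local Notation mm := (prodm m mleb).

Variables p q : WR -> R.
Hypotheses (ip : mm.-integrable setT (EFin \o p)) (iq : mm.-integrable setT (EFin \o q)).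
Hypothesis p0 : forall z, 0 <= p z.
Hypothesis pq0 : {ae mm, forall z, p z = 0 -> q z = 0}.
Hypothesis pE : {ae mm, forall z, p z = \int[leb]_(t in `]-oo, z.2]) q (z.1, t)}.
Let J := (\int[mm]_z (Ff (p z) (q z + z.2 * p z))%:E)%E.
Hypothesis Joo : (J < +oo)%E.

Let P w := \int[mleb]_r p (w, r).
Let K (z : WR) := Kf (p z) (P z.1 * gauss z.2).

Let mp : measurable_fun setT p := Rintegrable_measurable ip.
Let mq : measurable_fun setT q := Rintegrable_measurable iq.
Let mP : measurable_fun setT P. Proof. exact: measurable_Rint. Qed.
Let mPg : measurable_fun setT (fun z : WR => P z.1 * gauss z.2).
Proof.
apply: measurable_funM; first exact: measurableT_comp.
by apply: measurableT_comp; [exact: measurable_gauss|exact: measurable_snd].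
Qed.
Let mK : measurable_fun setT K. Proof. exact: measurable_Kf. Qed.
Let mS : measurable_fun setT (fun z : WR => Ff (p z) (q z + z.2 * p z)).
Proof.
apply: measurable_Ff => //; apply: measurable_funD => //.
by apply: measurable_funM => //; exact: measurable_snd.
Qed.

Let P0 w : 0 <= P w. Proof. by apply: fine_ge0; apply: integral_ge0 => r _; rewrite lee_fin. Qed.

Let slice : {ae m, forall w, (\int[mleb]_r `|(K (w, r))%:E| <=
  2^-1%:E * \int[mleb]_r (Ff (p (w, r)) (q (w, r) + r * p (w, r)))%:E)%E}.
Proof.
have a1 := ae_integrable_fst ip; have a2 := ae_integrable_fst iq.
have a3 := ae_slice1 pq0; have a4 := ae_slice1 pE.
apply: (ae_imp2 (ae_imp2 a1 a2 (fun w => @conj _ _)) (ae_imp2 a3 a4 (fun w => @conj _ _))).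
move=> w [ipw iqw] [pqw pEw].
(* On a slice of mass 0 the conventions [0^-1 = 0] and [ln 0 = 0] make [K] equal to [- p], whose
   absolute value has integral 0. *)
have [Pw0|Pw] := eqVneq (P w) 0.
  rewrite (_ : \int[mleb]_r `|(K (w, r))%:E| = \int[mleb]_r (p (w, r))%:E)%E.
    rewrite (RintegralE ipw) -/(P w) Pw0 mule_ge0// ?lee_fin//.
    by apply: integral_ge0 => r _; rewrite lee_fin Ff_ge0.
  apply: eq_integral => r _; rewrite /K /Kf /= Pw0 mul0r invr0 mulr0 ln0// mulr0 addr0 sub0r.
  by rewrite normrN ger0_norm.
have Pw_gt0 : 0 < P w by rewrite lt_neqAle eq_sym Pw P0.
(* [lsi1] asks for a derivative that vanishes at every zero of the density; [q] does so almost
   everywhere only. *)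
pose qt r := if p (w, r) == 0 then 0 else q (w, r).
have mpw : measurable_fun setT (fun r : R => p (w, r)) := Rintegrable_measurable ipw.
have mqw : measurable_fun setT (fun r : R => q (w, r)) := Rintegrable_measurable iqw.
have mqt : measurable_fun setT qt.
  apply: measurable_fun_ifT => //; apply: (@measurable_fun_bool _ _ _ _ true); rewrite setTI.
  rewrite (_ : _ @^-1` _ = (fun r : R => p (w, r)) @^-1` [set 0]).
    by rewrite -[X in measurable X]setTI; exact: mpw.
  by apply/seteqP; split => r /= /eqP.
have qtE : {ae leb, forall r, qt r = q (w, r)}.
  by apply: (@ae_imp _ (measurableTypeR R) R leb _ _ pqw) => r pqr; rewrite /qt; case: eqP => // /pqr ->.
have iqt : leb.-integrable setT (EFin \o qt).
  apply: (@Rintegrable_le _ (measurableTypeR R) R leb _ _ mqt _ (Rintegrable_norm iqw)) => r.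
  by rewrite /qt; case: ifP => // _; rewrite normr0.
have := @lsi1 R (fun r => p (w, r)) qt mpw (fun r => p0 _) ipw iqt.
have qt0 r : p (w, r) = 0 -> qt r = 0 by rewrite /qt => ->; rewrite eqxx.
have pEt : {ae leb, forall r, p (w, r) = \int[leb]_(t in `]-oo, r]) qt t}.
  apply: (@ae_imp _ (measurableTypeR R) R leb _ _ pEw) => r ->.
  rewrite -(Rint_indic (fun t => q (w, t)) (measurable_itv _)) -(Rint_indic qt (measurable_itv _)).
  apply: (@ae_eq_Rintegral _ (measurableTypeR R) R leb).
  - by apply: measurable_funM => //; exact: measurable_indic.
  - by apply: measurable_funM => //; exact: measurable_indic.
  - by apply: (@ae_imp _ (measurableTypeR R) R leb _ _ qtE) => t ->.
move=> /(_ qt0 pEt); congr (_ <= _)%E.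
  apply: eq_integral => r _; rewrite /K/= ger0_norm//.
  by apply: Kf_ge0 => //; rewrite mulr_gt0 ?gauss_gt0.
congr (_ * _)%E; apply: eq_integral => r _; rewrite /Ff /qt; case: ifP => // -> //.
Qed.

Let K_le : (\int[mm]_z `|(K z)%:E| <= 2^-1%:E * J)%E.
Proof.
rewrite tonelli1//; last by apply: measurableT_comp => //; exact/measurable_EFinP.
rewrite /J tonelli1//; last 2 first.
- exact/measurable_EFinP.
- by move=> z; rewrite lee_fin Ff_ge0.
have mS1 : measurable_fun setT (fun w => \int[mleb]_r (Ff (p (w, r)) (q (w, r) + r * p (w, r)))%:E)%E.
  apply: (measurable_fun_fubini_tonelli_F (m2 := mleb) (fun z : WR => (Ff (p z) (q z + z.2 * p z))%:E)).
    exact/measurable_EFinP.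
  by move=> z; rewrite lee_fin Ff_ge0.
have S0 w : (0 <= \int[mleb]_r (Ff (p (w, r)) (q (w, r) + r * p (w, r)))%:E)%E.
  by apply: integral_ge0 => r _; rewrite lee_fin Ff_ge0.
rewrite -ge0_integralZl//; apply: ae_ge0_le_integral => //.
- by move=> w _; exact: integral_ge0.
- apply: (measurable_fun_fubini_tonelli_F (m2 := mleb) (fun z : WR => `|(K z)%:E|%E)) => //.
  by apply: measurableT_comp => //; exact/measurable_EFinP.
- by move=> w _; rewrite mule_ge0.
- exact: measurable_funeM.
- by apply: filterS slice => w h _.
Qed.

Let J0 : (0 <= J)%E. Proof. by apply: integral_ge0 => z _; rewrite lee_fin Ff_ge0. Qed.

(** The integrand [u] differs from [K] by [p - P * gauss], of total integral 0. The integrability of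
    [K] results from the inequality itself, integrated over the slices by Tonelli. *)
Lemma lsi_slice :
  let u z := p z * ln (p z / (P z.1 * gauss z.2)) in
  mm.-integrable setT (EFin \o u) /\ ((\int[mm]_z u z)%:E <= 2^-1%:E * J)%E.
Proof.
move=> u.
have iK : mm.-integrable setT (EFin \o K).
  apply/integrableP; split; first exact/measurable_EFinP.
  by apply: le_lt_trans K_le _; rewrite lte_mul_pinfty// ?lee_fin// ge0_fin_numE.
have iP : m.-integrable setT (EFin \o P) by exact: integrable_Rint_snd.
have iPg : mm.-integrable setT (EFin \o (fun z : WR => P z.1 * gauss z.2)).
  by apply: (@integrable_tensor _ _ _ _ R m mleb) => //; exact: integrable_gauss.
have uE : u = (fun z => (K z + p z) - P z.1 * gauss z.2).
  by apply/funext => z; rewrite /u /K /Kf; ring.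
have iu : mm.-integrable setT (EFin \o u).
  by rewrite uE; apply: RintegrableB => //; exact: RintegrableD.
split=> //; rewrite uE RintegralB//; last exact: RintegrableD.
rewrite RintegralD//.
have -> : \int[mm]_z (P z.1 * gauss z.2) = \int[mm]_z p z.
  rewrite (Rfubini1 iPg) (Rfubini1 ip); apply: eq_Rintegral => w _ /=.
  rewrite (@RintegralZl _ (measurableTypeR R) R mleb)//; last exact: integrable_gauss.
  by rewrite /Rintegral integral_gauss/= mulr1.
rewrite addrK -(RintegralE iK); apply: le_trans K_le.
apply: le_integral => //; first exact: integrable_abse.
by move=> z _; exact: lee_abs.
Qed.

End lsi_slice.

(** * Splitting and shifting the coordinates of R^d *)

Section vcons_mpres.
Variable R : realType.
Local Notation leb := (@lebesgue_measure R).
Let mleb : {sigma_finite_measure set (measurableTypeR R) -> \bar R} := leb.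

Lemma mpres_integrableP d1 d2 (T1 : measurableType d1) (T2 : measurableType d2)
    (mX : {measure set T1 -> \bar R}) (mY : {measure set T2 -> \bar R}) (h : T1 -> T2)
    (hP : mpres mX mY h) (g : T2 -> R) : measurable_fun setT g ->
  mX.-integrable setT (EFin \o (fun x => g (h x))) -> mY.-integrable setT (EFin \o g).
Proof.
move=> mg /integrableP[_ ioo]; apply/integrableP; split; first exact/measurable_EFinP.
have [_ hh] := hP; rewrite -(hh (fun y => `|(g y)%:E|)%E)//.
by apply: measurableT_comp => //; exact/measurable_EFinP.
Qed.

Lemma vconsp_mpres k : mpres (prodm mleb (lam R k)) (lam R k.+1) (@vconsp R k).
Proof.
split; first exact: measurable_vconsp.
move=> g mg g0; rewrite tonelli1//; last exact: (measurableT_comp mg (@measurable_vconsp R k)).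
by rewrite integral_lamS.
Qed.

(** Read backwards, it moves the first coordinate of the vector into the parameter, on which the
    induction over the dimension then conditions. *)
Definition vassoc d (W : measurableType d) k (z : (W * measurableTypeR R) * Rd R k) : W * Rd R k.+1 :=
  (z.1.1, vcons z.1.2 (z.2 : 'rV[R]_k)).

Lemma measurable_vassoc d (W : measurableType d) k : measurable_fun setT (@vassoc d W k).
Proof.
apply: measurable_fun_pair; first by apply: measurableT_comp.
apply: (@measurableT_comp _ _ _ _ _ _ (@vconsp R k) _
  (fun z : (W * measurableTypeR R) * Rd R k => (z.1.2, z.2))); first exact: measurable_vconsp.
by apply: measurable_fun_pair => //; apply: measurableT_comp => //; exact: measurable_snd.
Qed.

Lemma vassoc_mpres d (W : measurableType d) (m : {sigma_finite_measure set W -> \bar R}) k :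
  mpres (prodm (prodm m mleb) (lam R k)) (prodm m (lam R k.+1)) (@vassoc d W k).
Proof.
split; first exact: measurable_vassoc.
move=> g mg g0; have mgv := measurableT_comp mg (@measurable_vassoc d W k).
rewrite tonelli1//= tonelli1//=; last 2 first.
- by apply: (@measurable_fun_fubini_tonelli_F _ _ _ _ R (lam R k) (g \o @vassoc d W k) mgv) => z; exact: g0.
- by move=> z; exact: integral_ge0.
rewrite tonelli1//; apply: eq_integral => w _.
by rewrite integral_lamS//; exact: (measurableT_comp mg (measurable_pair1 w)).
Qed.

Lemma sqnorm_vcons k (t : R) (y : 'rV[R]_k) : sqnorm (vcons t y) = t ^+ 2 + sqnorm y.
Proof.
rewrite /sqnorm big_ord_recl vcons0; congr (_ + _).
by apply: eq_bigr => j _; rewrite vconsS.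
Qed.

Lemma phi_vcons k (t : R) (y : 'rV[R]_k) : phi (vcons t y) = gauss t * phi y.
Proof.
rewrite /phi /gauss sqnorm_vcons exprS.
have -> : - ((t ^+ 2 + sqnorm y) / 2) = - (t ^+ 2 / 2) + - (sqnorm y / 2) by ring.
by rewrite expRD; ring.
Qed.

Lemma phi_gt0 k (x : 'rV[R]_k) : 0 < phi x.
Proof. by rewrite mulr_gt0 ?expR_gt0// exprn_gt0// invr_gt0 sqrtr_gt0 mulr_gt0// pi_gt0. Qed.

Lemma measurable_sqnorm k : measurable_fun [set: Rd R k] (fun x : Rd R k => sqnorm (x : 'rV[R]_k)).
Proof. by apply: measurable_sum => i; apply: measurable_funX; exact: measurable_coord. Qed.

Lemma measurable_phi k : measurable_fun [set: Rd R k] (fun x : Rd R k => phi (x : 'rV[R]_k)).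
Proof.
apply: measurable_funM => //; apply: measurableT_comp => //; apply: measurableT_comp => //.
by apply: measurable_funM => //; exact: measurable_sqnorm.
Qed.

Definition vshift k (i : 'I_k) (s : R) (y : Rd R k) : Rd R k :=
  (y : 'rV[R]_k) + s *: delta_mx ord0 i.

Lemma vshift_coord k (i j : 'I_k) s (y : Rd R k) :
  (vshift i s y : 'rV[R]_k) ord0 j = (y : 'rV[R]_k) ord0 j + (if j == i then s else 0).
Proof. by rewrite !mxE eqxx/=; case: eqP => _; rewrite ?mulr1 ?mulr0. Qed.

Lemma vshift_mpres k (i : 'I_k) s : mpres (lam R k) (lam R k) (vshift i s).
Proof.
split; last by move=> g mg g0; exact: lam_shift.
have := @measurable_affine R k 1 (s *: delta_mx ord0 i).
by congr measurable_fun; apply/funext => x; rewrite scale1r.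
Qed.

Lemma vshiftD k (i : 'I_k) s t x : vshift i s (vshift i t x) = vshift i (s + t) x.
Proof. by apply/rowP => j; rewrite !vshift_coord -addrA; case: ifP => _; rewrite ?addr0// [t + s]addrC. Qed.

Lemma vshiftN k (i : 'I_k) s x : vshift i (- s) (vshift i s x) = x.
Proof. by rewrite vshiftD addNr; apply/rowP => j; rewrite vshift_coord; case: ifP; rewrite addr0. Qed.

Lemma measurable_vshift k (i : 'I_k) : measurable_fun [set: Rd R k * R] (fun z => vshift i z.2 z.1).
Proof.
apply: measurable_fun_row => j; under eq_fun => z do rewrite vshift_coord.
apply: measurable_funD; first exact: (measurableT_comp (measurable_coord j) measurable_fst).
by case: (j == i) => //; exact: measurable_snd.
Qed.

Lemma vshift0_vcons k (s t : R) (y : 'rV[R]_k) : vshift ord0 s (vcons t y) = vcons (t + s) y.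
Proof.
apply/rowP => j; rewrite vshift_coord; have [l ->|->] := unliftP ord0 j.
  by rewrite !vconsS eq_sym -[_ == _]negbK neq_lift addr0.
by rewrite !vcons0 eqxx.
Qed.

Lemma vshiftS_vcons k (i : 'I_k) (s t : R) (y : 'rV[R]_k) :
  vshift (lift ord0 i) s (vcons t y) = vcons t (vshift i s y).
Proof.
apply/rowP => j; rewrite vshift_coord; have [l ->|->] := unliftP ord0 j.
  by rewrite !vconsS vshift_coord (inj_eq lift_inj).
by rewrite !vcons0 -[_ == _]negbK neq_lift addr0.
Qed.

End vcons_mpres.

(** * Induction on the dimension *)

Section cond_lsi.
Variable R : realType.
Local Notation leb := (@lebesgue_measure R).
Let mleb : {sigma_finite_measure set (measurableTypeR R) -> \bar R} := leb.

(* [q i] is the derivative of [p] in the [i]-th coordinate of the second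
   component, and [J i] is an average of conditional Fisher informations. *)
Definition cond_lsi_at k := forall d (W : measurableType d)
    (m : {sigma_finite_measure set W -> \bar R})
    (p : W * Rd R k -> R) (q : 'I_k -> W * Rd R k -> R),
  let mm := prodm m (lam R k) in
  let J i := (\int[mm]_z (Ff (p z) (q i z + (z.2 : 'rV[R]_k) ord0 i * p z))%:E)%E in
  let u z := p z * ln (p z / (\int[lam R k]_y p (z.1, y) * phi (z.2 : 'rV[R]_k))) in
  mm.-integrable setT (EFin \o p) -> (forall z, 0 <= p z) ->
  (forall i, mm.-integrable setT (EFin \o q i)) ->
  (forall i, {ae mm, forall z, p z = 0 -> q i z = 0}) ->
  (forall i, {ae mm, forall z, p z =
     \int[leb]_(s in `]-oo, 0%R]) q i (z.1, vshift i s z.2)}) ->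
  (forall i, J i < +oo)%E ->
  mm.-integrable setT (EFin \o u) /\ ((\int[mm]_z u z)%:E <= \sum_i 2^-1%:E * J i)%E.

(** In dimension 0 the density is its own marginal and [phi] is 1, so the integrand is identically
    0. *)
Lemma cond_lsi0 : cond_lsi_at 0.
Proof.
move=> d W m p q mm J u ip p0 iq pq0 pE Joo.
have u0 z : u z = 0.
  rewrite /u /Rintegral integral_lam0 /=; last first.
    by apply/measurable_EFinP; exact: (measurableT_comp (Rintegrable_measurable ip) (measurable_pair1 z.1)).
  rewrite /phi /sqnorm big_ord0 expr0 mul0r oppr0 expR0 !mulr1.
  have -> : (z.1, 0 : Rd R 0) = z by case: z => w y; congr pair; apply/rowP => -[].
  have [->|pz] := eqVneq (p z) 0; first by rewrite mul0r.
  by rewrite divff// ln1 mulr0.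
have -> : u = cst 0 by apply/funext.
by rewrite big_ord0 Rintegral_cst// mul0r lexx; split => //; exact: integrable0.
Qed.

Section step.
Variables (k : nat) (IH : cond_lsi_at k).
Context d (W : measurableType d) (m : {sigma_finite_measure set W -> \bar R}).
Variables (p : W * Rd R k.+1 -> R) (q : 'I_k.+1 -> W * Rd R k.+1 -> R).
Local Notation mm := (prodm m (lam R k.+1)).
Let J i := (\int[mm]_z (Ff (p z) (q i z + (z.2 : 'rV[R]_k.+1) ord0 i * p z))%:E)%E.
Hypotheses (ip : mm.-integrable setT (EFin \o p)) (p0 : forall z, 0 <= p z).
Hypothesis iq : forall i, mm.-integrable setT (EFin \o q i).
Hypothesis pq0 : forall i, {ae mm, forall z, p z = 0 -> q i z = 0}.
Hypothesis pE : forall i, {ae mm, forall z, p z =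
     \int[leb]_(s in `]-oo, 0%R]) q i (z.1, vshift i s z.2)}.
Hypothesis Joo : forall i, (J i < +oo)%E.

Let mp : measurable_fun setT p := Rintegrable_measurable ip.
Let mq i : measurable_fun setT (q i) := Rintegrable_measurable (iq i).
Let WR := (W * measurableTypeR R)%type.
Let m1 := prodm m mleb.
Let mv := prodm m1 (lam R k).
Let va := @vassoc R d W k.
Let vaP : mpres mv mm va := vassoc_mpres m k.
Let p' z := p (va z).
Let q' i z := q i (va z).
Let ip' : mv.-integrable setT (EFin \o p') := mpres_integrable vaP ip.
Let iq' i : mv.-integrable setT (EFin \o q' i) := mpres_integrable vaP (iq i).
(* Chain rule: the first coordinate is treated by [lsi_slice] for the marginal
   [p1], the others by induction, conditionally on it. *)
Let p1 (z : WR) : R := \int[lam R k]_y p' (z, y).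
Let q1 (z : WR) : R := \int[lam R k]_y q' ord0 (z, y).
Let ip1 : m1.-integrable setT (EFin \o p1) := integrable_Rint_snd ip'.
Let iq1 : m1.-integrable setT (EFin \o q1) := integrable_Rint_snd (iq' ord0).
Let p10 z : 0 <= p1 z.
Proof. by apply: fine_ge0; apply: integral_ge0 => y _; rewrite lee_fin p0. Qed.
Let mp' : measurable_fun setT p' := Rintegrable_measurable ip'.
Let mq' i : measurable_fun setT (q' i) := Rintegrable_measurable (iq' i).
Let mp1 : measurable_fun setT p1 := Rintegrable_measurable ip1.
Let J1 := (\int[m1]_z (Ff (p1 z) (q1 z + z.2 * p1 z))%:E)%E.
Let P w := \int[lam R k.+1]_x p (w, x).

Let zero_slice := ae_slice1 (zero_marginal ip' (fun z => p0 _)).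

Let zero1 : {ae m1, forall z, p1 z = 0 -> q1 z = 0}.
Proof.
apply: (ae_imp2 zero_slice (ae_slice1 (mpres_ae vaP (pq0 ord0)))) => z h1 h2 pz0.
have qz0 : {ae lam R k, forall y, q' ord0 (z, y) = 0}.
  by apply: (ae_imp2 h1 h2) => y h3 h4; apply/h4/h3.
rewrite /q1 (ae_eq_Rintegral (g := cst 0) _ _ qz0)//; first by rewrite Rintegral_cst// mul0r.
exact: (measurableT_comp (Rintegrable_measurable (iq' ord0)) (measurable_pair1 z)).
Qed.

(** Integrating the representation of [p] along the first coordinate over the other ones, and
    exchanging the integrals, shows that [p1] is a primitive of [q1]. The shift turns []-oo, 0]]
    into []-oo, r]]. *)
Let rep1 : {ae m1, forall z, p1 z = \int[leb]_(t in `]-oo, z.2]) q1 (z.1, t)}.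
Proof.
have h1 := ae_fst mleb (ae_integrable_fst (iq ord0)).
apply: (ae_imp2 h1 (ae_slice1 (mpres_ae vaP (pE ord0)))) => -[w r] /= iqw pEz.
have ih := mpres_integrable (vconsp_mpres R k) iqw.
have mh := Rintegrable_measurable ih.
pose h2 (z : (measurableTypeR R * Rd R k)%type) := q ord0 (w, vconsp z) * \1_(`]-oo, r]) z.1.
have mh2 : measurable_fun setT h2.
  apply: measurable_funM => //; apply: measurableT_comp => //; exact: measurable_indic.
have ih2 : (prodm mleb (lam R k)).-integrable setT (EFin \o h2).
  apply: (Rintegrable_le mh2 _ (Rintegrable_norm ih)) => z.
  by rewrite /h2 normrM indicE; case: (_ \in _); rewrite ?normr1 ?normr0 ?mulr1 ?mulr0.
rewrite -(Rint_indic (fun t => q1 (w, t)) (measurable_itv _)).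
transitivity (\int[prodm mleb (lam R k)]_z h2 z).
  rewrite (Rfubini2 ih2); apply: ae_eq_Rintegral.
  - exact: (measurableT_comp mp' (measurable_pair1 (w, r))).
  - exact: (Rintegrable_measurable (integrable_Rint_fst ih2)).
  apply: (ae_imp pEz) => y; rewrite /p' => ->.
  rewrite /h2/= (Rint_indic (fun t => q ord0 (w, vconsp (t, y))) (measurable_itv _)).
  have mhy : measurable_fun setT (fun t : R => q ord0 (w, vconsp (t, y))).
    exact: (measurableT_comp mh (measurable_pair2 y)).
  rewrite -(Rint_shift r mhy).
  by apply: eq_Rintegral => s _; rewrite /va /vassoc/= vshift0_vcons addrC.
rewrite (Rfubini1 ih2); apply: eq_Rintegral => t _; rewrite /h2/= indicE /q1.
case: (_ \in _); rewrite ?mulr1 ?mulr0; first by apply: eq_Rintegral => y _; rewrite mulr1.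
by under eq_Rintegral => y _ do rewrite mulr0; rewrite Rintegral_cst// mul0r.
Qed.

Let JE i : J i = (\int[mv]_z (Ff (p' z) (q' i z + (vcons z.1.2 (z.2 : 'rV[R]_k)) ord0 i * p' z))%:E)%E.
Proof.
have [_ h] := vaP; rewrite /J -h//; last by move=> z; rewrite lee_fin Ff_ge0.
apply/measurable_EFinP; apply: measurable_Ff => //; apply: measurable_funD; first exact: mq.
apply: measurable_funM; last exact: mp.
exact: (measurableT_comp (measurable_coord i) measurable_snd).
Qed.

(** Taking a marginal decreases the Fisher information: [q1 + r p1] is the integral of [q + r p]
    over a fibre on which [r] is constant, and [Ff_integral] applies. *)
Let J1_le : (J1 <= J ord0)%E.
Proof.
have mS : measurable_fun setT (fun z => Ff (p' z) (q' ord0 z + z.1.2 * p' z)).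
  apply: measurable_Ff => //; apply: measurable_funD; first exact: mq'.
  by apply: measurable_funM => //; apply: measurableT_comp => //; exact: measurable_snd.
rewrite JE (eq_integral (fun z => (Ff (p' z) (q' ord0 z + z.1.2 * p' z))%:E)); last first.
  by move=> z _; rewrite vcons0.
rewrite tonelli1; last 2 first.
- exact/measurable_EFinP.
- by move=> z; rewrite lee_fin Ff_ge0// p0.
apply: ae_ge0_le_integral => //.
- by move=> z _; rewrite lee_fin Ff_ge0.
- apply/measurable_EFinP; apply: measurable_Ff => //; apply: measurable_funD.
    exact: (Rintegrable_measurable iq1).
  by apply: measurable_funM => //; exact: measurable_snd.
- by move=> z _; apply: integral_ge0 => y _; rewrite lee_fin Ff_ge0// p0.
- apply: (measurable_fun_fubini_tonelli_F (m2 := lam R k) (fun z => (Ff (p' z) (q' ord0 z + z.1.2 * p' z))%:E)).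
    exact/measurable_EFinP.
  by move=> z; rewrite lee_fin Ff_ge0// p0.
have a1 := ae_imp2 (ae_integrable_fst ip') (ae_integrable_fst (iq' ord0)) (fun w => @conj _ _).
apply: (ae_imp2 a1 (ae_slice1 (mpres_ae vaP (pq0 ord0)))) => z [ipz iqz] pqz _.
have E : q1 z + z.2 * p1 z = \int[lam R k]_y (q' ord0 (z, y) + z.2 * p' (z, y)).
  by rewrite RintegralD// ?RintegralZl//; exact: RintegrableZ.
rewrite E /p1; apply: Ff_integral => //.
- by apply: RintegrableD => //; exact: RintegrableZ.
- by move=> y; exact: p0.
- by apply: (ae_imp pqz) => y h /[dup] py /h; rewrite /q' /p' in py * => ->; rewrite py mulr0 addr0.
Qed.

Let PE : {ae m, forall w, P w = \int[mleb]_r p1 (w, r)}.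
Proof.
apply: (ae_imp (ae_integrable_fst ip)) => w ipw.
have ih := mpres_integrable (vconsp_mpres R k) ipw.
by rewrite /P -(mpres_Rintegral (vconsp_mpres R k) (Rintegrable_measurable ipw)) (Rfubini1 ih).
Qed.

Let u1 (z : WR) := p1 z * ln (p1 z / (\int[mleb]_r p1 (z.1, r) * gauss z.2)).
Let v (z : WR * Rd R k) := p' z * ln (p1 z.1 / (\int[mleb]_r p1 (z.1.1, r) * gauss z.1.2)).

Let lsi_u1 : m1.-integrable setT (EFin \o u1) /\ ((\int[m1]_z u1 z)%:E <= 2^-1%:E * J ord0)%E.
Proof.
have J1oo : (J1 < +oo)%E by apply: le_lt_trans J1_le _.
have [i1 le1] := lsi_slice ip1 iq1 p10 zero1 rep1 J1oo.
split; first exact: i1.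
have h2 : (0 <= 2^-1%:E :> \bar R)%E by rewrite lee_fin.
exact: (le_trans le1 (lee_wpmul2l h2 J1_le)).
Qed.

Let ml : measurable_fun setT (fun z : WR => ln (p1 z / (\int[mleb]_r p1 (z.1, r) * gauss z.2))).
Proof.
apply: measurableT_comp; first exact: measurable_ln.
apply: measurable_funM => //; apply: measurableT_comp; first exact: measurable_inv.
apply: measurable_funM.
  exact: (measurableT_comp (Rintegrable_measurable (integrable_Rint_snd ip1)) measurable_fst).
by apply: measurableT_comp; [exact: measurable_gauss|exact: measurable_snd].
Qed.

Let mv_ : measurable_fun setT v.
Proof. by apply: measurable_funM => //; exact: (measurableT_comp ml measurable_fst). Qed.

Let iv : mv.-integrable setT (EFin \o v).
Proof.
apply/integrableP; split; first exact/measurable_EFinP.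
rewrite tonelli1//; last by apply: measurableT_comp => //; exact/measurable_EFinP.
have /integrableP[_] := lsi_u1.1; apply: le_lt_trans; rewrite le_eqVlt; apply/orP; left; apply/eqP.
apply: ae_eq_integral => //.
- apply: (measurable_fun_fubini_tonelli_F (m2 := lam R k) (fun z => `|(v z)%:E|%E)) => //.
  by apply: measurableT_comp => //; exact/measurable_EFinP.
- apply: measurableT_comp => //; apply/measurable_EFinP; exact: measurable_funM.
apply: (ae_imp (ae_integrable_fst ip')) => z ipz _ /=.
under eq_integral => y _ do rewrite /v/= normrM (ger0_norm (p0 _)) mulrC.
rewrite ge0_RZl//.
- by rewrite (RintegralE ipz) -/(p1 z) -EFinM /u1 normrM (ger0_norm (p10 z)) mulrC.
- exact: (Rintegrable_measurable ipz).
Qed.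

Let int_v : \int[mv]_z v z = \int[m1]_z u1 z.
Proof.
rewrite (Rfubini1 iv); apply: ae_eq_Rintegral.
- exact: Rintegrable_measurable (integrable_Rint_snd iv).
- exact: Rintegrable_measurable lsi_u1.1.
apply: (ae_imp (ae_integrable_fst ip')) => z ipz.
under eq_Rintegral => y _ do rewrite /v/= mulrC.
by rewrite RintegralZl// -/(p1 z) mulrC.
Qed.

Let u (z : W * Rd R k.+1) := p z * ln (p z / (P z.1 * phi (z.2 : 'rV[R]_k.+1))).
Let u' (z : WR * Rd R k) := p' z * ln (p' z / (p1 z.1 * phi (z.2 : 'rV[R]_k))).

(** The relative density is the conditional one times that of the marginal. Where [p > 0], both
    marginals are positive outside a null set, and the logarithm of the product can be split. *)
Let uE : {ae mv, forall z, u (va z) = u' z + v z}.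
Proof.
have a1 := zero_marginal ip' (fun z => p0 _).
have a2 := mpres_ae vaP (zero_marginal ip p0).
have a3 := ae_fst (lam R k) (ae_fst mleb PE).
apply: (ae_imp2 (ae_imp2 a1 a2 (fun z => @conj _ _)) a3) => -[[w r] y] /= [h1 h2].
rewrite /u /u' /v /p'/= -/(P w) => Pw; rewrite -Pw.
set z := (w, r, y); rewrite phi_vcons.
have [pz|pz] := eqVneq (p (va z)) 0; first by rewrite pz !mul0r addr0.
have P1 : 0 < p1 (w, r).
  by rewrite lt_neqAle p10 andbT; apply: contra pz => /eqP/esym/h1/eqP.
have Pgt0 : 0 < P w.
  rewrite lt_neqAle; apply/andP; split; first by apply: contra pz => /eqP/esym/h2/eqP.
  by apply: fine_ge0; apply: integral_ge0 => x _; rewrite lee_fin p0.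
have p_gt0 : 0 < p (va z) by rewrite lt_neqAle eq_sym pz p0.
have g0 := gauss_gt0 r; have f0 := phi_gt0 (y : 'rV[R]_k).
have -> : p (va z) / (P w * (gauss r * phi (y : 'rV[R]_k))) =
    (p (va z) / (p1 (w, r) * phi (y : 'rV[R]_k))) * (p1 (w, r) / (P w * gauss r)).
  by field; rewrite !gt_eqF.
by rewrite lnM ?mulrDr// posrE divr_gt0// mulr_gt0.
Qed.

Lemma cond_lsi_step : mm.-integrable setT (EFin \o u) /\
  ((\int[mm]_z u z)%:E <= \sum_i 2^-1%:E * J i)%E.
Proof.
have pqS i : {ae mv, forall z, p' z = 0 -> q' (lift ord0 i) z = 0} by exact: (mpres_ae vaP (pq0 (lift ord0 i))).
have pES i : {ae mv, forall z, p' z = \int[leb]_(s in `]-oo, 0%R]) q' (lift ord0 i) (z.1, vshift i s z.2)}.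
  apply: (ae_imp (mpres_ae vaP (pE (lift ord0 i)))) => z; rewrite /p' => ->.
  by apply: eq_Rintegral => s _; rewrite /q' /va /vassoc/= vshiftS_vcons.
have JES i : (\int[mv]_z (Ff (p' z) (q' (lift ord0 i) z + (z.2 : 'rV[R]_k) ord0 i * p' z))%:E = J (lift ord0 i))%E.
  by rewrite JE; apply: eq_integral => z _; rewrite vconsS.
have JSoo i : (\int[mv]_z (Ff (p' z) (q' (lift ord0 i) z + (z.2 : 'rV[R]_k) ord0 i * p' z))%:E < +oo)%E.
  by rewrite JES.
have [iu' leu'] := IH ip' (fun z => p0 _) (fun i => iq' (lift ord0 i)) pqS pES JSoo.
have mu : measurable_fun setT u.
  apply: measurable_funM => //; apply: measurableT_comp; first exact: measurable_ln.
  apply: measurable_funM => //; apply: measurableT_comp; first exact: measurable_inv.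
  apply: measurable_funM; last by apply: measurableT_comp; [exact: measurable_phi|exact: measurable_snd].
  exact: (measurableT_comp (Rintegrable_measurable (integrable_Rint_snd ip)) measurable_fst).
have muv : measurable_fun setT (fun z => u (va z)) by exact: measurableT_comp mu vaP.1.
have iuv : mv.-integrable setT (EFin \o (fun z => u (va z))).
  apply: (ae_eq_integrable muv _ (RintegrableD iu' iv)).
  by apply: (ae_imp uE) => z ->.
split; first exact: (mpres_integrableP vaP mu iuv).
rewrite -(mpres_Rintegral vaP mu) (ae_eq_Rintegral muv _ uE); last first.
  exact: (Rintegrable_measurable (RintegrableD iu' iv)).
rewrite RintegralD// int_v EFinD addeC big_ord_recl; apply: leeD; first exact: lsi_u1.2.
by under eq_bigr => i _ do rewrite -JES.
Qed.

End step.

Lemma cond_lsi k : cond_lsi_at k.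
Proof.
elim: k => [|k IH]; first exact: cond_lsi0.
by move=> d W m p q mm J u ip p0 iq pq0 pE Joo; exact: cond_lsi_step.
Qed.

End cond_lsi.

(** * Test functions *)

Section derive_line.
Variables (R : realType) (V : normedModType R).

Lemma is_derive_lineP (f : V -> R) (x v : V) (df : R) :
  is_derive (0 : R) 1 (fun h : R => f (h *: v + x)) df <-> is_derive x v f df.
Proof.
have E : (fun h : R => h^-1 *: ((f \o shift x) (h *: v) - f x)) =
    (fun h0 : R => h0^-1 *: (((fun h : R => f (h *: v + x)) \o shift (0 : R)) (h0 *: (1 : R)) - f (0 *: v + x))).
  by apply/funext => k /=; rewrite scale0r add0r [_ *: 1]mulr1 addr0.
split=> h; have d1 := @ex_derive _ _ _ _ _ _ _ h; have d2 := @derive_val _ _ _ _ _ _ _ h.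
  by split; [rewrite /derivable E|rewrite /derive E].
by split; [rewrite /derivable -E|rewrite /derive -E].
Qed.

End derive_line.

Section test_functions.
Variables (R : realType) (d : nat).
Implicit Types (psi : 'rV[R]_d -> R) (b : 'I_d -> R -> R).
Local Notation e_ i := (delta_mx ord0 i : 'rV[R]_d).

(** The sigma-algebra is generated by rectangles and not by open sets. A continuous function is the
    limit of its values at the grid points of mesh [1 / (n + 1)], and each approximation is constant
    on countably many half-open cubes. *)
Lemma continuous_measurable_row psi : continuous psi -> measurable_fun [set: Rd R d] (psi : Rd R d -> R).
Proof.
move=> cpsi.
pose grid (n : nat) (x : 'rV[R]_d) : 'rV[R]_d := \row_i ((Num.floor (n.+1%:R * x ord0 i))%:~R / n.+1%:R).
apply: (@measurable_fun_cvg _ (Rd R d) R setT (fun n x => psi (grid n x))).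
  move=> n _ B mB; rewrite setTI.
  pose pt (k : {ffun 'I_d -> int}) : 'rV[R]_d := \row_i ((k i)%:~R / n.+1%:R).
  pose F (k : {ffun 'I_d -> int}) : set (Rd R d) :=
    [set x : 'rV[R]_d | (forall i, Num.floor (n.+1%:R * x ord0 i) = k i) /\ B (psi (pt k))].
  rewrite (_ : _ @^-1` B = \bigcup_k F k).
    apply: countable_bigcupT_measurable => [|k]; first exact: countableP.
    have [Bk|nBk] := pselect (B (psi (pt k))); last first.
      by rewrite (_ : F k = set0)//; apply/seteqP; split => // x [].
    apply: sub_sigma_algebra; exists (fun i => `[(k i)%:~R / n.+1%:R, (k i + 1)%:~R / n.+1%:R[%classic).
    split => //; apply/seteqP; split => x /=.
      move=> [fk _] i; rewrite in_itv/=; have /eqP := fk i; rewrite floor_eq.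
      by rewrite ler_pdivrMr// ltr_pdivlMr// ![x ord0 i * _]mulrC.
    move=> xk; split => // i; have := xk i; rewrite in_itv/= => h.
    by apply/eqP; rewrite floor_eq; move: h; rewrite ler_pdivrMr// ltr_pdivlMr// ![x ord0 i * _]mulrC.
  apply/seteqP; split => x /=.
    move=> Bx; exists [ffun i => Num.floor (n.+1%:R * x ord0 i)] => //; split.
      by move=> i; rewrite ffunE.
    by move: Bx; congr (B (psi _)); apply/rowP => i; rewrite !mxE ffunE.
  move=> [k _ [fk]]; congr (B (psi _)); apply/rowP => i; by rewrite !mxE fk.
move=> x _; apply: (@cvg_comp _ _ _ (grid^~ x) psi _ (nbhs (x : 'rV[R]_d))); last exact: cpsi.
apply/cvg_ballP => e e0; near=> n; split => // i j; rewrite (ord1 i) /ball/= mxE.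
set t : R := x ord0 j; have n0 : 0 < n.+1%:R :> R by [].
have /andP[h1 h2] := floor_itv (n.+1%:R * t).
have {}h1 : (Num.floor (n.+1%:R * t))%:~R / n.+1%:R <= t by rewrite ler_pdivrMr// [t * _]mulrC.
have {}h2 : t < (Num.floor (n.+1%:R * t))%:~R / n.+1%:R + n.+1%:R^-1.
  by rewrite -[X in _ + X]mul1r -mulrDl ltr_pdivlMr// [t * _]mulrC; move: h2; rewrite intrD.
have ne : n.+1%:R^-1 < e.
  rewrite invf_plt ?posrE//; apply: lt_le_trans (_ : n%:R + 1 <= _); last by rewrite natr1.
  apply: (@le_lt_trans _ _ n%:R); last by rewrite ltrDl.
  by near: n; exact: nbhs_infty_ger.
by rewrite ger0_norm ?subr_ge0// ltrBlDl; apply: (lt_trans h2); rewrite ltrD2l.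
Unshelve. all: by end_near. Qed.

Definition prodtest b (x : 'rV[R]_d) : R := \prod_j b j (x ord0 j).

Lemma is_derive_prodtest b (i : 'I_d) (x : 'rV[R]_d) :
  (forall t : R, derivable (b i) t 1) ->
  is_derive x (e_ i) (prodtest b)
    ((\prod_(j | j != i) b j (x ord0 j)) * derive1 (b i) (x ord0 i)).
Proof.
move=> db; apply/is_derive_lineP.
rewrite (_ : (fun h => _) = fun h : R => (\prod_(j | j != i) b j (x ord0 j)) * b i (h + x ord0 i)); last first.
  apply/funext => h; rewrite /prodtest (bigD1 i)//= mulrC; congr (_ * _).
    by apply: eq_bigr => j ji; rewrite !mxE eqxx (negbTE ji)/= mulr0 add0r.
  by rewrite !mxE !eqxx mulr1.
have h1 : is_derive (0 : R) 1 (fun h : R => h + x ord0 i) 1.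
  have h := is_deriveD (is_derive_id (0 : R) (1 : R)) (is_derive_cst (x ord0 i) (0 : R) (1 : R)).
  by apply: (is_derive_eq h); rewrite addr0.
have h2 := @is_derive1_comp _ (b i) (fun h : R => h + x ord0 i) 0 _ _ (is_derive1P (db (0 + x ord0 i))) h1.
have h3 := is_deriveZ (\prod_(j | j != i) b j (x ord0 j)) h2.
by apply: (is_derive_eq h3); rewrite /GRing.scale/= mulr1 add0r.
Qed.

Lemma continuous_prodtest b : (forall j, continuous (b j)) -> continuous (prodtest b).
Proof.
move=> cb; rewrite /prodtest; elim: (index_enum _) => [|j s IHs].
  rewrite (_ : (fun n => _) = cst 1); first exact: cst_continuous.
  by apply/funext => n; rewrite big_nil.
rewrite (_ : (fun n => _) =
    (fun x : 'rV[R]_d => b j (x ord0 j) * \prod_(j <- s) b j (x ord0 j))); last first.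
  by apply/funext => n; rewrite big_cons.
have cj : continuous (fun x : 'rV[R]_d => b j (x ord0 j)).
  move=> x; apply: (@continuous_comp 'rV[R]_d R R (fun x => x ord0 j) (b j)); last exact: cb.
  exact: coord_continuous.
by move=> x; apply: continuousM; [exact: cj|exact: IHs].
Qed.

Lemma Ck_prodtest k b : (forall j, smooth (b j)) -> Ck k (prodtest b).
Proof.
elim: k b => [|k IHk] b sb.
  by apply: continuous_prodtest => j; exact: smooth_continuous.
split; first by apply: continuous_prodtest => j; exact: smooth_continuous.
move=> i; have db x := is_derive_prodtest x (smooth_derivable (sb i)).
split=> [x|]; first exact: (@ex_derive _ _ _ _ _ _ _ (db x)).
rewrite (_ : (fun x => _) = prodtest (fun j => if j == i then derive1 (b j) else b j)).
  by apply: IHk => j; case: eqP => _ //; exact: smooth_derive.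
apply/funext => x; rewrite (@derive_val _ _ _ _ _ _ _ (db x)).
rewrite /prodtest [RHS](bigD1 i)//= eqxx mulrC; congr (_ * _).
by apply: eq_bigr => j /negbTE ->.
Qed.

Lemma test_prodtest b : (forall j, smooth (b j) /\ compact_supp (b j)) -> test_fun (prodtest b).
Proof.
move=> hb; split=> [k|]; first by apply: Ck_prodtest => j; have [] := hb j.
have [M MP] := choice (fun j => (hb j).2).
pose N := \sum_j `|M j|.
have MN j : M j <= N by rewrite /N (bigD1 j)//= (le_trans (ler_norm _))// lerDl sumr_ge0.
have N0 : 0 <= N by rewrite sumr_ge0.
exists (\sum_(j < d) N ^+ 2) => x; rewrite /sqnorm => h.
have [/forallP xN|] := boolP [forall j : 'I_d, x ord0 j ^+ 2 <= N ^+ 2].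
  by move: h; rewrite ltNge ler_sum// => j _; exact: xN.
rewrite negb_forall => /existsP[j]; rewrite -ltNge => xj.
rewrite /prodtest (bigD1 j)//= MP ?mul0r//.
apply: (le_lt_trans (MN j)); rewrite -(ger0_norm N0) -ltr_sqr ?nnegrE//.
by rewrite !real_normK// num_real.
Qed.

Lemma test_continuous psi : test_fun psi -> continuous psi.
Proof. by case=> /(_ 0%N). Qed.

Lemma test_derivable psi i x : test_fun psi -> derivable psi x (e_ i).
Proof. by case=> /(_ 1%N) [_ /(_ i)[]]. Qed.

Lemma test_derive_continuous psi i : test_fun psi -> continuous (fun x => 'D_(e_ i) psi x).
Proof. by case=> /(_ 1%N) [_ /(_ i)[]]. Qed.

Lemma coord_sqnorm (x : 'rV[R]_d) i : x ord0 i ^+ 2 <= sqnorm x.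
Proof. by rewrite /sqnorm (bigD1 i)//= lerDl sumr_ge0// => j _; exact: sqr_ge0. Qed.

Lemma derive_supp psi i r : (forall x, r < sqnorm x -> psi x = 0) ->
  (forall x, derivable psi x (e_ i)) ->
  forall x, r < sqnorm x -> 'D_(e_ i) psi x = 0.
Proof.
move=> psi0 dpsi x rx.
have csq : continuous (fun h : R => sqnorm (h *: e_ i + x)).
  rewrite (_ : (fun h => _) = fun h : R => sqnorm x + h * (2 * x ord0 i + h)); last first.
    apply/funext => h; rewrite /sqnorm (bigD1 i)// [X in _ = X + _](bigD1 i)//= !mxE !eqxx mulr1.
    rewrite (eq_bigr (fun j => x ord0 j ^+ 2)); first by ring.
    by move=> j /negbTE ji; rewrite !mxE eqxx ji/= mulr0 add0r.
  move=> h; apply: cvgD; first exact: cvg_cst.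
  by apply: cvgM; [exact: cvg_id|apply: cvgD; [exact: cvg_cst|exact: cvg_id]].
have hd : is_derive (0 : R) 1 (fun h : R => psi (h *: e_ i + x)) 0.
  have h0 : is_derive (0 : R) 1 (fun _ : R => 0 : R) 0 by exact: is_derive_cst.
  apply: (near_eq_is_derive _ h0); near=> h; rewrite psi0//; near: h.
  by apply: (cvgr_gt _ (csq 0)); rewrite scale0r add0r.
exact: (@derive_val _ _ _ _ _ _ _ ((is_derive_lineP _ _ _ _).1 hd)).
Unshelve. all: by end_near. Qed.

Lemma continuous_supp_bounded psi r : continuous psi -> (forall x, r < sqnorm x -> psi x = 0) ->
  exists M, 0 <= M /\ forall x, `|psi x| <= M * (sqnorm x <= r)%R%:R.
Proof.
move=> cpsi psi0; pose N := `|r| + 1.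
have cB : compact [set x : 'rV[R]_d | forall i, `[(- N)%R, N]%classic (x ord0 i)].
  by apply: (@rV_compact R d (fun=> `[(- N)%R, N]%classic)) => i; exact: segment_compact.
have := compact_bounded (continuous_compact (continuous_subspaceT cpsi) cB).
move=> [M [_ MP]]; exists (`|M| + 1); split; first by rewrite addr_ge0.
move=> x; case: (leP (sqnorm x) r) => xr; last by rewrite psi0// normr0 mulr0.
rewrite mulr1; apply: (MP (`|M| + 1)); first by rewrite (le_lt_trans (ler_norm _))// ltrDl.
exists x => // i /=; rewrite in_itv/= -ler_norml.
have h := le_trans (coord_sqnorm x i) xr.
have N1 : 1 <= N by rewrite /N lerDr.
have rN : r <= N ^+ 2.
  apply: (@le_trans _ _ N); first by rewrite (le_trans (ler_norm _))// lerDl.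
  by rewrite expr2 -[leLHS]mulr1 ler_wpM2l// (le_trans ler01).
rewrite -(ger0_norm (le_trans ler01 N1)) -ler_sqr ?nnegrE// !real_normK ?num_real//.
exact: le_trans h rN.
Qed.

Lemma is_derive_affine psi (c : R) (v x : 'rV[R]_d) i : derivable psi (c *: x + v) (e_ i) ->
  is_derive x (e_ i) (fun x => psi (c *: x + v)) (c * 'D_(e_ i) psi (c *: x + v)).
Proof.
move=> dpsi; apply/is_derive_lineP.
have h0 : is_derive (c * 0) 1 (fun h : R => psi (h *: e_ i + (c *: x + v))) ('D_(e_ i) psi (c *: x + v)).
  by rewrite mulr0; apply/is_derive_lineP/derivableP.
have h1 : is_derive (0 : R) 1 (fun h : R => c * h) c.
  have h := is_deriveZ c (is_derive_id (0 : R) (1 : R)).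
  by apply: (is_derive_eq h); rewrite /GRing.scale/= mulr1.
have h2 := @is_derive1_comp _ (fun h : R => psi (h *: e_ i + (c *: x + v))) (fun h : R => c * h) 0 _ _ h0 h1.
rewrite (_ : (fun h => _) = ((fun h : R => psi (h *: e_ i + (c *: x + v))) \o (fun h : R => c * h))).
  by apply: (is_derive_eq h2); rewrite mulrC.
by apply/funext => h /=; congr psi; rewrite scalerDr scalerA addrA.
Qed.

Lemma Ck_affine k psi (a c : R) (v : 'rV[R]_d) : Ck k psi -> Ck k (fun x => a * psi (c *: x + v)).
Proof.
have caff : continuous (fun x : 'rV[R]_d => c *: x + v).
  by move=> x; apply: continuousD; [apply: continuousZr; exact: cvg_id|exact: cst_continuous].
have cc psi' a' : continuous psi' -> continuous (fun x : 'rV[R]_d => a' * psi' (c *: x + v)).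
  move=> cp x; apply: continuousM; first exact: cst_continuous.
  have h1 : (c *: y + v) @[y --> (x : 'rV[R]_d)] --> c *: (x : 'rV[R]_d) + v by exact: caff.
  exact: (cvg_comp _ _ h1 (cp (c *: (x : 'rV[R]_d) + v))).
elim: k psi a => [|k IHk] psi a; first exact: cc.
move=> [cp dp]; split; first exact: cc.
move=> i; have [di Ci] := dp i.
have dd x : is_derive x (e_ i) (fun x => a * psi (c *: x + v)) (a * c * 'D_(e_ i) psi (c *: x + v)).
  have h := is_deriveZ a (is_derive_affine (di (c *: x + v))).
  by apply: (is_derive_eq h); rewrite /GRing.scale/= mulrA.
split=> [x|]; first exact: (@ex_derive _ _ _ _ _ _ _ (dd x)).
have -> : (fun x => 'D_(e_ i) (fun x : 'rV[R]_d => a * psi (c *: x + v)) x) =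
    (fun x : 'rV[R]_d => a * c * 'D_(e_ i) psi (c *: x + v)).
  by apply/funext => x; rewrite (@derive_val _ _ _ _ _ _ _ (dd x)).
exact: (IHk _ (a * c) Ci).
Qed.

Lemma test_affine psi (c : R) (v : 'rV[R]_d) : c != 0 -> test_fun psi ->
  test_fun (fun x => psi (c *: x + v)).
Proof.
move=> c0 [Cpsi [r psi0]]; split.
  move=> k; have := Ck_affine 1 c v (Cpsi k).
  by congr Ck; apply/funext => x; rewrite mul1r.
have c2 : 0 < c ^+ 2 by rewrite exprn_even_gt0.
(* From [|c x|^2 <= 2 (|c x + v|^2 + |v|^2)]: beyond this bound [c x + v] leaves the support. *)
exists (2 * (`|r| + sqnorm v) / c ^+ 2) => x h; apply: psi0.
move: h; rewrite ltr_pdivrMr// => h.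
have : sqnorm x * c ^+ 2 <= 2 * (sqnorm (c *: x + v) + sqnorm v).
  rewrite /sqnorm -big_split mulr_suml mulr_sumr; apply: ler_sum => i _; rewrite !mxE.
  set t : R := x ord0 i; set w : R := v ord0 i; rewrite -subr_ge0.
  rewrite [X in 0 <= X](_ : _ = (c * t + 2 * w) ^+ 2); last by rewrite /=; ring.
  exact: sqr_ge0.
by have := ler_norm r; lra.
Qed.

Lemma derive_affine psi (c : R) (v x : 'rV[R]_d) i : test_fun psi ->
  'D_(e_ i) (fun x => psi (c *: x + v)) x = c * 'D_(e_ i) psi (c *: x + v).
Proof.
move=> tpsi; apply: (@derive_val _ _ _ _ _ _ _ (is_derive_affine _)).
exact: test_derivable.
Qed.

Lemma test_bounded psi : test_fun psi ->
  exists r M, 0 <= M /\ forall x, `|psi x| <= M * (sqnorm x <= r)%R%:R.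
Proof.
move=> tpsi; have [_ [r psi0]] := tpsi; exists r.
exact: (continuous_supp_bounded (test_continuous tpsi)).
Qed.

Lemma test_derive_bounded psi i : test_fun psi ->
  exists r M, 0 <= M /\ forall x, `|'D_(e_ i) psi x| <= M * (sqnorm x <= r)%R%:R.
Proof.
move=> tpsi; have [_ [r psi0]] := tpsi; exists r.
apply: continuous_supp_bounded; first exact: test_derive_continuous.
by apply: derive_supp => // x; exact: test_derivable.
Qed.

End test_functions.

(** * Densities with finite Fisher information *)

Section normal_form.
Variables (R : realType) (d : nat).
Local Notation L := (lam R d).
Local Notation leb := (@lebesgue_measure R).
Local Notation e_ i := (delta_mx ord0 i : 'rV[R]_d).
Local Notation co x i := ((x : 'rV[R]_d) ord0 i).
Implicit Types (f : Rd R d -> R) (g : 'I_d -> Rd R d -> R) (psi : 'rV[R]_d -> R).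

Lemma sintE (h : Rd R d -> R) : measurable_fun setT h -> sint h = (\int[L]_x (h x)%:E)%E.
Proof.
move=> mh; rewrite /sint !iintE; first last.
- by move=> x; rewrite lee_fin le_max lexx orbT.
- by apply/measurable_EFinP; apply: measurable_maxr.
- by move=> x; rewrite lee_fin le_max lexx orbT.
- by apply/measurable_EFinP; apply: measurable_maxr => //; exact: measurableT_comp.
rewrite [RHS]integralE; congr (_ - _)%E.
  by apply: eq_integral => x _; rewrite funeposE EFin_max.
by apply: eq_integral => x _; rewrite funenegE EFin_max.
Qed.

Lemma sint_int (h : Rd R d -> R) : L.-integrable setT (EFin \o h) -> sint h = (\int[L]_x h x)%:E.
Proof. by move=> ih; rewrite sintE ?(RintegralE ih)//; exact: Rintegrable_measurable ih. Qed.

Definition weak_pair f g := forall psi i, test_fun psi ->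
  \int[L]_x (f x * 'D_(e_ i) psi x) = - \int[L]_x (g i x * psi x).

Definition fisher_dens f g i (x : Rd R d) := Ff (f x) (g i x + co x i * f x).

(** What [fisher_normal] extracts from an admissible pair of finite information. A weak gradient is
    only locally integrable and arbitrary on null sets; here it is integrable and zero wherever [f]
    is, so that it can be tensorised and integrated over fibres. *)
Record nice f g : Prop := Nice {
  nice_int : L.-integrable setT (EFin \o f);
  nice_ge0 : forall x, 0 <= f x;
  nice_one : \int[L]_x f x = 1;
  nice_gint : forall i, L.-integrable setT (EFin \o g i);
  nice_g0 : forall i x, f x = 0 -> g i x = 0;
  nice_gmean : forall i, \int[L]_x g i x = 0;
  nice_xint : forall i, L.-integrable setT (EFin \o (fun x => co x i * f x));
  nice_xmean : forall i, \int[L]_x (co x i * f x) = 0;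
  nice_weak : weak_pair f g;
  nice_fisher : forall i, (\int[L]_x (fisher_dens f g i x)%:E < +oo)%E }.

Lemma integrable_mul_bounded f (h : Rd R d -> R) (M : R) : L.-integrable setT (EFin \o f) ->
  measurable_fun setT h -> (forall x, `|h x| <= M) ->
  L.-integrable setT (EFin \o (fun x => f x * h x)).
Proof.
move=> fi mh hM; apply: (@Rintegrable_le _ _ _ L _ (fun x => M * `|f x|)).
- by apply: measurable_funM => //; exact: Rintegrable_measurable fi.
- by move=> x; rewrite normrM mulrC ler_wpM2r.
- exact: RintegrableZ (Rintegrable_norm fi).
Qed.

Lemma test_mes psi : test_fun psi -> measurable_fun [set: Rd R d] (psi : Rd R d -> R).
Proof. by move=> /test_continuous; exact: continuous_measurable_row. Qed.

Lemma test_derive_mes psi i : test_fun psi ->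
  measurable_fun [set: Rd R d] ((fun x => 'D_(e_ i) psi x) : Rd R d -> R).
Proof. by move=> /test_derive_continuous h; apply: continuous_measurable_row; exact: h. Qed.

Lemma test_le psi : test_fun psi -> exists M, forall x, `|psi x| <= M.
Proof.
move=> /test_bounded[r [M [M0 h]]]; exists M => x; apply: le_trans (h x) _.
by rewrite -[leRHS]mulr1 ler_wpM2l//; case: (sqnorm x <= r)%R.
Qed.

Lemma test_derive_le psi i : test_fun psi -> exists M, forall x, `|'D_(e_ i) psi x| <= M.
Proof.
move=> /(@test_derive_bounded _ _ _ i)[r [M [M0 h]]]; exists M => x; apply: le_trans (h x) _.
by rewrite -[leRHS]mulr1 ler_wpM2l//; case: (sqnorm x <= r)%R.
Qed.

Lemma bump_gt0 (a b : R) n x : a < x < b -> 0 < bump a b n x.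
Proof.
move=> /andP[ax xb]; rewrite /bump /flat !mulr_gt0 ?subr_gt0// ?expR_gt0//.
by rewrite invr_gt0 exprn_gt0// mulr_gt0// subr_gt0.
by rewrite invr_gt0 exprn_gt0// mulr_gt0// subr_gt0.
Qed.

(** * The weak gradient on the zero set of the density *)

Section vanish.
Variables (f : Rd R d -> R) (g : 'I_d -> Rd R d -> R) (i : 'I_d).
Hypotheses (fi : L.-integrable setT (EFin \o f)) (f0 : forall x, 0 <= f x).
Hypothesis gi : forall psi, test_fun psi -> L.-integrable setT (EFin \o (fun x => g i x * psi x)).
Hypothesis wp : weak_pair f g.

Let mf := Rintegrable_measurable fi.

Section cutoff.
Variable n : nat.
Let ch := bump (- n.+1%:R) n.+1%:R 0 : R -> R.
Let sch : smooth ch /\ compact_supp ch.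
Proof. by split; [exact: smooth_bump|exact: bump_compact]. Qed.
Let chi := prodtest (fun _ : 'I_d => ch).
Let tchi : test_fun chi. Proof. by apply: test_prodtest => j. Qed.
Let Dchi (x : Rd R d) := 'D_(e_ i) chi x.
Let DchiE (x : Rd R d) : Dchi x = (\prod_(j | j != i) ch (co x j)) * derive1 ch (co x i).
Proof.
apply: (@derive_val _ _ _ _ _ _ _ (is_derive_prodtest _ _)).
exact: smooth_derivable sch.1.
Qed.

(** [shift_rep] needs an integrable derivative whereas [g i] is only locally integrable, so
    everything is multiplied by the cutoff [chi]; [q] is the derivative of [p] by the product
    rule. *)
Let p (x : Rd R d) := f x * chi x.
Let q (x : Rd R d) := g i x * chi x + f x * Dchi x.

Let ip : L.-integrable setT (EFin \o p).
Proof.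
have [M hM] := test_le tchi.
by apply: (integrable_mul_bounded fi _ hM); exact: test_mes.
Qed.

Let iq : L.-integrable setT (EFin \o q).
Proof.
have [M hM] := test_derive_le i tchi.
apply: RintegrableD; first exact: gi.
by apply: (integrable_mul_bounded fi _ hM); exact: test_derive_mes.
Qed.

Let weak b : (forall j, smooth (b j) /\ compact_supp (b j)) ->
  \int[L]_x (p x * ((\prod_(j | j != i) b j (co x j)) * derive1 (b i) (co x i))) =
  - \int[L]_x (q x * \prod_j b j (co x j)).
Proof.
move=> hb; pose cb j t := ch t * b j t.
have hcb j : smooth (cb j) /\ compact_supp (cb j).
  split; first by apply: smoothM; [exact: sch.1|exact: (hb j).1].
  by have [M hM] := sch.2; exists M => x /hM; rewrite /cb => ->; rewrite mul0r.
have tcb : test_fun (prodtest cb) by exact: test_prodtest.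
have tb : test_fun (prodtest b) by exact: test_prodtest.
have bE (x : Rd R d) : prodtest cb x = chi x * prodtest b x by rewrite /prodtest -big_split.
have DcbE (x : Rd R d) : 'D_(e_ i) (prodtest cb) x =
    chi x * ((\prod_(j | j != i) b j (co x j)) * derive1 (b i) (co x i)) + Dchi x * prodtest b x.
  rewrite (@derive_val _ _ _ _ _ _ _ (is_derive_prodtest x (smooth_derivable (hcb i).1))).
  have -> : derive1 (cb i) (co x i) = derive1 ch (co x i) * b i (co x i) + ch (co x i) * derive1 (b i) (co x i).
    apply: derive1_eq.
    have := is_deriveM (is_derive1P (@smooth_derivable _ _ sch.1 (co x i))) (is_derive1P (@smooth_derivable _ _ (hb i).1 (co x i))).
    by move=> h; apply: (is_derive_eq h); rewrite /GRing.scale /= addrC [b i _ * _]mulrC.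
  have e0 : \prod_(j | j != i) cb j (co x j) = (\prod_(j | j != i) ch (co x j)) * \prod_(j | j != i) b j (co x j).
    by rewrite -big_split.
  have e1 : chi x = ch (co x i) * \prod_(j | j != i) ch (co x j) by rewrite /chi /prodtest (bigD1 i).
  have e2 : prodtest b x = b i (co x i) * \prod_(j | j != i) b j (co x j) by rewrite /prodtest (bigD1 i).
  by rewrite e0 e1 e2 DchiE; ring.
have [M1 hM1] := test_derive_le i tcb; have [M2 hM2] := test_le tb; have [M3 hM3] := test_derive_le i tchi.
have iA : L.-integrable setT (EFin \o (fun x => f x * 'D_(e_ i) (prodtest cb) x)).
  by apply: (integrable_mul_bounded fi _ hM1); exact: test_derive_mes.
have iB : L.-integrable setT (EFin \o (fun x => f x * Dchi x * prodtest b x)).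
  apply: (integrable_mul_bounded _ _ hM2); last exact: test_mes.
  by apply: (integrable_mul_bounded fi _ hM3); exact: test_derive_mes.
have iC : L.-integrable setT (EFin \o (fun x => g i x * prodtest cb x)) by exact: gi.
transitivity (\int[L]_x (f x * 'D_(e_ i) (prodtest cb) x - f x * Dchi x * prodtest b x)).
  by apply: eq_Rintegral => x _; rewrite DcbE /p; ring.
rewrite RintegralB// (wp i tcb) -opprD -RintegralD//; congr (- _).
by apply: eq_Rintegral => x _; rewrite bE /q /prodtest; ring.
Qed.

(** At a zero of [f] the function [q] reduces to [g i * chi], and [chi] is positive inside the
    cube. *)
Lemma vanish_box : {ae L, forall x, (forall j, `|co x j| < n.+1%:R) -> f x = 0 -> g i x = 0}.
Proof.
have gen d' (T' : measurableType d') (h : T' -> Rd R d) :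
  (forall j, measurable_fun setT (fun x => co (h x) j)) -> measurable_fun setT h.
  exact: measurable_fun_row.
have [h1 h2] := shift_rep (@measurable_coord R d) gen (measurable_vshift i) (vshift_mpres i) (vshiftN i)
  (fun j s x => vshift_coord i j s x) ip iq weak.
have chi0 (x : Rd R d) : 0 <= chi x by apply: prodr_ge0 => j _; exact: bump_ge0.
have p0 x : 0 <= p x by rewrite mulr_ge0.
have := shift_zero (measurable_vshift i) (vshift_mpres i) (vshiftD i) (Rintegrable_measurable ip) (Rintegrable_measurable iq) p0 h1 h2.
move=> h; apply: (ae_imp h) => x pq xn fx0.
have : q x = 0 by apply: pq; rewrite /p fx0 mul0r.
rewrite /q fx0 mul0r addr0 => /eqP; rewrite mulf_eq0 => /orP[/eqP//|/eqP c0].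
have : 0 < chi x.
  by apply: prodr_gt0 => j _; apply: bump_gt0; rewrite -ltr_norml.
by rewrite c0 ltxx.
Qed.

End cutoff.

Lemma vanish_ae : {ae L, forall x, f x = 0 -> g i x = 0}.
Proof.
apply: (ae_imp (ae_foralln vanish_box)) => x h; pose M := \sum_j `|co x j|.
apply: (h (Num.truncn M)) => j; apply: le_lt_trans (truncnS_gt _).
by rewrite /M (bigD1 j)//= lerDl sumr_ge0.
Qed.

End vanish.

Section mean_zero.
Variables (f : Rd R d -> R) (g : 'I_d -> Rd R d -> R) (i : 'I_d).
Hypotheses (fi : L.-integrable setT (EFin \o f)) (gi : L.-integrable setT (EFin \o g i)).
Hypothesis wp : weak_pair f g.

Let psi := prodtest (fun _ : 'I_d => bump (- 1) 1 0 : R -> R).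
Let tpsi : test_fun psi.
Proof. by apply: test_prodtest => j; split; [exact: smooth_bump|exact: bump_compact]. Qed.

Let a n : R := n.+1%:R^-1.
Let psin n (x : 'rV[R]_d) := psi (a n *: x + 0).
Let a_neq0 n : a n != 0. Proof. by rewrite invr_eq0. Qed.
Let tpsin n : test_fun (psin n). Proof. exact: test_affine. Qed.
Let a01 n : 0 <= a n <= 1.
Proof. by rewrite invr_ge0 ler0n invf_le1// ler1n. Qed.
Let cvg_a : a n @[n --> \oo] --> (0 : R). Proof. exact: cvg_harmonic. Qed.

(** Tested against [psi (a x)] with [a] tending to 0: the test function tends to the constant
    [psi 0], and its derivative is of order [a]. *)
Lemma weak_mean_zero : \int[L]_x g i x = 0.
Proof.
have [M hM] := test_le tpsi; have [M' hM'] := test_derive_le i tpsi.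
have DE n (x : 'rV[R]_d) : 'D_(e_ i) (psin n) x = a n * 'D_(e_ i) psi (a n *: x + 0).
  exact: derive_affine.
have M'0 : 0 <= M' by apply: le_trans (hM' 0).
have Dle n (x : 'rV[R]_d) : `|'D_(e_ i) (psin n) x| <= a n * M'.
  by have /andP[a0 _] := a01 n; rewrite DE normrM ger0_norm// ler_wpM2l.
have c1 : \int[L]_x (f x * 'D_(e_ i) (psin n) x) @[n --> \oo] --> (0 : R).
  have [||||//|_] := @Rdct _ (Rd R d) R L (fun n x => f x * 'D_(e_ i) (psin n) x) (fun=> 0) (fun x => M' * `|f x|).
  - by move=> n; apply: measurable_funM; [exact: Rintegrable_measurable fi|exact: test_derive_mes].
  - by [].
  - move=> x; apply: norm_cvg0; apply: (@squeeze_cvgr _ _ _ _ (fun=> 0) (fun n => `|f x| * (a n * M'))).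
    + by near=> n; rewrite normr_ge0/= normrM ler_wpM2l.
    + exact: cvg_cst.
    + rewrite -[X in _ --> X](mulr0 `|f x|); apply: cvgM; first exact: cvg_cst.
      by rewrite -[X in _ --> X](mul0r M'); apply: cvgM => //; exact: cvg_cst.
  - exact: RintegrableZ (Rintegrable_norm fi).
  - move=> n x; rewrite normrM mulrC ler_wpM2r// (le_trans (Dle n x))//.
    by have /andP[a0 a1] := a01 n; rewrite -[leRHS]mul1r ler_wpM2r.
  by rewrite Rintegral_cst// mul0r.
have c2 : \int[L]_x (g i x * psin n x) @[n --> \oo] --> \int[L]_x (g i x * psi 0).
  have [||||//|//] := @Rdct _ (Rd R d) R L (fun n x => g i x * psin n x) (fun x => g i x * psi 0) (fun x => M * `|g i x|).
  - by move=> n; apply: measurable_funM; [exact: Rintegrable_measurable gi|exact: test_mes].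
  - by apply: measurable_funM => //; exact: Rintegrable_measurable gi.
  - move=> x; apply: cvgM; first exact: cvg_cst.
    have ct (y : 'rV[R]_d) : a n *: y + 0 @[n --> \oo] --> (0 *: y + 0).
      by apply: cvgD; [exact: cvgZr_tmp|exact: cvg_cst].
    have h1 := ct x.
    rewrite scale0r addr0 in h1.
    exact: (cvg_comp _ _ h1 (test_continuous tpsi (x := 0))).
  - exact: RintegrableZ (Rintegrable_norm gi).
  - by move=> n x; rewrite normrM mulrC ler_wpM2r// hM.
have : \int[L]_x (g i x * psi 0) = 0.
  have E : (fun n => \int[L]_x (g i x * psin n x)) = (fun n => - \int[L]_x (f x * 'D_(e_ i) (psin n) x)).
    by apply/funext => n; rewrite (wp i (tpsin n)) opprK.
  rewrite E in c2; have c3 := cvgN c1; rewrite oppr0 in c3.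
  by apply: (cvg_unique _ c2 (c3 _)).
have psi0 : psi 0 != 0.
  by rewrite gt_eqF// prodr_gt0// => j _; rewrite mxE bump_gt0// ltrN10 ltr01.
under eq_Rintegral => x _ do rewrite mulrC.
by rewrite RintegralZl// => /eqP; rewrite mulf_eq0 (negbTE psi0) => /eqP.
Unshelve. all: by end_near. Qed.

End mean_zero.

Definition fisher_val f (G : 'rV[R]_d -> 'rV[R]_d) := iint (fun x : 'rV[R]_d =>
  (if f x == 0 then 0 else f x * sqnorm ((f x)^-1 *: G x + x))%:E).

Lemma measurable_fisher_dens f g i : measurable_fun setT f -> measurable_fun setT (g i) ->
  measurable_fun setT (fisher_dens f g i).
Proof.
move=> mf mg; apply: measurable_Ff => //; apply: measurable_funD => //.
by apply: measurable_funM => //; exact: measurable_coord.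
Qed.

Lemma fisher_valE f g (G : 'rV[R]_d -> 'rV[R]_d) : measurable_fun setT f -> (forall x, 0 <= f x) ->
  (forall i, measurable_fun setT (g i)) ->
  (forall i (x : Rd R d), f x != 0 -> g i x = co (G x) i) ->
  fisher_val f G = (\sum_i \int[L]_x (fisher_dens f g i x)%:E)%E.
Proof.
move=> mf f0 mg gG.
have dens0 i x : 0 <= fisher_dens f g i x by exact: Ff_ge0.
have densE (x : Rd R d) : (if f x == 0 then 0 else f x * sqnorm ((f x)^-1 *: G x + x)) = \sum_i fisher_dens f g i x.
  rewrite /fisher_dens /Ff; have [fx|fx] := eqVneq (f x) 0; first by rewrite big1.
  rewrite /sqnorm mulr_sumr; apply: eq_bigr => i _; rewrite !mxE gG//.
  by field.
rewrite /fisher_val iintE.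
- under eq_integral => x _ do rewrite densE -sumEFin.
  rewrite ge0_integral_sum//; last by move=> i x _; rewrite lee_fin.
  by move=> i; apply/measurable_EFinP; exact: measurable_fisher_dens.
- under eq_fun => x do rewrite densE.
  by apply/measurable_EFinP; apply: measurable_sum => i; exact: measurable_fisher_dens.
- by move=> x; rewrite densE lee_fin sumr_ge0.
Qed.

Lemma fisher_normal (m : set 'rV[R]_d -> \bar R) f G : is_density m f -> weak_grad f G ->
  m setT = 1%E -> (forall i, L.-integrable setT (EFin \o (fun x => co x i * f x))) ->
  (forall i, \int[L]_x (co x i * f x) = 0) -> (fisher_val f G < +oo)%E ->
  exists2 g, nice f g & fisher_val f G = (\sum_i \int[L]_x (fisher_dens f g i x)%:E)%E.
Proof.
move=> [mf [f0 mE]] [mG [Gloc Gw]] m1 ix xm Foo.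
have mf0 x : (0 <= (f x)%:E)%E by rewrite lee_fin f0.
have f1 : (\int[L]_x (f x)%:E = 1)%E.
  rewrite -m1 mE// iintE//; first by apply: eq_integral => x _; rewrite indicT mul1r.
    by apply/measurable_EFinP; apply: measurable_funM.
  by move=> x; rewrite lee_fin mulr_ge0.
have fi : L.-integrable setT (EFin \o f) by apply: ge0_integrable => //; rewrite f1 ltry.
pose G1 i (x : Rd R d) := co (G x) i.
have Gi i psi : test_fun psi -> L.-integrable setT (EFin \o (fun x => G1 i x * psi x)).
  move=> tpsi; have [r [M [M0 hM]]] := test_bounded tpsi.
  have m1r : measurable_fun setT (fun x : Rd R d => (sqnorm (x : 'rV[R]_d) <= r)%R%:R : R).
    by apply: measurable_boolr; apply: measurable_fun_ler => //; exact: measurable_sqnorm.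
  have iG : L.-integrable setT (EFin \o (fun x : Rd R d => (sqnorm (x : 'rV[R]_d) <= r)%R%:R * `|G1 i x|)).
    apply: ge0_integrable.
    - by apply: measurable_funM => //; apply: measurableT_comp => //; exact: mG.
    - by move=> x; rewrite mulr_ge0.
    have := Gloc i r; rewrite iintE.
    + by congr (_ < _)%E; apply: eq_integral => x _; case: (_ <= r)%R.
    + apply/measurable_EFinP; apply: measurable_funM; last by apply: measurableT_comp => //; exact: mG.
      apply: measurable_fun_ifT => //; apply: measurable_fun_ler => //; exact: measurable_sqnorm.
    + by move=> x; rewrite lee_fin mulr_ge0//; case: (_ <= r)%R.
  apply: (Rintegrable_le _ _ (RintegrableZ M iG)).
    by apply: measurable_funM; [exact: mG|exact: test_mes].
  by move=> x; rewrite normrM mulrC mulrA ler_wpM2r.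
have wpG : weak_pair f G1.
  move=> psi i tpsi; have [M hM] := test_derive_le i tpsi.
  have iD := integrable_mul_bounded fi (test_derive_mes i tpsi) hM.
  have := Gw psi i tpsi; rewrite (sint_int iD) (sint_int (Gi i psi tpsi)).
  by move=> [].
pose g i (x : Rd R d) := if f x == 0 then 0 else G1 i x.
have mg i : measurable_fun setT (g i).
  apply: measurable_fun_ifT => //; last exact: mG.
  apply: (@measurable_fun_bool _ _ _ _ true); rewrite setTI.
  rewrite (_ : _ @^-1` _ = f @^-1` [set 0]); last by apply/seteqP; split => r /= /eqP.
  by rewrite -[X in measurable X]setTI; exact: mf.
have gG i : {ae L, forall x, g i x = G1 i x}.
  have hv := vanish_ae fi f0 (Gi i) wpG.
  apply: (ae_imp hv) => x h.
  by rewrite /g; case: eqP => // /h ->.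
have wp : weak_pair f g.
  move=> psi i tpsi; rewrite (wpG psi i tpsi); congr (- _).
  apply: ae_eq_Rintegral.
  - exact: Rintegrable_measurable (Gi i psi tpsi).
  - by apply: measurable_funM => //; exact: test_mes.
  - by apply: (ae_imp (gG i)) => x ->.
have dens0 i x : 0 <= fisher_dens f g i x by exact: Ff_ge0.
have mdens i : measurable_fun setT (fisher_dens f g i) by exact: measurable_fisher_dens.
have FE : fisher_val f G = (\sum_i \int[L]_x (fisher_dens f g i x)%:E)%E.
  by apply: fisher_valE => // i x fx; rewrite /g (negbTE fx).
have Fi i : (\int[L]_x (fisher_dens f g i x)%:E < +oo)%E.
  apply: le_lt_trans Foo; rewrite FE (bigD1 i)//= leeDl// sume_ge0// => j _.
  by apply: integral_ge0 => x _; rewrite lee_fin.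
(* With [s = g + x_i f] one has [|s| <= f + s^2 / f]: the gradient is integrable because the
   information is finite and the first moments exist. *)
have gi i : L.-integrable setT (EFin \o g i).
  have iF := ge0_integrable (mdens i) (dens0 i) (Fi i).
  apply: (Rintegrable_le (mg i) _ (RintegrableD (RintegrableD fi iF) (Rintegrable_norm (ix i)))) => x.
  have [fx|fx] := eqVneq (f x) 0.
    by rewrite /g fx eqxx normr0 !addr_ge0.
  have fx0 : 0 < f x by rewrite lt_neqAle eq_sym fx f0.
  set s := g i x + co x i * f x.
  have hs : `|s| <= f x + fisher_dens f g i x.
    rewrite /fisher_dens /Ff (negbTE fx) -/s.
    rewrite -(ler_pM2r fx0) (_ : (f x + s ^+ 2 / f x) * f x = f x ^+ 2 + `|s| ^+ 2); last first.
      by rewrite real_normK ?num_real//; field.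
    have := sqr_ge0 (f x - `|s|); have := mulr_ge0 (normr_ge0 s) (ltW fx0); rewrite sqrrB; lra.
  rewrite (_ : g i x = s - co x i * f x); last by rewrite /s addrK.
  by apply: le_trans (ler_normB _ _) _; rewrite lerD2r.
exists g => //; split => //.
- by rewrite /Rintegral f1.
- by move=> i x fx; rewrite /g fx eqxx.
- by move=> i; exact: (weak_mean_zero fi (gi i) wp).
Qed.

End normal_form.

(** * Sums of two independent vectors *)

Section smooth_bounded.
Variable R : realType.

Lemma smooth_bounded (b : R -> R) : smooth b -> compact_supp b ->
  exists M, forall x, `|b x| <= M /\ `|derive1 b x| <= M.
Proof.
move=> sb cb.
have tb : test_fun (prodtest (fun _ : 'I_1 => b)) by apply: test_prodtest.
have [M1 h1] := test_le tb; have [M2 h2] := test_derive_le ord0 tb.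
exists (Num.max M1 M2) => x; rewrite !le_max; split.
  by have := h1 (\row__ x); rewrite /prodtest big_ord1 mxE => ->.
have := h2 (\row__ x); rewrite (@derive_val _ _ _ _ _ _ _ (is_derive_prodtest _ (smooth_derivable sb))).
rewrite big1 ?mul1r ?mxE; first by move=> ->; rewrite orbT.
by move=> j; rewrite (ord1 j).
Qed.

End smooth_bounded.

Section gaussian_lsi.
Variables (R : realType) (d : nat).
Local Notation L := (lam R d).
Local Notation leb := (@lebesgue_measure R).
Local Notation co x i := ((x : 'rV[R]_d) ord0 i).
Variables (f : Rd R d -> R) (g : 'I_d -> Rd R d -> R).
Hypothesis nfg : nice f g.

Let mf : measurable_fun setT f := Rintegrable_measurable (nice_int nfg).
Let mg i : measurable_fun setT (g i) := Rintegrable_measurable (nice_gint nfg i).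

Lemma nice_rep i : {ae L, forall x, f x = \int[leb]_(s in `]-oo, 0%R]) g i (vshift i s x)}.
Proof.
have gen d' (T' : measurableType d') (h : T' -> Rd R d) :
  (forall j, measurable_fun setT (fun x => co (h x) j)) -> measurable_fun setT h.
  exact: measurable_fun_row.
have [] // := shift_rep (@measurable_coord R d) gen (measurable_vshift i) (vshift_mpres i) (vshiftN i)
  (fun j s x => vshift_coord i j s x) (nice_int nfg) (nice_gint nfg i) _.
move=> b hb; rewrite -(nice_weak nfg i (test_prodtest hb)).
apply: eq_Rintegral => x _.
by rewrite (@derive_val _ _ _ _ _ _ _ (is_derive_prodtest x (smooth_derivable (hb i).1))).
Qed.

Let tt_m : {sigma_finite_measure set unit -> \bar R} := dirac tt.

Let snd_mpres : mpres (prodm tt_m L) L snd.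
Proof.
split; first exact: measurable_snd.
move=> h mh h0; rewrite tonelli1//; last exact: (measurableT_comp mh measurable_snd).
rewrite integral_dirac ?diracT ?mul1e//.
Qed.

(** [cond_lsi] over a one-point parameter space, where the marginal is the total mass 1, makes the
    entropy finite. *)
Lemma entropy_integrable : L.-integrable setT (EFin \o (fun x => f x * ln (f x / phi (x : 'rV[R]_d)))).
Proof.
have mu : measurable_fun setT (fun x : Rd R d => f x * ln (f x / phi (x : 'rV[R]_d))).
  apply: measurable_funM => //; apply: measurableT_comp; first exact: measurable_ln.
  by apply: measurable_funM => //; apply: measurableT_comp; [exact: measurable_inv|exact: measurable_phi].
apply: (mpres_integrableP snd_mpres mu).
have JE i : (\int[prodm tt_m L]_z (Ff (f z.2) (g i z.2 + co z.2 i * f z.2))%:E =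
    \int[L]_x (fisher_dens f g i x)%:E)%E.
  have [_ h] := snd_mpres; rewrite -h//.
    by apply/measurable_EFinP; exact: measurable_fisher_dens.
  by move=> x; rewrite lee_fin Ff_ge0// (nice_ge0 nfg).
have [] := @cond_lsi R d _ unit tt_m (fun z => f z.2) (fun i z => g i z.2).
- exact: (mpres_integrable snd_mpres (nice_int nfg)).
- by move=> z; exact: nice_ge0 nfg _.
- by move=> i; exact: (mpres_integrable snd_mpres (nice_gint nfg i)).
- by move=> i; apply: aeW => z; exact: nice_g0 nfg _ _.
- by move=> i; exact: (ae_snd tt_m (nice_rep i)).
- by move=> i; rewrite JE; exact: nice_fisher.
move=> h _; move: h; congr (integrable _ _ _).
by apply/funext => z /=; rewrite (nice_one nfg) mul1r.
Qed.

Definition entropy (f : Rd R d -> R) := \int[L]_x (f x * ln (f x / phi (x : 'rV[R]_d))).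
Definition fisher (f : Rd R d -> R) g i := \int[L]_x (fisher_dens f g i x).

Lemma fisher_dens_integrable i : L.-integrable setT (EFin \o fisher_dens f g i).
Proof.
apply: ge0_integrable; [exact: measurable_fisher_dens| |exact: nice_fisher].
by move=> x; rewrite Ff_ge0// (nice_ge0 nfg).
Qed.

End gaussian_lsi.

(** * Density, information and entropy of c X + s Y *)

Section convolution.
Variables (R : realType) (d : nat).
Local Notation L := (lam R d).
Local Notation LL := (prodm (lam R d) (lam R d)).
Local Notation leb := (@lebesgue_measure R).
Local Notation co x i := ((x : 'rV[R]_d) ord0 i).
Local Notation e_ i := (delta_mx ord0 i : 'rV[R]_d).
Variables (f1 f2 : Rd R d -> R) (g1 g2 : 'I_d -> Rd R d -> R).
Hypotheses (n1 : nice f1 g1) (n2 : nice f2 g2).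
Variables (c s : R).
Hypotheses (cs1 : c ^+ 2 + s ^+ 2 = 1) (c0 : c != 0) (s0 : s != 0).
Let EE := (Rd R d * Rd R d)%type.

Let rf : EE -> EE := refl c s.
Let rfP : mpres LL LL rf.
Proof. by split; [exact: measurable_refl|exact: lam_refl]. Qed.
Let rfK : involutive rf. Proof. exact: reflK. Qed.

Let i1 := nice_int n1.
Let i2 := nice_int n2.
Let j1 i := nice_gint n1 i.
Let j2 i := nice_gint n2 i.
Let mf1 : measurable_fun setT f1 := Rintegrable_measurable i1.
Let mf2 : measurable_fun setT f2 := Rintegrable_measurable i2.

Let T (a b : Rd R d -> R) (z : EE) : R := a z.1 * b z.2.
Let iT a b : L.-integrable setT (EFin \o a) -> L.-integrable setT (EFin \o b) ->
  LL.-integrable setT (EFin \o T a b).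
Proof. exact: integrable_tensor. Qed.

Let bounded_mul (h k : EE -> R) M : LL.-integrable setT (EFin \o h) ->
  measurable_fun setT k -> (forall z, `|k z| <= M) -> LL.-integrable setT (EFin \o (fun z => h z * k z)).
Proof.
move=> ih mk kM; apply: (@Rintegrable_le _ _ _ LL _ (fun x => M * `|h x|)).
- by apply: measurable_funM => //; exact: Rintegrable_measurable ih.
- by move=> x; rewrite normrM mulrC ler_wpM2r.
- exact: RintegrableZ (Rintegrable_norm ih).
Qed.

(** Fubini, with the weak identity of the first density at each fixed [y]. Only the slices of [Psi]
    have to be test functions: a function of [c x + s y] need not have compact support in both
    variables jointly. *)
Lemma weak_fst (Psi A : EE -> R) i M : measurable_fun setT Psi -> measurable_fun setT A ->
  (forall z, `|Psi z| <= M) -> (forall z, `|A z| <= M) ->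
  (forall y, test_fun (fun x => Psi (x, y))) ->
  (forall x y, 'D_(e_ i) (fun x => Psi (x, y)) x = A (x, y)) ->
  \int[LL]_z (T f1 f2 z * A z) = - \int[LL]_z (T (g1 i) f2 z * Psi z).
Proof.
move=> mPsi mA PsiM AM tPsi DPsi.
rewrite (Rfubini2 (bounded_mul (iT i1 i2) mA AM)) (Rfubini2 (bounded_mul (iT (j1 i) i2) mPsi PsiM)).
rewrite -mulN1r -RintegralZl//; last exact: (integrable_Rint_fst (bounded_mul (iT (j1 i) i2) mPsi PsiM)).
apply: eq_Rintegral => y _ /=; rewrite mulN1r /T/=.
have mAy : measurable_fun setT (fun x => A (x, y)) := measurableT_comp mA (measurable_pair2 y).
have mPy : measurable_fun setT (fun x => Psi (x, y)) := measurableT_comp mPsi (measurable_pair2 y).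
under eq_Rintegral => x _ do rewrite mulrAC mulrC -DPsi.
rewrite RintegralZl//; last first.
  under eq_fun => x do rewrite DPsi.
  exact: (integrable_mul_bounded i1 mAy (fun x => AM (x, y))).
rewrite (nice_weak n1 i (tPsi y)) mulrN; congr (- _); rewrite -RintegralZl//.
  by apply: eq_Rintegral => x _; rewrite mulrAC mulrC.
exact: (integrable_mul_bounded (j1 i) mPy (fun x => PsiM (x, y))).
Qed.

Lemma weak_snd (Psi A : EE -> R) i M : measurable_fun setT Psi -> measurable_fun setT A ->
  (forall z, `|Psi z| <= M) -> (forall z, `|A z| <= M) ->
  (forall x, test_fun (fun y => Psi (x, y))) ->
  (forall x y, 'D_(e_ i) (fun y => Psi (x, y)) y = A (x, y)) ->
  \int[LL]_z (T f1 f2 z * A z) = - \int[LL]_z (T f1 (g2 i) z * Psi z).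
Proof.
move=> mPsi mA PsiM AM tPsi DPsi.
rewrite (Rfubini1 (bounded_mul (iT i1 i2) mA AM)) (Rfubini1 (bounded_mul (iT i1 (j2 i)) mPsi PsiM)).
rewrite -mulN1r -RintegralZl//; last exact: (integrable_Rint_snd (bounded_mul (iT i1 (j2 i)) mPsi PsiM)).
apply: eq_Rintegral => x _ /=; rewrite mulN1r /T/=.
have mAy : measurable_fun setT (fun y => A (x, y)) := measurableT_comp mA (measurable_pair1 x).
have mPy : measurable_fun setT (fun y => Psi (x, y)) := measurableT_comp mPsi (measurable_pair1 x).
under eq_Rintegral => y _ do rewrite -mulrA -DPsi.
rewrite RintegralZl//; last first.
  under eq_fun => y do rewrite DPsi.
  exact: (integrable_mul_bounded i2 mAy (fun y => AM (x, y))).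
rewrite (nice_weak n2 i (tPsi x)) mulrN; congr (- _); rewrite -RintegralZl//.
  by apply: eq_Rintegral => y _; rewrite mulrA.
exact: (integrable_mul_bounded (j2 i) mPy (fun y => PsiM (x, y))).
Qed.

Let sg1 i x := g1 i x + co x i * f1 x.
Let sg2 i x := g2 i x + co x i * f2 x.
Let isg1 i : L.-integrable setT (EFin \o sg1 i).
Proof. by apply: RintegrableD; [exact: j1|exact: nice_xint n1 i]. Qed.
Let isg2 i : L.-integrable setT (EFin \o sg2 i).
Proof. by apply: RintegrableD; [exact: j2|exact: nice_xint n2 i]. Qed.

(** Expanding the square leaves a cross term that is the product of the integrals of [sg1] and
    [sg2]. Each vanishes, because the gradient and the vector both have mean zero. *)
Lemma fisher_tensor (a b : R) i :
  (\int[LL]_z (Ff (T f1 f2 z) (a * T (sg1 i) f2 z + b * T f1 (sg2 i) z))%:E =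
   (a ^+ 2 * fisher f1 g1 i + b ^+ 2 * fisher f2 g2 i)%:E)%E.
Proof.
have iF1 := fisher_dens_integrable n1 i; have iF2 := fisher_dens_integrable n2 i.
have E z : Ff (T f1 f2 z) (a * T (sg1 i) f2 z + b * T f1 (sg2 i) z) =
  a ^+ 2 * T (fisher_dens f1 g1 i) f2 z + b ^+ 2 * T f1 (fisher_dens f2 g2 i) z
   + 2 * a * b * T (sg1 i) (sg2 i) z.
  rewrite /T /Ff /fisher_dens /Ff -/(sg1 i z.1) -/(sg2 i z.2).
  have [x0|x0] := eqVneq (f1 z.1) 0.
    by rewrite x0 mul0r eqxx /sg1 x0 (nice_g0 n1)//; ring.
  have [y0|y0] := eqVneq (f2 z.2) 0.
    by rewrite y0 mulr0 eqxx /sg2 y0 (nice_g0 n2)//; ring.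
  by rewrite mulf_eq0 (negbTE x0) (negbTE y0)/=; field; rewrite x0 y0.
have iA := RintegrableZ (a ^+ 2) (iT iF1 i2); have iB := RintegrableZ (b ^+ 2) (iT i1 iF2).
have iC := RintegrableZ (2 * a * b) (iT (isg1 i) (isg2 i)).
under eq_integral => z _ do rewrite E.
rewrite (RintegralE (RintegrableD (RintegrableD iA iB) iC)); congr EFin.
have iAB := RintegrableD iA iB.
rewrite RintegralD// RintegralD// !RintegralZl; try by [|exact: iT].
have TE u v : L.-integrable setT (EFin \o u) -> L.-integrable setT (EFin \o v) ->
    \int[LL]_z T u v z = (\int[L]_x u x) * (\int[L]_y v y).
  move=> iu iv; rewrite (Rfubini1 (iT iu iv)) mulrC -RintegralZl//.
  by apply: eq_Rintegral => x _; rewrite /T/= RintegralZl// mulrC.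
rewrite !TE// (nice_one n1) (nice_one n2).
have -> : \int[L]_x sg1 i x = 0.
  by rewrite RintegralD ?(nice_gmean n1) ?(nice_xmean n1) ?addr0//; exact: nice_xint n1 i.
by rewrite -/(fisher f1 g1 i) -/(fisher f2 g2 i); ring.
Qed.

(* [H] is the density of (V, W); [Gv] and [Gw] are its gradients in V and W. *)
Let H z := T f1 f2 (rf z).
Let iH : LL.-integrable setT (EFin \o H) := mpres_integrable rfP (iT i1 i2).
Let H0 z : 0 <= H z. Proof. by rewrite mulr_ge0 ?(nice_ge0 n1) ?(nice_ge0 n2). Qed.
Let Gv i z := c * T (g1 i) f2 (rf z) + s * T f1 (g2 i) (rf z).
Let Gw i z := s * T (g1 i) f2 (rf z) - c * T f1 (g2 i) (rf z).
Let ia i : LL.-integrable setT (EFin \o (fun z => T (g1 i) f2 (rf z))) := mpres_integrable rfP (iT (j1 i) i2).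
Let ib i : LL.-integrable setT (EFin \o (fun z => T f1 (g2 i) (rf z))) := mpres_integrable rfP (iT i1 (j2 i)).
Let iGv i : LL.-integrable setT (EFin \o Gv i).
Proof. by apply: RintegrableD; exact: RintegrableZ. Qed.
Let iGw i : LL.-integrable setT (EFin \o Gw i).
Proof. by apply: RintegrableB; exact: RintegrableZ. Qed.
Let H_Gv i z : H z = 0 -> Gv i z = 0.
Proof.
rewrite /H /Gv /T => /eqP; rewrite mulf_eq0 => /orP[] /eqP h; rewrite h.
  by rewrite (nice_g0 n1)// !mul0r !mulr0 addr0.
by rewrite (nice_g0 n2)// !mulr0 addr0.
Qed.
Let H_Gw i z : H z = 0 -> Gw i z = 0.
Proof.
rewrite /H /Gw /T => /eqP; rewrite mulf_eq0 => /orP[] /eqP h; rewrite h.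
  by rewrite (nice_g0 n1)// !mul0r !mulr0 subr0.
by rewrite (nice_g0 n2)// !mulr0 subr0.
Qed.

Definition convdens (v : Rd R d) : R := \int[L]_w H (v, w).
Definition convgrad i (v : Rd R d) : R := \int[L]_w Gv i (v, w).

Lemma convdens_int : L.-integrable setT (EFin \o convdens).
Proof. exact: integrable_Rint_snd iH. Qed.

Lemma convgrad_int i : L.-integrable setT (EFin \o convgrad i).
Proof. exact: integrable_Rint_snd (iGv i). Qed.

Lemma convdens_ge0 v : 0 <= convdens v.
Proof. by apply: fine_ge0; apply: integral_ge0 => w _; rewrite lee_fin. Qed.

Let mH : measurable_fun setT H := Rintegrable_measurable iH.
Let mGv i : measurable_fun setT (Gv i) := Rintegrable_measurable (iGv i).
Let mrf : measurable_fun setT rf := rfP.1.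

Let rf1 z i : co z.1 i = c * co (rf z).1 i + s * co (rf z).2 i.
Proof. by rewrite -{1}(rfK z) !mxE. Qed.
Let rf2 z i : co z.2 i = s * co (rf z).1 i - c * co (rf z).2 i.
Proof. by rewrite -{1}(rfK z) !mxE. Qed.

(** The Blachman-Stam inequality. [Ff_integral] on the fibres of constant [v] plays the part of the
    contraction property of conditional expectation. *)
Lemma conv_fisher_le i : (\int[L]_x (fisher_dens convdens convgrad i x)%:E <=
   (c ^+ 2 * fisher f1 g1 i + s ^+ 2 * fisher f2 g2 i)%:E)%E.
Proof.
pose S z := Ff (H z) (Gv i z + co z.1 i * H z).
have mS : measurable_fun setT S.
  apply: measurable_Ff => //; apply: measurable_funD => //; apply: measurable_funM => //.
  exact: (measurableT_comp (measurable_coord i) measurable_fst).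
have S0 z : 0 <= S z by exact: Ff_ge0.
have mTs1 : measurable_fun setT (T (sg1 i) f2) := Rintegrable_measurable (iT (isg1 i) i2).
have mTs2 : measurable_fun setT (T f1 (sg2 i)) := Rintegrable_measurable (iT i1 (isg2 i)).
have mT : measurable_fun setT (T f1 f2) := Rintegrable_measurable (iT i1 i2).
rewrite -(fisher_tensor c s i).
have [_ h] := rfP; rewrite -h; last 2 first.
- apply/measurable_EFinP; apply: measurable_Ff => //.
  by apply: measurable_funD; apply: measurable_funM.
- by move=> z; rewrite lee_fin Ff_ge0// mulr_ge0 ?(nice_ge0 n1) ?(nice_ge0 n2).
rewrite (eq_integral (fun z => (S z)%:E)); last first.
  move=> z _; congr ((Ff _ _)%:E); rewrite rf1 /Gv /H /T /sg1 /sg2; ring.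
rewrite tonelli1; last 2 first.
- exact/measurable_EFinP.
- by move=> z; rewrite lee_fin.
apply: ae_ge0_le_integral => //.
- by move=> v _; rewrite lee_fin Ff_ge0// convdens_ge0.
- apply/measurable_EFinP; apply: measurable_fisher_dens.
    exact: Rintegrable_measurable convdens_int.
  exact: Rintegrable_measurable (convgrad_int i).
- by move=> v _; apply: integral_ge0 => w _; rewrite lee_fin.
- apply: (measurable_fun_fubini_tonelli_F (m2 := L) (fun z => (S z)%:E)).
    exact/measurable_EFinP.
  by move=> z; rewrite lee_fin.
apply: (ae_imp2 (ae_integrable_fst iH) (ae_integrable_fst (iGv i))) => v ihv igv _.
have E : convgrad i v + co v i * convdens v = \int[L]_w (Gv i (v, w) + co v i * H (v, w)).
  by rewrite RintegralD// ?RintegralZl//; exact: RintegrableZ.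
rewrite /fisher_dens E /convdens; apply: Ff_integral => //.
- by apply: RintegrableD => //; exact: RintegrableZ.
- by apply: aeW => w hw; rewrite hw mulr0 addr0 H_Gv.
Qed.

Let transfer (k : EE -> R) : measurable_fun setT k ->
  \int[LL]_z (H z * k z) = \int[LL]_z (T f1 f2 z * k (rf z)).
Proof.
move=> mk; rewrite -(mpres_Rintegral rfP (g := fun z => T f1 f2 z * k (rf z))).
  by apply: eq_Rintegral => z _; rewrite rfK.
apply: measurable_funM; first exact: Rintegrable_measurable (iT i1 i2).
exact: measurableT_comp.
Qed.

Let transfer_grad (a b : R) (k : EE -> R) i M : measurable_fun setT k -> (forall z, `|k z| <= M) ->
  \int[LL]_z ((a * T (g1 i) f2 (rf z) + b * T f1 (g2 i) (rf z)) * k z) =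
  a * \int[LL]_z (T (g1 i) f2 z * k (rf z)) + b * \int[LL]_z (T f1 (g2 i) z * k (rf z)).
Proof.
move=> mk kM; have mkr : measurable_fun setT (fun z => k (rf z)) by exact: measurableT_comp.
have iA := bounded_mul (iT (j1 i) i2) mkr (fun z => kM (rf z)).
have iB := bounded_mul (iT i1 (j2 i)) mkr (fun z => kM (rf z)).
rewrite -!RintegralZl// -RintegralD//; try exact: RintegrableZ.
rewrite -(mpres_Rintegral rfP (g := fun z => a * (T (g1 i) f2 z * k (rf z)) + b * (T f1 (g2 i) z * k (rf z)))).
  by apply: eq_Rintegral => z _; rewrite rfK; ring.
exact: (Rintegrable_measurable (RintegrableD (RintegrableZ a iA) (RintegrableZ b iB))).
Qed.

Let marginal (h : EE -> R) (k : Rd R d -> R) M : LL.-integrable setT (EFin \o h) ->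
  measurable_fun setT k -> (forall x, `|k x| <= M) ->
  \int[L]_v (\int[L]_w h (v, w) * k v) = \int[LL]_z (h z * k z.1).
Proof.
move=> ih mk kM; have mk1 : measurable_fun setT (fun z : EE => k z.1) by exact: measurableT_comp.
have ihk := bounded_mul ih mk1 (fun z => kM z.1).
rewrite (Rfubini1 ihk); apply: ae_eq_Rintegral.
- by apply: measurable_funM => //; exact: Rintegrable_measurable (integrable_Rint_snd ih).
- exact: Rintegrable_measurable (integrable_Rint_snd ihk).
apply: (ae_imp (ae_integrable_fst ih)) => v ihv.
by rewrite mulrC -RintegralZl//; apply: eq_Rintegral => w _; rewrite mulrC.
Qed.

Lemma conv_weak_pair : weak_pair convdens convgrad.
Proof.
move=> psi i tpsi.
have [M1 h1] := test_le tpsi; have [M2 h2] := test_derive_le i tpsi.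
have M10 : 0 <= M1 by apply: le_trans (h1 0).
have M20 : 0 <= M2 by apply: le_trans (h2 0).
have mpsi := test_mes tpsi; have mD := test_derive_mes i tpsi.
rewrite (marginal iH mD h2) (marginal (iGv i) mpsi h1).
have mD1 : measurable_fun setT (fun z : EE => 'D_(e_ i) psi (z.1 : 'rV[R]_d)).
  exact: (measurableT_comp mD measurable_fst).
have mP1 : measurable_fun setT (fun z : EE => psi (z.1 : 'rV[R]_d)).
  exact: (measurableT_comp mpsi measurable_fst).
rewrite (transfer mD1) (transfer_grad c s i mP1 (fun z => h1 _)).
pose Psi (z : EE) := psi (rf z).1.
pose D (z : EE) := 'D_(e_ i) psi ((rf z).1 : 'rV[R]_d).
pose A z := c * D z; pose B z := s * D z.
have mPsi : measurable_fun setT Psi by exact: (measurableT_comp mP1 mrf).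
have mDr : measurable_fun setT D by exact: (measurableT_comp mD1 mrf).
pose M := M1 + `|c| * M2 + `|s| * M2.
have PsiM z : `|Psi z| <= M.
  by rewrite /M -addrA (le_trans (h1 _))// lerDl addr_ge0// mulr_ge0.
have AM z : `|A z| <= M.
  rewrite /A normrM; apply: (@le_trans _ _ (`|c| * M2)); first by rewrite ler_wpM2l// h2.
  by rewrite /M addrAC lerDr addr_ge0// mulr_ge0.
have BM z : `|B z| <= M.
  rewrite /B normrM; apply: (@le_trans _ _ (`|s| * M2)); first by rewrite ler_wpM2l// h2.
  by rewrite /M lerDr addr_ge0// mulr_ge0.
have mA : measurable_fun setT A by exact: measurable_funM.
have mB : measurable_fun setT B by exact: measurable_funM.
have t1 y : test_fun (fun x => Psi (x, y)) by exact: (test_affine (s *: (y : 'rV[R]_d)) c0 tpsi).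
have E2 x : (fun y : 'rV[R]_d => Psi (x, y)) = (fun y => psi (s *: y + c *: (x : 'rV[R]_d))).
  by apply/funext => y; rewrite /Psi/= addrC.
have t2 x : test_fun (fun y => Psi (x, y)) by rewrite E2; exact: test_affine.
have d1 x y : 'D_(e_ i) (fun x => Psi (x, y)) x = A (x, y).
  exact: (derive_affine c (s *: (y : 'rV[R]_d)) x i tpsi).
have d2 x y : 'D_(e_ i) (fun y => Psi (x, y)) y = B (x, y).
  by rewrite E2 derive_affine// /B /D/= addrC.
have w1 := weak_fst mPsi mA PsiM AM t1 d1.
have w2 := weak_snd mPsi mB PsiM BM t2 d2.
have iTA := bounded_mul (iT i1 i2) mA AM; have iTB := bounded_mul (iT i1 i2) mB BM.
(* The derivative of [psi] is recovered as [c] times the derivative in [x] plus [s] times the one in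
   [y], since [c^2 + s^2 = 1]. *)
transitivity (\int[LL]_z (c * (T f1 f2 z * A z) + s * (T f1 f2 z * B z))).
  apply: eq_Rintegral => z _; rewrite /A /B -/(D z).
  by rewrite -[LHS]mulr1 -cs1; ring.
rewrite RintegralD//; try exact: RintegrableZ.
rewrite !RintegralZl// w1 w2 !mulrN -opprD.
by [].
Qed.

Lemma conv_weak_grad : weak_grad convdens (fun v => \row_i convgrad i v).
Proof.
have cgE i : (fun x : 'rV[R]_d => (\row_i convgrad i x) ord0 i) = convgrad i.
  by apply/funext => x; rewrite mxE.
have mcg i : measurable_fun setT (convgrad i) := Rintegrable_measurable (convgrad_int i).
split; first by move=> i; rewrite cgE.
split=> [i r|psi i tpsi].
  under eq_fun => x do rewrite mxE.
  have m1 : measurable_fun setT (fun x : Rd R d => (if (sqnorm (x : 'rV[R]_d) <= r)%R then 1 else 0 : R)).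
    by apply: measurable_fun_ifT => //; apply: measurable_fun_ler => //; exact: measurable_sqnorm.
  rewrite iintE.
  - have /integrableP[_] := convgrad_int i; apply: le_lt_trans.
    apply: ge0_Rle; first by apply: measurable_funM => //; exact: measurableT_comp.
    + by move=> x; rewrite mulr_ge0//; case: (_ <= r)%R.
    + exact: measurableT_comp.
    + by move=> x; case: (_ <= r)%R; rewrite ?mul1r ?mul0r.
  - by apply/measurable_EFinP; apply: measurable_funM => //; exact: measurableT_comp.
  - by move=> x; rewrite lee_fin mulr_ge0//; case: (_ <= r)%R.
have [M1 h1] := test_le tpsi; have [M2 h2] := test_derive_le i tpsi.
under [in RHS]eq_fun => x do rewrite mxE.
rewrite (sint_int (integrable_mul_bounded convdens_int (test_derive_mes i tpsi) h2)).
rewrite (sint_int (integrable_mul_bounded (convgrad_int i) (test_mes tpsi) h1)).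
by rewrite (conv_weak_pair i tpsi).
Qed.

(** [shift_rep] on the pairs (v, w), along one coordinate of [w]. The weak identity is verified in
    the original variables, where the derivative in [w_i] is [s] times the one in [x_i] minus [c]
    times the one in [y_i]. *)
Lemma conv_rep i : {ae LL, forall z, H z =
  \int[leb]_(t in `]-oo, 0%R]) Gw i (z.1, vshift i t z.2)}.
Proof.
pose cc (j : 'I_d + 'I_d) (z : EE) := match j with inl j => co z.1 j | inr j => co z.2 j end.
have mcc j : measurable_fun setT (cc j).
  case: j => j /=; first exact: (measurableT_comp (measurable_coord j) measurable_fst).
  exact: (measurableT_comp (measurable_coord j) measurable_snd).
have gen d' (T' : measurableType d') (h : T' -> EE) :
    (forall j, measurable_fun setT (fun x => cc j (h x))) -> measurable_fun setT h.
  move=> mh; rewrite (_ : h = fun x => ((h x).1, (h x).2)); last first.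
    by apply/funext => x; case: (h x).
  apply: measurable_fun_pair; apply: measurable_fun_row => j.
    exact: (mh (inl j)).
  exact: (mh (inr j)).
pose tau t (z : EE) : EE := (z.1, vshift i t z.2).
have cc_tau j t z : cc j (tau t z) = cc j z + (if j == inr i then t else 0).
  by case: j => j /=; rewrite ?addr0// vshift_coord (inj_eq (@inr_inj _ _)).
have mtau : measurable_fun [set: EE * R] (fun z => tau z.2 z.1).
  apply: gen => j; under eq_fun => z do rewrite cc_tau.
  apply: measurable_funD; first exact: (measurableT_comp (mcc j) measurable_fst).
  by case: (j == inr i) => //; exact: measurable_snd.
have tau_mp t : mpres LL LL (tau t).
  have mt : measurable_fun setT (tau t) by exact: (measurableT_comp mtau (measurable_pair2 t)).
  split=> // h mh h0; rewrite tonelli1//; last exact: (measurableT_comp mh mt).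
  rewrite tonelli1//; apply: eq_integral => v _; have [_ hh] := vshift_mpres i t.
  by rewrite -[RHS]hh//; exact: (measurableT_comp mh (measurable_pair1 v)).
have tauN t z : tau (- t) (tau t z) = z.
  by case: z => v w; rewrite /tau/= vshiftN.
have [] := shift_rep mcc gen mtau tau_mp tauN cc_tau iH (iGw i) _.
move=> b hb.
have [K0 hK0] := choice (fun j => smooth_bounded (hb j).1 (hb j).2).
pose K := 1 + \sum_j `|K0 j|.
have K0K j : K0 j <= K.
  by rewrite /K (bigD1 j)//= (le_trans (ler_norm _))// addrCA lerDl addr_ge0// sumr_ge0.
have K1 : 1 <= K by rewrite /K lerDl sumr_ge0.
have Kge0 : 0 <= K by exact: le_trans K1.
have bK j t : `|b j t| <= K by apply: le_trans (hK0 j t).1 _.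
have dbK j t : `|derive1 (b j) t| <= K by apply: le_trans (hK0 j t).2 _.
pose b1 j := b (inl j); pose b2 j := b (inr j).
have sb1 j : smooth (b1 j) := (hb (inl j)).1; have sb2 j : smooth (b2 j) := (hb (inr j)).1.
pose Pn (z : EE) := \prod_(j | j != i) (b1 j (co z.1 j) * b2 j (co z.2 j)).
pose Psi0 (z : EE) := \prod_j (b1 j (co z.1 j) * b2 j (co z.2 j)).
pose a (z : EE) := derive1 (b1 i) (co z.1 i) * b2 i (co z.2 i).
pose bb (z : EE) := b1 i (co z.1 i) * derive1 (b2 i) (co z.2 i).
have mb j : measurable_fun setT (fun z : EE => b j (cc j z)).
  apply: measurableT_comp => //; apply: continuous_measurable_fun.
  exact: smooth_continuous (hb j).1.
have mdb j : measurable_fun setT (fun z : EE => derive1 (b j) (cc j z)).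
  apply: measurableT_comp => //; apply: continuous_measurable_fun.
  exact: smooth_continuous (smooth_derive (hb j).1).
have mbb j : measurable_fun setT (fun z : EE => b1 j (co z.1 j) * b2 j (co z.2 j)).
  by apply: measurable_funM; [exact: (mb (inl j))|exact: (mb (inr j))].
have mPsi0 : measurable_fun setT Psi0 by apply: measurable_prod.
have mPn : measurable_fun setT Pn.
  rewrite /Pn; under eq_fun => z do rewrite big_mkcond.
  by apply: (@measurable_prod _ EE R setT 'I_d) => j _; case: (j != i).
have ma : measurable_fun setT a by apply: measurable_funM; [exact: (mdb (inl i))|exact: (mb (inr i))].
have mbb' : measurable_fun setT bb by apply: measurable_funM; [exact: (mb (inl i))|exact: (mdb (inr i))].
have prodK (P : pred 'I_d) z : `|\prod_(j | P j) (b1 j (co z.1 j) * b2 j (co z.2 j))| <= \prod_(j < d) (K * K).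
  rewrite normr_prod (big_mkcond P); apply: ler_prod => j _; case: (P j).
    by rewrite normr_ge0/= normrM ler_pM//; [exact: bK|exact: bK].
  by rewrite ler01/= -[leLHS]mulr1 ler_pM.
pose C := \prod_(j < d) (K * K).
have C0 : 0 <= C by apply: prodr_ge0 => j _; rewrite mulr_ge0.
pose M := C + C * ((`|c| + `|s|) * (K * K)).
have aK z : `|a z| <= K * K by rewrite normrM ler_pM//; [exact: dbK|exact: bK].
have bbK z : `|bb z| <= K * K by rewrite normrM ler_pM//; [exact: bK|exact: dbK].
have lin (u v : R) z : `|u| + `|v| <= `|c| + `|s| -> `|Pn z * (u * a z + v * bb z)| <= M.
  move=> uv; rewrite normrM; apply: (@le_trans _ _ (C * ((`|c| + `|s|) * (K * K)))); last by rewrite lerDr.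
  apply: ler_pM => //; first exact: prodK.
  apply: le_trans (ler_normD _ _) _; rewrite [`|u * _|]normrM [`|v * _|]normrM.
  apply: (@le_trans _ _ ((`|u| + `|v|) * (K * K))); last by rewrite ler_wpM2r// mulr_ge0.
  by rewrite mulrDl lerD// ler_wpM2l.
pose Psi z := Psi0 (rf z).
pose A z := Pn (rf z) * (c * a (rf z) + s * bb (rf z)).
pose B z := Pn (rf z) * (s * a (rf z) + - c * bb (rf z)).
have PsiM z : `|Psi z| <= M.
  apply: (@le_trans _ _ C); first exact: (prodK predT).
  by rewrite lerDl mulr_ge0// mulr_ge0 ?addr_ge0// mulr_ge0.
have AM z : `|A z| <= M by apply: lin.
have BM z : `|B z| <= M by apply: lin; rewrite normrN addrC.
have mA0 (u v : R) : measurable_fun setT (fun z => Pn (rf z) * (u * a (rf z) + v * bb (rf z))).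
  apply: (@measurableT_comp _ _ _ _ _ _ (fun z => Pn z * (u * a z + v * bb z)) _ rf) => //.
  by apply: measurable_funM => //; apply: measurable_funD; apply: measurable_funM.
have mPsi : measurable_fun setT Psi by exact: measurableT_comp.
(* At fixed [y] a product test function of (v, w) is again a product as a function of [x], because
   [v_j] and [w_j] involve only the coordinate [x_j]; likewise at fixed [x]. Its support is compact
   as [c] and [s] are nonzero. *)
pose B1 (y : 'rV[R]_d) j t := b1 j (c * t + s * y ord0 j) * b2 j (s * t - c * y ord0 j).
pose B2 (x : 'rV[R]_d) j t := b1 j (c * x ord0 j + s * t) * b2 j (s * x ord0 j - c * t).
have caff (u v : R) (h : R -> R) : u != 0 -> compact_supp h -> compact_supp (fun t => h (u * t + v)).
  move=> u0 [N hN]; exists ((`|N| + `|v|) / `|u|) => t; rewrite ltr_pdivrMr ?normr_gt0// => ht.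
  apply: hN; have := ler_norm N; have := ler_normB (u * t + v) v.
  by rewrite addrK normrM [`|u| * _]mulrC; lra.
have csM (h k : R -> R) : compact_supp h -> compact_supp (fun t => h t * k t).
  by move=> [N hN]; exists N => t /hN ->; rewrite mul0r.
have B1E y j : B1 y j = fun t => b1 j (c * t + s * y ord0 j) * b2 j (s * t + (- c * y ord0 j)).
  by apply/funext => t; rewrite /B1 mulNr.
have B2E x j : B2 x j = fun t => b1 j (s * t + c * x ord0 j) * b2 j (- c * t + s * x ord0 j).
  by apply/funext => t; rewrite /B2 addrC; congr (_ * b2 j _); ring.
have hB1 y j : smooth (B1 y j) /\ compact_supp (B1 y j).
  rewrite B1E; split; first by apply: smoothM; exact: smooth_affine.
  by apply: csM; apply: caff => //; exact: (hb (inl j)).2.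
have hB2 x j : smooth (B2 x j) /\ compact_supp (B2 x j).
  rewrite B2E; split; first by apply: smoothM; exact: smooth_affine.
  by apply: csM; apply: caff => //; exact: (hb (inl j)).2.
have Psi1 y : (fun x => Psi (x, y)) = prodtest (B1 y).
  by apply/funext => x; apply: eq_bigr => j _; rewrite /B1/= !mxE.
have Psi2 x : (fun y => Psi (x, y)) = prodtest (B2 x).
  by apply/funext => y; apply: eq_bigr => j _; rewrite /B2/= !mxE.
have daff (h k : R -> R) (u v u' v' t : R) : smooth h -> smooth k ->
    derive1 (fun t => h (u * t + v) * k (u' * t + v')) t =
    u * (derive1 h (u * t + v) * k (u' * t + v')) + u' * (h (u * t + v) * derive1 k (u' * t + v')).
  move=> sh sk; apply: derive1_eq.
  have aff (p q : R) : is_derive t 1 (fun t : R => p * t + q) p.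
    have h0 := is_deriveD (is_deriveZ p (is_derive_id t (1 : R))) (is_derive_cst q t (1 : R)).
    by apply: (is_derive_eq h0); rewrite /GRing.scale/= mulr1 addr0.
  have h1 := @is_derive1_comp _ h (fun t : R => u * t + v) t _ _ (is_derive1P (@smooth_derivable _ _ sh (u * t + v))) (aff u v).
  have h2 := @is_derive1_comp _ k (fun t : R => u' * t + v') t _ _ (is_derive1P (@smooth_derivable _ _ sk (u' * t + v'))) (aff u' v').
  have h3 := is_deriveM h1 h2; apply: (is_derive_eq h3).
  by rewrite /GRing.scale/=; ring.
have t1 y : test_fun (fun x => Psi (x, y)) by rewrite Psi1; exact: test_prodtest.
have t2 x : test_fun (fun y => Psi (x, y)) by rewrite Psi2; exact: test_prodtest.
have d1 x y : 'D_(e_ i) (fun x => Psi (x, y)) x = A (x, y).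
  rewrite Psi1 (@derive_val _ _ _ _ _ _ _ (is_derive_prodtest _ (smooth_derivable (hB1 y i).1))).
  rewrite /A; congr (_ * _); first by apply: eq_bigr => j _; rewrite /B1/= !mxE.
  by rewrite B1E daff// /a /bb/= !mxE !mulNr.
have d2 x y : 'D_(e_ i) (fun y => Psi (x, y)) y = B (x, y).
  rewrite Psi2 (@derive_val _ _ _ _ _ _ _ (is_derive_prodtest _ (smooth_derivable (hB2 x i).1))).
  rewrite /B; congr (_ * _); first by apply: eq_bigr => j _; rewrite /B2/= !mxE.
  have E1 : s * co y i + c * co x i = c * co x i + s * co y i by rewrite addrC.
  have E2' : - c * co y i + s * co x i = s * co x i - c * co y i by ring.
  by rewrite B2E daff// E1 E2' /a /bb/= !mxE.
have w1 := weak_fst mPsi (mA0 _ _) PsiM AM t1 d1.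
have w2 := weak_snd mPsi (mA0 _ _) PsiM BM t2 d2.
have iTA := bounded_mul (iT i1 i2) (mA0 _ _) AM; have iTB := bounded_mul (iT i1 i2) (mA0 _ _) BM.
have PsiE z : \prod_j b j (cc j z) = Psi0 z by rewrite big_sumType/= -big_split.
have DE z : (\prod_(j | j != inr i) b j (cc j z)) * derive1 (b (inr i)) (cc (inr i) z) = Pn z * bb z.
  rewrite big_sumType/= (bigD1 i)//= /Pn big_split /bb /=.
  by rewrite -/(b1 i) -/(b2 i); ring.
transitivity (\int[LL]_z (H z * (Pn z * bb z))).
  by apply: eq_Rintegral => z _; rewrite -DE.
rewrite (transfer (k := fun z => Pn z * bb z)); last exact: measurable_funM.
(* In [s * A - c * B] the terms in [a] cancel, and [c^2 + s^2 = 1] leaves the derivative in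
   [w_i]. *)
transitivity (\int[LL]_z (s * (T f1 f2 z * A z) + - c * (T f1 f2 z * B z))).
  apply: eq_Rintegral => z _; rewrite /A /B -[LHS]mulr1 -cs1; ring.
rewrite RintegralD//; try exact: RintegrableZ.
rewrite !RintegralZl// w1 w2 !mulrN -opprD; congr (- _).
have PsiM0 z : `|Psi0 z| <= M by rewrite -(rfK z); exact: PsiM.
rewrite -(transfer_grad s (- c) i mPsi0 PsiM0).
  by apply: eq_Rintegral => z _; rewrite PsiE /Gw mulNr.
by move=> _ h; exact: h.
Qed.

Let phi_rf z : phi (z.1 : 'rV[R]_d) * phi (z.2 : 'rV[R]_d) =
  phi ((rf z).1 : 'rV[R]_d) * phi ((rf z).2 : 'rV[R]_d).
Proof.
have E : sqnorm (z.1 : 'rV[R]_d) + sqnorm (z.2 : 'rV[R]_d) =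
    sqnorm ((rf z).1 : 'rV[R]_d) + sqnorm ((rf z).2 : 'rV[R]_d).
  rewrite /sqnorm -!big_split; apply: eq_bigr => i _ /=.
  rewrite !mxE -[LHS]mul1r -cs1; ring.
rewrite /phi mulrACA [RHS]mulrACA -!expRD; congr (_ * expR _).
by rewrite -!opprD -!mulrDl E.
Qed.

(** [phi_rf] makes the entropy of the pair invariant under the reflection, and [cond_lsi] with the
    parameter [v] bounds the conditional part [u]. *)
Lemma conv_entropy : L.-integrable setT (EFin \o (fun x => convdens x * ln (convdens x / phi (x : 'rV[R]_d)))) /\
  entropy f1 + entropy f2 <= entropy convdens +
    \sum_i 2^-1 * (s ^+ 2 * fisher f1 g1 i + c ^+ 2 * fisher f2 g2 i).
Proof.
pose u z := H z * ln (H z / (convdens z.1 * phi (z.2 : 'rV[R]_d))).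
have JE i : (\int[LL]_z (Ff (H z) (Gw i z + co z.2 i * H z))%:E =
    (s ^+ 2 * fisher f1 g1 i + c ^+ 2 * fisher f2 g2 i)%:E)%E.
  rewrite -(sqrrN c) -(fisher_tensor s (- c) i); have [_ h] := rfP; rewrite -[RHS]h.
  - by apply: eq_integral => z _; congr ((Ff _ _)%:E); rewrite rf2 /Gw /H /T /sg1 /sg2; ring.
  - apply/measurable_EFinP; apply: measurable_Ff; first exact: Rintegrable_measurable (iT i1 i2).
    apply: measurable_funD; apply: measurable_funM => //.
      exact: (Rintegrable_measurable (iT (isg1 i) i2)).
    exact: (Rintegrable_measurable (iT i1 (isg2 i))).
  - by move=> z; rewrite lee_fin Ff_ge0// mulr_ge0 ?(nice_ge0 n1) ?(nice_ge0 n2).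
have [iu leu] : LL.-integrable setT (EFin \o u) /\
    ((\int[LL]_z u z)%:E <= \sum_i 2^-1%:E * \int[LL]_z (Ff (H z) (Gw i z + co z.2 i * H z))%:E)%E.
  apply: (@cond_lsi R d _ (Rd R d) L H Gw iH H0 iGw).
  - by move=> i; apply: aeW => z; exact: H_Gw.
  - exact: conv_rep.
  - by move=> i; rewrite JE ltry.
have {}leu : \int[LL]_z u z <= \sum_i 2^-1 * (s ^+ 2 * fisher f1 g1 i + c ^+ 2 * fisher f2 g2 i).
  by rewrite -lee_fin -sumEFin (le_trans leu)//; apply: lee_sum => i _; rewrite JE EFinM.
pose en f (x : Rd R d) := f x * ln (f x / phi (x : 'rV[R]_d)).
have ie1 : L.-integrable setT (EFin \o en f1) := entropy_integrable n1.
have ie2 : L.-integrable setT (EFin \o en f2) := entropy_integrable n2.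
pose h z := T (en f1) f2 z + T f1 (en f2) z.
have ih : LL.-integrable setT (EFin \o h) := RintegrableD (iT ie1 i2) (iT i1 ie2).
have ihr : LL.-integrable setT (EFin \o (fun z => h (rf z))) := mpres_integrable rfP ih.
pose l (x : Rd R d) := ln (convdens x / phi (x : 'rV[R]_d)).
have ml : measurable_fun setT l.
  apply: measurableT_comp; first exact: measurable_ln.
  apply: measurable_funM; first exact: Rintegrable_measurable convdens_int.
  by apply: measurableT_comp; [exact: measurable_inv|exact: measurable_phi].
pose k z := H z * l z.1.
have mk : measurable_fun setT k by apply: measurable_funM => //; exact: (measurableT_comp ml measurable_fst).
have kE : {ae LL, forall z, h (rf z) - u z = k z}.
  (* The logarithm is split only where all the densities are positive; outside a null set, [H > 0]
     forces [convdens > 0]. *)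
  apply: (ae_imp (zero_marginal iH H0)) => z; rewrite -/(convdens z.1) => Vz.
  rewrite /h /u /k /l /T /en /H /T.
  set a := f1 _; set b := f2 _.
  have [a0|an0] := eqVneq a 0; first by rewrite a0 !mul0r addr0 subr0.
  have [b0|bn0] := eqVneq b 0; first by rewrite b0 !(mul0r, mulr0) addr0 subr0.
  have a_gt0 : 0 < a by rewrite lt_neqAle eq_sym an0 (nice_ge0 n1).
  have b_gt0 : 0 < b by rewrite lt_neqAle eq_sym bn0 (nice_ge0 n2).
  have V_gt0 : 0 < convdens z.1.
    rewrite lt_neqAle convdens_ge0 andbT; apply/eqP => /esym/Vz/eqP.
    by rewrite /H /T -/a -/b mulf_eq0 (negbTE an0) (negbTE bn0).
  have p1 := phi_gt0 ((rf z).1 : 'rV[R]_d); have p2 := phi_gt0 ((rf z).2 : 'rV[R]_d).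
  have q1 := phi_gt0 (z.1 : 'rV[R]_d); have q2 := phi_gt0 (z.2 : 'rV[R]_d).
  have -> : a * ln (a / phi ((rf z).1 : 'rV[R]_d)) * b + a * (b * ln (b / phi ((rf z).2 : 'rV[R]_d))) =
      a * b * (ln (a / phi ((rf z).1 : 'rV[R]_d)) + ln (b / phi ((rf z).2 : 'rV[R]_d))) by ring.
  rewrite -lnM ?posrE ?divr_gt0// -mulrBr; congr (_ * _); apply/eqP; rewrite subr_eq; apply/eqP.
  have E : a / phi ((rf z).1 : 'rV[R]_d) * (b / phi ((rf z).2 : 'rV[R]_d)) =
      (convdens z.1 / phi (z.1 : 'rV[R]_d)) * (a * b / (convdens z.1 * phi (z.2 : 'rV[R]_d))).
    rewrite mulf_div -phi_rf; field; rewrite !gt_eqF//.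
  rewrite E lnM// posrE.
    by rewrite divr_gt0.
  by rewrite divr_gt0// mulr_gt0.
(* The entropy of [V] is finite by subtraction: [k] is integrable as a difference, and [w] is then
   integrated out. *)
have ihu := RintegrableB ihr iu.
have ik : LL.-integrable setT (EFin \o k) := ae_eq_integrable mk kE ihu.
have int_k : \int[LL]_z k z = entropy f1 + entropy f2 - \int[LL]_z u z.
  rewrite -(ae_eq_Rintegral (Rintegrable_measurable ihu) mk kE) RintegralB//; congr (_ - _).
  rewrite (mpres_Rintegral rfP (Rintegrable_measurable ih)) RintegralD//; try exact: iT.
  have TE u' v : L.-integrable setT (EFin \o u') -> L.-integrable setT (EFin \o v) ->
      \int[LL]_z T u' v z = (\int[L]_x u' x) * (\int[L]_y v y).
    move=> iu' iv; rewrite (Rfubini1 (iT iu' iv)) mulrC -RintegralZl//.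
    by apply: eq_Rintegral => x _; rewrite /T/= RintegralZl// mulrC.
  by rewrite !TE// (nice_one n1) (nice_one n2) mulr1 mul1r.
have mV : measurable_fun setT (fun x => convdens x * l x).
  by apply: measurable_funM => //; exact: Rintegrable_measurable convdens_int.
have VE : {ae L, forall v, \int[L]_w k (v, w) = convdens v * l v}.
  apply: (ae_imp (ae_integrable_fst iH)) => v ihv.
  under eq_Rintegral => w _ do rewrite /k/= mulrC.
  by rewrite RintegralZl// mulrC.
have iV := ae_eq_integrable mV VE (integrable_Rint_snd ik).
split; first exact: iV.
have -> : entropy convdens = \int[LL]_z k z.
  rewrite (Rfubini1 ik); apply/esym; apply: ae_eq_Rintegral VE => //.
  exact: Rintegrable_measurable (integrable_Rint_snd ik).
by rewrite int_k -addrA lerDl addrC subr_ge0.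
Qed.

End convolution.

(** * Laws of normalized sums *)

Section laws.
Variables (R : realType) (d : nat).
Local Notation E := (Rd R d).
Local Notation L := (lam R d).
Local Notation leb := (@lebesgue_measure R).
Local Notation co x i := ((x : 'rV[R]_d) ord0 i).
Let mleb : {sigma_finite_measure set (measurableTypeR R) -> \bar R} := leb.

Definition vadd (z : E * E) : E := (z.1 : 'rV[R]_d) + (z.2 : 'rV[R]_d).

Lemma measurable_vadd : measurable_fun setT vadd.
Proof.
apply: measurable_fun_row => i; under eq_fun => z do rewrite mxE.
apply: measurable_funD; first exact: (measurableT_comp (measurable_coord i) measurable_fst).
exact: (measurableT_comp (measurable_coord i) measurable_snd).
Qed.

Definition vscale (k : R) (x : E) : E := k *: (x : 'rV[R]_d).

Lemma measurable_vscale k : measurable_fun setT (vscale k).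
Proof.
apply: measurable_fun_row => i; under eq_fun => x do rewrite mxE.
by apply: measurable_funM => //; exact: measurable_coord.
Qed.

Section convm.
Variables m1 m2 : probability E R.

Definition convm : set E -> \bar R := pushforward (prodm m1 m2) vadd.

HB.instance Definition _ := Measure.copy convm (pushm measurable_vadd (prodm m1 m2)).

Lemma convm_setT : convm setT = 1%E.
Proof.
rewrite /convm /pushforward preimage_setT /prodm -setXTT product_measure1E//.
by rewrite [X in (X * _)%E]probability_setT [X in (_ * X)%E]probability_setT mule1.
Qed.

HB.instance Definition _ := Measure_isProbability.Build _ _ _ convm convm_setT.

Lemma convm_mpres : mpres (prodm m1 m2) convm vadd.
Proof.
split; first exact: measurable_vadd.
by move=> g mg g0; rewrite /convm ge0_integral_pushforward//; exact: measurable_vadd.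
Qed.

Lemma integral_convm (h : E -> \bar R) : measurable_fun setT h -> (forall x, 0 <= h x)%E ->
  (\int[convm]_x h x = \int[m1]_x \int[m2]_y h (vadd (x, y)))%E.
Proof.
move=> mh h0; have [_ hh] := convm_mpres; rewrite -hh// tonelli1//.
exact: (measurableT_comp mh measurable_vadd).
Qed.

End convm.

Variable mu : probability E R.

(** [sumlaw] is a bare set function; this is the same recursion within probability measures, with
    which integrals and Tonelli's theorem are available. *)
Fixpoint nu (n : nat) : probability E R :=
  if n is n'.+1 then convm mu (nu n') else @dirac _ (Rd R d) (0 : 'rV[R]_d) R.

Lemma sumlawE n (A : set E) : measurable A -> sumlaw mu n A = nu n A.
Proof.
elim: n A => [|n IHn] A mA /=.
  by rewrite diracE indicE.
have mIA : measurable_fun setT (fun x : E => (\1_A x : R)%:E).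
  by apply/measurable_EFinP; exact: measurable_indic.
rewrite -[RHS]/(convm mu (nu n) A) -[RHS]integral_indicT// integral_convm//.
apply: eq_integral => x _.
have mAx : measurable [set y : E | A ((x : 'rV[R]_d) + (y : 'rV[R]_d))].
  have := measurableT_comp measurable_vadd (measurable_pair1 x).
  by move=> /(_ measurableT A mA); rewrite setTI.
rewrite IHn// -integral_indicT//; by apply: eq_integral => y _.
Qed.

Lemma integral_nuD n m (h : E -> \bar R) : measurable_fun setT h -> (forall x, 0 <= h x)%E ->
  (\int[nu (n + m)]_x h x = \int[nu n]_x \int[nu m]_y h (vadd (x, y)))%E.
Proof.
elim: n h => [|n IHn] h mh h0.
  rewrite add0n integral_dirac ?diracT ?mul1e//.
    by apply: eq_integral => y _; rewrite /vadd/= add0r.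
  apply: (measurable_fun_fubini_tonelli_F (m2 := nu m) (h \o vadd)); last by move=> z; exact: h0.
  exact: (measurableT_comp mh measurable_vadd).
have mhv := measurableT_comp mh measurable_vadd.
have hv0 z : (0 <= (h \o vadd) z)%E by exact: h0.
rewrite addSn /= integral_convm// integral_convm; last 2 first.
- exact: (measurable_fun_fubini_tonelli_F (m2 := nu m) (h \o vadd) mhv hv0).
- by move=> x; exact: integral_ge0.
apply: eq_integral => x _; rewrite IHn//; last exact: (measurableT_comp mhv (measurable_pair1 x)).
apply: eq_integral => y _; apply: eq_integral => z _.
by rewrite /vadd/= addrA.
Qed.

Definition ksc n : R := (Num.sqrt n%:R)^-1.

Lemma UlawE n (A : set E) : measurable A -> Ulaw mu n A = nu n (vscale (ksc n) @^-1` A).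
Proof.
move=> mA; rewrite /Ulaw sumlawE//.
have := @measurable_vscale (ksc n) measurableT A mA.
by rewrite setTI.
Qed.

Lemma Ulaw_setT n : Ulaw mu n setT = 1%E.
Proof. by rewrite UlawE// preimage_setT probability_setT. Qed.

Lemma Ulaw1 (A : set E) : measurable A -> Ulaw mu 1 A = mu A.
Proof.
move=> mA; rewrite UlawE// -[LHS]integral_indicT; last first.
  have := @measurable_vscale (ksc 1) measurableT A mA.
  by rewrite setTI.
rewrite -[RHS]integral_indicT// /= integral_convm; last 2 first.
- apply/measurable_EFinP; apply: measurable_indic.
  have := @measurable_vscale (ksc 1) measurableT A mA.
  by rewrite setTI.
- by move=> x; rewrite lee_fin.
have mB : measurable (vscale (ksc 1) @^-1` A).
  by have := @measurable_vscale (ksc 1) measurableT A mA; rewrite setTI.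
have mIB : measurable_fun setT (\1_(vscale (ksc 1) @^-1` A) : E -> R) by exact: measurable_indic.
apply: eq_integral => x _; rewrite integral_dirac//; last first.
  apply/measurable_EFinP; apply: (measurableT_comp mIB).
  exact: (measurableT_comp measurable_vadd (measurable_pair1 x)).
rewrite diracT mul1e; congr EFin; rewrite !indicE; congr ((_ : bool)%:R).
have E1 : vscale (ksc 1) (vadd (x, 0 : E)) = x.
  by rewrite /vscale /ksc /vadd/= addr0 sqrtr1 invr1 scale1r.
by apply/idP/idP; rewrite !inE /= E1.
Qed.

(** Layer-cake formula: [is_density] speaks of sets only, and the superlevel sets of [h] carry it
    over to functions. *)
Lemma law_density n (f : E -> R) (h : E -> R) : is_density (Ulaw mu n) f ->
  measurable_fun setT h -> (forall x, 0 <= h x) ->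
  (\int[nu n]_x (h (vscale (ksc n) x))%:E = \int[L]_x (h x * f x)%:E)%E.
Proof.
move=> [mf [f0 fE]] mh h0.
(* [h x] is the Lebesgue measure of [0, h x[. *)
pose Q (z : E * measurableTypeR R) : R := (0 <= z.2 < h z.1)%R%:R.
have mQ : measurable_fun setT Q.
  apply: measurable_boolr; apply: measurable_and.
    by apply: measurable_fun_ler => //; exact: measurable_snd.
  apply: measurable_fun_ltr; first exact: measurable_snd.
  exact: (measurableT_comp mh measurable_fst).
have Q0 z : 0 <= Q z by [].
have QE x : (\int[mleb]_t (Q (x, t))%:E = (h x)%:E)%E.
  transitivity (\int[mleb]_t (\1_(`[0, h x[%classic : set R) t)%:E)%E.
    apply: eq_integral => t _; rewrite /Q indicE/=; congr ((_ : bool)%:R%:E).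
    by apply/idP/idP; rewrite inE/= in_itv.
  rewrite (@integral_indicT _ (measurableTypeR R) R mleb)// /mleb/= lebesgue_measure_itv/= lte_fin.
  have [hx|hx|<-//] := ltgtP 0 (h x); first by rewrite sube0.
  by have := h0 x; rewrite leNgt hx.
pose A t : set E := [set x | 0 <= t < h x].
have mA t : measurable (A t).
  have mb : measurable_fun setT (fun x : E => (0 <= t) && (t < h x)).
    by apply: measurable_and => //; apply: measurable_fun_ltr.
  by have := mb measurableT [set true] Logic.I; rewrite setTI.
have QA x t : Q (x, t) = \1_(A t) x.
  by rewrite /Q indicE /A/=; congr ((_ : bool)%:R); apply/idP/idP; rewrite inE.
have ms := measurable_vscale (ksc n).
under eq_integral => x _ do rewrite -QE.
have mQs : measurable_fun setT (fun z : E * measurableTypeR R => (Q (vscale (ksc n) z.1, z.2))%:E).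
  apply/measurable_EFinP; apply: (measurableT_comp mQ).
  apply: measurable_fun_pair; first exact: (measurableT_comp ms measurable_fst).
  exact: measurable_snd.
have Qs0 (z : E * measurableTypeR R) : (0 <= (Q (vscale (ksc n) z.1, z.2))%:E)%E by rewrite lee_fin.
rewrite -(tonelli1 (fun z : E * measurableTypeR R => (Q (vscale (ksc n) z.1, z.2))%:E)) ?tonelli2//.
have mQf : measurable_fun setT (fun z : E * measurableTypeR R => (Q z * f z.1)%:E).
  by apply/measurable_EFinP; apply: measurable_funM => //; exact: measurableT_comp.
have Qf0 z : (0 <= (Q z * f z.1)%:E)%E by rewrite lee_fin mulr_ge0.
transitivity (\int[prodm L mleb]_z (Q z * f z.1)%:E)%E.
  rewrite tonelli2//; apply: eq_integral => t _ /=.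
  under eq_integral => x _ do rewrite QA.
  under [in RHS]eq_integral => x _ do rewrite QA.
  rewrite -iintE//; last 2 first.
  - by apply/measurable_EFinP; apply: measurable_funM => //; exact: measurable_indic.
  - by move=> x; rewrite lee_fin mulr_ge0.
  rewrite -fE// UlawE// -integral_indicT//.
  by have := ms measurableT (A t) (mA t); rewrite setTI.
rewrite tonelli1//; apply: eq_integral => x _ /=.
under eq_integral => t _ do rewrite mulrC.
rewrite (@ge0_RZl _ (measurableTypeR R) R mleb)//.
  by rewrite QE -EFinM mulrC.
exact: (measurableT_comp mQ (measurable_pair1 x)).
Qed.

Hypothesis cmu : centered mu.

Lemma nu_centered n i : (nu n).-integrable setT (EFin \o (fun x : E => co x i)) /\
  \int[nu n]_x co x i = 0.
Proof.
elim: n => [|n [IHi IHm]].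
  have m0 : measurable_fun setT (EFin \o (fun x : E => co x i)) by apply/measurable_EFinP; exact: measurable_coord.
  split; last by rewrite /Rintegral integral_dirac// diracT mul1e/= mxE.
  apply/integrableP; split => //; rewrite integral_dirac ?diracT ?mul1e//= ?mxE ?normr0 ?ltry//.
  apply/measurable_EFinP; apply: measurableT_comp => //; exact: measurable_coord.
have [i1 m1] := cmu i; have [vm vh] := convm_mpres mu (nu n).
have mco : measurable_fun setT (fun x : E => co x i) by exact: measurable_coord.
have c1 (m : probability E R) : m.-integrable setT (EFin \o (fun _ : E => 1 : R)).
  exact: finite_measure_integrable_cst.
have ia : (prodm mu (nu n)).-integrable setT (fun z : E * E => (co z.1 i * 1)%:E).
  exact: (@integrable_tensor _ _ E E R mu (nu n) (fun x => co x i) (fun=> 1) i1 (c1 (nu n))).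
have ib : (prodm mu (nu n)).-integrable setT (fun z : E * E => (1 * co z.2 i)%:E).
  exact: (@integrable_tensor _ _ E E R mu (nu n) (fun=> 1) (fun x => co x i) (c1 mu) IHi).
have iab := RintegrableD ia ib.
have cE : (fun z : E * E => co z.1 i * 1 + 1 * co z.2 i) = (fun z => co (vadd z) i).
  by apply/funext => z; rewrite mulr1 mul1r mxE.
rewrite cE in iab.
split; first exact: (mpres_integrableP (convm_mpres mu (nu n)) mco iab).
rewrite -(mpres_Rintegral (convm_mpres mu (nu n)) mco) -cE RintegralD//.
rewrite (Rfubini1 ia) (Rfubini1 ib) /=.
have e1 : \int[mu]_x \int[nu n]_y (co x i * 1) = 0.
  transitivity (\int[mu]_x co x i); last by rewrite /Rintegral m1.
  apply: eq_Rintegral => x _; rewrite mulr1 Rintegral_cst// [fine _](_ : _ = 1) ?mulr1//.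
  by rewrite [X in fine X](probability_setT (nu n)).
have e2 : \int[mu]_x \int[nu n]_y (1 * co y i) = 0.
  transitivity (\int[mu]_x (0 : R)); last by rewrite Rintegral_cst// mul0r.
  by apply: eq_Rintegral => x _; under eq_Rintegral => y _ do rewrite mul1r.
by rewrite e1 e2 addr0.
Qed.

Lemma density_centered n f i : is_density (Ulaw mu n) f ->
  L.-integrable setT (EFin \o (fun x : E => co x i * f x)) /\ \int[L]_x (co x i * f x) = 0.
Proof.
move=> df; have [mf [f0 _]] := df; have [ic mc] := nu_centered n i.
have mco : measurable_fun setT (fun x : E => co x i) by exact: measurable_coord.
pose k := ksc n.
have ik : (nu n).-integrable setT (EFin \o (fun x : E => co (vscale k x) i)).
  have := RintegrableZ k ic; congr (integrable _ _ _).
  by apply/funext => x /=; rewrite mxE.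
have /integrableP[_ koo] := ik.
have xf : L.-integrable setT (EFin \o (fun x : E => co x i * f x)).
  apply/integrableP; split; first by apply/measurable_EFinP; exact: measurable_funM.
  move: koo; rewrite (law_density (h := fun x => `|co x i|) df)//; last exact: measurableT_comp.
  by under eq_integral => x _ do rewrite -{1}(ger0_norm (f0 x)) -normrM.
split=> //.
(* [law_density] is for nonnegative functions, hence the separate treatment of positive and negative
   parts. *)
pose hp (x : E) := Num.max (co x i) 0; pose hn (x : E) := Num.max (- co x i) 0.
have mhp : measurable_fun setT hp by exact: measurable_maxr.
have mhn : measurable_fun setT hn by apply: measurable_maxr => //; exact: measurableT_comp.
have hp0 x : 0 <= hp x by rewrite le_max lexx orbT.
have hn0 x : 0 <= hn x by rewrite le_max lexx orbT.
have hE x : co x i = hp x - hn x.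
  by rewrite /hp /hn; case: (leP (co x i) 0) => h; case: (leP (- co x i) 0) => h'; lra.
have hple x : hp x <= `|co x i| by rewrite /hp ge_max ler_norm normr_ge0.
have hnle x : hn x <= `|co x i| by rewrite /hn ge_max -normrN ler_norm normr_ge0.
have ip : L.-integrable setT (EFin \o (fun x => hp x * f x)).
  apply: (Rintegrable_le _ _ (Rintegrable_norm xf)); first exact: measurable_funM.
  by move=> x; rewrite !normrM ler_wpM2r// ger0_norm.
have in_ : L.-integrable setT (EFin \o (fun x => hn x * f x)).
  apply: (Rintegrable_le _ _ (Rintegrable_norm xf)); first exact: measurable_funM.
  by move=> x; rewrite !normrM ler_wpM2r// ger0_norm.
have ms := measurable_vscale k.
have jp : (nu n).-integrable setT (EFin \o (fun x => hp (vscale k x))).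
  apply: (Rintegrable_le _ _ (Rintegrable_norm ik)); first exact: measurableT_comp.
  by move=> x; rewrite ger0_norm.
have jn : (nu n).-integrable setT (EFin \o (fun x => hn (vscale k x))).
  apply: (Rintegrable_le _ _ (Rintegrable_norm ik)); first exact: measurableT_comp.
  by move=> x; rewrite ger0_norm.
have -> : \int[L]_x (co x i * f x) = \int[L]_x (hp x * f x) - \int[L]_x (hn x * f x).
  by rewrite -RintegralB//; apply: eq_Rintegral => x _; rewrite hE mulrBl.
rewrite /Rintegral -(law_density df mhp hp0) -(law_density df mhn hn0).
rewrite -/(Rintegral (nu n) setT (fun x => hp (vscale k x))) -/(Rintegral (nu n) setT (fun x => hn (vscale k x))).
rewrite -RintegralB//.
transitivity (\int[nu n]_x (k * co x i)); last by rewrite RintegralZl// mc mulr0.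
by apply: eq_Rintegral => x _; rewrite -hE mxE.
Qed.

(** [U_(n+m)] is [c U_n + s U_m] with independent terms, the first component of the reflection; its
    law is therefore a marginal of the reflected product law. *)
Lemma conv_density n m f1 f2 : (0 < n)%N -> (0 < m)%N ->
  is_density (Ulaw mu n) f1 -> is_density (Ulaw mu m) f2 ->
  let c := Num.sqrt n%:R / Num.sqrt (n + m)%:R in
  let s := Num.sqrt m%:R / Num.sqrt (n + m)%:R in
  L.-integrable setT (EFin \o f1) -> L.-integrable setT (EFin \o f2) ->
  is_density (Ulaw mu (n + m)) (convdens f1 f2 c s).
Proof.
move=> n0 m0 df1 df2 c s i1 i2; have [mf1 [f10 _]] := df1; have [mf2 [f20 _]] := df2.
have sq_gt0 k : (0 < k)%N -> 0 < Num.sqrt k%:R :> R by move=> k0; rewrite sqrtr_gt0 ltr0n.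
have nm0 : (0 < n + m)%N by rewrite addn_gt0 n0.
have c0 : c != 0 by rewrite mulf_neq0// ?invr_eq0 gt_eqF// sq_gt0.
have cs1 : c ^+ 2 + s ^+ 2 = 1.
  rewrite /c /s !exprMn !exprVn !sqr_sqrtr ?ler0n// -mulrDl -natrD divff// pnatr_eq0 -lt0n//.
have rfP : mpres (prodm L L) (prodm L L) (refl c s).
  by split; [exact: measurable_refl|exact: lam_refl].
pose T (z : E * E) := f1 z.1 * f2 z.2.
have iT : (prodm L L).-integrable setT (EFin \o T) by exact: integrable_tensor.
have iH := mpres_integrable rfP iT.
have T0 z : 0 <= T z by rewrite mulr_ge0.
split; first exact: Rintegrable_measurable (integrable_Rint_snd iH).
split=> [v|A mA].
  by apply: fine_ge0; apply: integral_ge0 => w _; rewrite lee_fin; exact: (T0 (refl c s (v, w))).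
have mIA : measurable_fun setT (\1_A : E -> R) by exact: measurable_indic.
have mV : measurable_fun setT (convdens f1 f2 c s) := Rintegrable_measurable (integrable_Rint_snd iH).
have V0 v : 0 <= convdens f1 f2 c s v.
  by apply: fine_ge0; apply: integral_ge0 => w _; rewrite lee_fin; exact: (T0 (refl c s (v, w))).
rewrite iintE; last 2 first.
- by apply/measurable_EFinP; exact: measurable_funM.
- by move=> x; rewrite lee_fin mulr_ge0.
have mscA k : measurable (vscale k @^-1` A) by have := @measurable_vscale k measurableT A mA; rewrite setTI.
have mrf := @measurable_refl R d c s.
pose lin (z : E * E) : E := (refl c s z).1.
have mlin : measurable_fun setT lin by exact: (measurableT_comp measurable_fst mrf).
have mI2 : measurable_fun setT (fun z => \1_A (lin z) * f2 z.2).
  apply: measurable_funM; first exact: (measurableT_comp mIA mlin).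
  exact: measurableT_comp.
pose ph (x : E) := \int[L]_y (\1_A (lin (x, y)) * f2 y).
have mph : measurable_fun setT ph by exact: (measurable_Rint L mI2).
have I01 (x : E) : `|\1_A x : R| <= 1 by rewrite indicE; case: (_ \in _); rewrite ?normr1 ?normr0.
have iph x : L.-integrable setT (EFin \o (fun y => \1_A (lin (x, y)) * f2 y)).
  apply: (Rintegrable_le _ _ (Rintegrable_norm i2)); first exact: (measurableT_comp mI2 (measurable_pair1 x)).
  by move=> y; rewrite normrM -[leRHS]mul1r ler_wpM2r.
have ph0 x : 0 <= ph x.
  by apply: fine_ge0; apply: integral_ge0 => y _; rewrite lee_fin mulr_ge0.
transitivity (\int[L]_x (ph x * f1 x)%:E)%E.
  rewrite UlawE// -integral_indicT// integral_nuD; last 2 first.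
  - by apply/measurable_EFinP; exact: measurable_indic.
  - by move=> x; rewrite lee_fin.
  rewrite -(law_density df1 mph ph0); apply: eq_integral => x _.
  set X := vscale (ksc n) x.
  have mAX : measurable_fun setT (fun y => \1_A (lin (X, y)) : R).
    exact: (measurableT_comp mIA (measurableT_comp mlin (measurable_pair1 X))).
  rewrite /ph -(RintegralE (iph X)) -(law_density df2 mAX)//.
  apply: eq_integral => y _; rewrite !indicE; congr (((_ : bool)%:R)%:E).
  have linE : vscale (ksc (n + m)) (vadd (x, y)) = lin (X, vscale (ksc m) y).
    rewrite /lin /X /vscale /vadd /refl/= scalerDr !scalerA /ksc /c /s; congr (_ *: _ + _ *: _).
      by rewrite mulrAC divff ?mul1r// gt_eqF// sq_gt0.
    by rewrite mulrAC divff ?mul1r// gt_eqF// sq_gt0.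
  by apply/idP/idP; rewrite !inE /= linE.
have mIT : measurable_fun setT (fun z => (\1_A (lin z) * T z)%:E).
  apply/measurable_EFinP; apply: measurable_funM; first exact: (measurableT_comp mIA mlin).
  exact: Rintegrable_measurable iT.
have IT0 z : (0 <= (\1_A (lin z) * T z)%:E)%E by rewrite lee_fin mulr_ge0.
transitivity (\int[prodm L L]_z (\1_A (lin z) * T z)%:E)%E.
  rewrite tonelli1//; apply: eq_integral => x _.
  under [in RHS]eq_integral => y _ do rewrite /T/= mulrCA.
  rewrite ge0_RZl//.
  - by rewrite (RintegralE (iph x)) -/(ph x) -EFinM mulrC.
  - exact: (measurableT_comp mI2 (measurable_pair1 x)).
  - by move=> y; rewrite mulr_ge0.
(* As the reflection is an involution, this change of variables turns [lin] into the first
   coordinate [v]. *)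
have [_ hrf] := rfP; rewrite -[LHS]hrf// tonelli1//; last first.
  exact: (measurableT_comp mIT mrf).
apply: ae_eq_integral => //.
- apply: (measurable_fun_fubini_tonelli_F (m2 := L) (fun z => (\1_A (lin (refl c s z)) * T (refl c s z))%:E)) => //.
  exact: (measurableT_comp mIT mrf).
- by apply/measurable_EFinP; exact: measurable_funM.
apply: (ae_imp (ae_integrable_fst iH)) => v ihv _.
have reflE w : lin (refl c s (v, w)) = v by rewrite /lin reflK.
under eq_integral => w _ do rewrite reflE.
rewrite ge0_RZl//; last by have := Rintegrable_measurable ihv.
by rewrite (RintegralE ihv) EFinM.
Qed.

End laws.

(** * Entropy and information as functionals of the law *)

Section functionals.
Variables (R : realType) (d : nat).
Local Notation E := (Rd R d).
Local Notation L := (lam R d).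
Local Notation co x i := ((x : 'rV[R]_d) ord0 i).
Implicit Types (m : set 'rV[R]_d -> \bar R) (f : E -> R).

Lemma eq_density m1 m2 f : (forall A : set E, measurable A -> m1 A = m2 A) ->
  is_density m1 f <-> is_density m2 f.
Proof.
move=> m12; split=> -[mf [f0 h]]; split=> //; split=> // A mA.
  by rewrite -m12// h.
by rewrite m12// h.
Qed.

Lemma eq_relD m1 m2 : (forall A : set E, measurable A -> m1 A = m2 A) -> relD m1 = relD m2.
Proof.
move=> m12; rewrite /relD; congr ereal_inf; apply/seteqP; split => v [f [df ->]];
  by exists f; split => //; apply/(eq_density f m12).
Qed.

Lemma eq_fisherI m1 m2 : (forall A : set E, measurable A -> m1 A = m2 A) ->
  fisherI m1 = fisherI m2.
Proof.
move=> m12; rewrite /fisherI; congr ereal_inf; apply/seteqP; split => v [f [g [df h]]];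
  by exists f, g; split => //; apply/(eq_density f m12).
Qed.

Lemma density_integral1 m f : m setT = 1%E -> is_density m f ->
  (\int[L]_x (f x)%:E = 1)%E /\ L.-integrable setT (EFin \o f).
Proof.
move=> m1 [mf [f0 mE]].
have f1 : (\int[L]_x (f x)%:E = 1)%E.
  rewrite -m1 mE// iintE//; first by apply: eq_integral => x _; rewrite indicT mul1r.
    by apply/measurable_EFinP; apply: measurable_funM.
  by move=> x; rewrite lee_fin mulr_ge0.
by split=> //; apply: ge0_integrable => //; rewrite f1 ltry.
Qed.

(** Two densities of the same law agree almost everywhere, so the infimum is over a single value. *)
Lemma relDE m f : m setT = 1%E -> is_density m f ->
  L.-integrable setT (EFin \o (fun x => f x * ln (f x / phi (x : 'rV[R]_d)))) ->
  relD m = (entropy f)%:E.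
Proof.
move=> m1 df ien; have [f1 fi] := density_integral1 m1 df.
have [mf [f0 fE]] := df.
suff h f' : is_density m f' ->
    sint (fun x => (f' x * ln (f' x / phi x))%R) = (entropy f)%:E.
  apply/eqP; rewrite eq_le; apply/andP; split.
    by apply: ereal_inf_lbound; exists f; split => //; rewrite h.
  by apply: le_ereal_inf_tmp => _ [f' [df' ->]]; rewrite h.
move=> df'; have [f'1 f'i] := density_integral1 m1 df'; have [mf' [f'0 f'E]] := df'.
have iE (k : E -> R) (A : set E) : measurable A -> measurable_fun setT k -> (forall x, 0 <= k x) ->
    (\int[L]_(x in A) (k x)%:E = iint (fun x => (\1_A x * k x)%:E))%E.
  move=> mA mk k0; rewrite iintE.
  - rewrite integral_mkcond; apply: eq_integral => x _.
    by rewrite patchE indicE; case: (x \in A); rewrite ?mul1r ?mul0r.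
  - by apply/measurable_EFinP; apply: measurable_funM => //; exact: measurable_indic.
  - by move=> x; rewrite lee_fin mulr_ge0.
have ff' : {ae L, forall x, f x = f' x}.
  have := @integral_ae_eq _ E R L setT measurableT (EFin \o f') (EFin \o f) fi (measurable_int _ f'i).
  have hA (A : set E) : A `<=` setT -> measurable A ->
      (\int[L]_(x in A) (EFin \o f) x = \int[L]_(x in A) (EFin \o f') x)%E.
    by move=> _ mA; rewrite !iE// -fE// f'E.
  by move=> /(_ hA); apply: filterS => x /(_ Logic.I)[].
have men (k : E -> R) : measurable_fun setT k ->
    measurable_fun setT (fun x : E => k x * ln (k x / phi (x : 'rV[R]_d))).
  move=> mk; apply: measurable_funM => //; apply: measurableT_comp; first exact: measurable_ln.
  by apply: measurable_funM => //; apply: measurableT_comp; [exact: measurable_inv|exact: measurable_phi].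
rewrite sintE; last exact: men.
rewrite -(RintegralE ien); apply: ae_eq_integral => //.
- by apply/measurable_EFinP; exact: men.
- by apply/measurable_EFinP; exact: men.
- by apply: (ae_imp ff') => x ->.
Qed.

End functionals.

(** * From U_n and U_m to U_(n+m) *)

Section clt_step.
Variables (R : realType) (d : nat) (mu : probability (Rd R d) R).
Hypothesis cmu : centered mu.
Local Notation E := (Rd R d).
Local Notation L := (lam R d).
Local Notation U := (Ulaw mu).

Lemma pair_normal n f G : is_density (U n) f -> weak_grad f G -> (fisher_val f G < +oo)%E ->
  exists2 g, nice f g & fisher_val f G = (\sum_i fisher f g i)%:E.
Proof.
move=> df wg Foo.
have [g ng ->] := fisher_normal df wg (Ulaw_setT mu n)
  (fun i => (density_centered cmu i df).1) (fun i => (density_centered cmu i df).2) Foo.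
exists g => //; rewrite -sumEFin; apply: eq_bigr => i _.
by rewrite (RintegralE (fisher_dens_integrable ng i)).
Qed.

Lemma relD_pair n f G : is_density (U n) f -> weak_grad f G -> (fisher_val f G < +oo)%E ->
  relD (U n) = (entropy f)%:E.
Proof.
move=> df wg Foo; have [g ng _] := pair_normal df wg Foo.
by apply: relDE df _; [exact: Ulaw_setT|exact: entropy_integrable ng].
Qed.

Lemma fisher_val_ge0 (f : E -> R) (G : 'rV[R]_d -> 'rV[R]_d) : measurable_fun setT f -> (forall x, 0 <= f x) ->
  (forall i, measurable_fun [set: E] ((fun x => G x ord0 i) : E -> R)) -> (0 <= fisher_val f G)%E.
Proof.
move=> mf f0 mG; rewrite (fisher_valE (g := fun i (x : E) => G x ord0 i))//.
by apply: sume_ge0 => i _; apply: integral_ge0 => x _; rewrite lee_fin Ff_ge0.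
Qed.

Lemma fisherI_ge0 (m : set 'rV[R]_d -> \bar R) : (0 <= fisherI m)%E.
Proof.
apply: le_ereal_inf_tmp => _ [f [G [[mf [f0 _]] [[mG _] ->]]]].
exact: fisher_val_ge0.
Qed.

Lemma fisherI_pair (m : set 'rV[R]_d -> \bar R) (r e : R) : fisherI m = r%:E -> 0 < e ->
  exists f G, [/\ is_density m f, weak_grad f G & (fisher_val f G < (r + e)%:E)%E].
Proof.
move=> rE e0; have rfin : fisherI m \is a fin_num by rewrite rE.
have [_ [f [G [df [wg ->]]]]] := lb_ereal_inf_adherent e0 rfin.
by rewrite -/(fisherI m) rE -EFinD => h; exists f, G.
Qed.

Lemma clt_pair n m f1 G1 f2 G2 (v1 v2 : R) : (0 < n)%N -> (0 < m)%N ->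
  is_density (U n) f1 -> weak_grad f1 G1 -> fisher_val f1 G1 = v1%:E ->
  is_density (U m) f2 -> weak_grad f2 G2 -> fisher_val f2 G2 = v2%:E ->
  let t := n%:R / (n + m)%:R in
  (fisherI (U (n + m)) <= (t * v1 + (1 - t) * v2)%:E)%E /\
  exists2 e, relD (U (n + m)) = e%:E &
    entropy f1 + entropy f2 <= e + 2^-1 * ((1 - t) * v1 + t * v2).
Proof.
move=> n0 m0 df1 wg1 F1 df2 wg2 F2 t.
have [|g1 n1 S1] := pair_normal df1 wg1; first by rewrite F1 ltry.
have [|g2 n2 S2] := pair_normal df2 wg2; first by rewrite F2 ltry.
have {}S1 : v1 = \sum_i fisher f1 g1 i by apply: EFin_inj; rewrite -S1.
have {}S2 : v2 = \sum_i fisher f2 g2 i by apply: EFin_inj; rewrite -S2.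
set c := Num.sqrt n%:R / Num.sqrt (n + m)%:R : R.
set s := Num.sqrt m%:R / Num.sqrt (n + m)%:R : R.
have nm0 : (n + m)%:R != 0 :> R by rewrite pnatr_eq0 -lt0n addn_gt0 n0.
have c2 : c ^+ 2 = t by rewrite /c exprMn exprVn !sqr_sqrtr ?ler0n.
have s2 : s ^+ 2 = 1 - t.
  by rewrite /s exprMn exprVn !sqr_sqrtr ?ler0n// /t natrD; field; rewrite -natrD.
have cs1 : c ^+ 2 + s ^+ 2 = 1 by rewrite c2 s2 addrC subrK.
have sq_neq0 k : (0 < k)%N -> Num.sqrt k%:R != 0 :> R by move=> k0; rewrite gt_eqF// sqrtr_gt0 ltr0n.
have c0 : c != 0 by rewrite mulf_neq0 ?invr_eq0 ?sq_neq0// addn_gt0 n0.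
have s0 : s != 0 by rewrite mulf_neq0 ?invr_eq0 ?sq_neq0// addn_gt0 n0.
have dV : is_density (U (n + m)) (convdens f1 f2 c s).
  exact: (conv_density n0 m0 df1 df2 (nice_int n1) (nice_int n2)).
have wV := conv_weak_grad n1 n2 cs1 c0 s0.
have [ieV leV] := conv_entropy n1 n2 cs1 c0 s0.
split.
  apply: (@le_trans _ _ (fisher_val (convdens f1 f2 c s) (fun v => \row_i convgrad f1 f2 g1 g2 c s i v))).
    by apply: ereal_inf_lbound; exists (convdens f1 f2 c s), (fun v => \row_i convgrad f1 f2 g1 g2 c s i v).
  have [mV [V0 _]] := dV.
  rewrite (fisher_valE (g := convgrad f1 f2 g1 g2 c s))//.
  - rewrite S1 S2 !mulr_sumr -big_split -sumEFin; apply: lee_sum => i _ /=.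
    by rewrite -s2 -c2; exact: conv_fisher_le.
  - by move=> i; exact: Rintegrable_measurable (convgrad_int n1 n2 cs1 c0 i).
  - by move=> i x _; rewrite mxE.
exists (entropy (convdens f1 f2 c s)).
  by apply: relDE dV ieV; exact: Ulaw_setT.
apply: (le_trans leV); rewrite lerD2l S1 S2 !mulr_sumr -big_split mulr_sumr.
by apply: ler_sum => i _ /=; rewrite -s2 -c2.
Qed.

(** The near-minimising pairs vary with the error allowed; that their densities all have the same
    entropy [e] is what permits a passage to the limit. *)
Lemma finite_fisher n : (fisherI (U n) < +oo)%E ->
  exists r e, [/\ fisherI (U n) = r%:E, relD (U n) = e%:E &
    forall f G, is_density (U n) f -> weak_grad f G -> (fisher_val f G < +oo)%E -> entropy f = e].
Proof.
move=> Foo; have F0 := fisherI_ge0 (U n).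
have Ffin : fisherI (U n) \is a fin_num by rewrite ge0_fin_numE.
have rE : fisherI (U n) = (fine (fisherI (U n)))%:E by rewrite fineK.
have [f [G [df wg h]]] := fisherI_pair rE ltr01.
have hoo : (fisher_val f G < +oo)%E by apply: lt_trans h (ltry _).
have DE := relD_pair df wg hoo.
exists (fine (fisherI (U n))), (entropy f); split => // f' G' df' wg' hoo'.
by apply: EFin_inj; rewrite -DE -(relD_pair df' wg' hoo').
Qed.

Lemma clt_step n m : (0 < n)%N -> (0 < m)%N ->
  (fisherI (U n) < +oo)%E -> (fisherI (U m) < +oo)%E ->
  let t := n%:R / (n + m)%:R in
  exists r1 r2 r e1 e2 e : R,
  [/\ fisherI (U n) = r1%:E /\ relD (U n) = e1%:E,
      fisherI (U m) = r2%:E /\ relD (U m) = e2%:E,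
      fisherI (U (n + m)) = r%:E /\ relD (U (n + m)) = e%:E,
      r <= t * r1 + (1 - t) * r2 &
      e1 + e2 <= e + 2^-1 * ((1 - t) * r1 + t * r2)].
Proof.
move=> n0 m0 In Im t.
have [r1 [e1 [r1E e1E u1]]] := finite_fisher In.
have [r2 [e2 [r2E e2E u2]]] := finite_fisher Im.
have t01 : 0 <= t <= 1.
  rewrite divr_ge0 ?ler0n//= ler_pdivrMr ?mul1r ?ler_nat ?leq_addr//.
  by rewrite ltr0n addn_gt0 n0.
(* The infima in [fisherI] need not be attained: [clt_pair] is applied to pairs within [eps] of
   them. *)
have key (eps : R) : 0 < eps -> (fisherI (U (n + m)) <= (t * r1 + (1 - t) * r2 + eps)%:E)%E /\
    exists2 e, relD (U (n + m)) = e%:E & e1 + e2 <= e + 2^-1 * ((1 - t) * r1 + t * r2) + eps.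
  move=> eps0.
  have [f1 [G1 [df1 wg1 h1]]] := fisherI_pair r1E eps0.
  have [f2 [G2 [df2 wg2 h2]]] := fisherI_pair r2E eps0.
  have F1oo : (fisher_val f1 G1 < +oo)%E by apply: lt_trans h1 (ltry _).
  have F2oo : (fisher_val f2 G2 < +oo)%E by apply: lt_trans h2 (ltry _).
  have [mf1 [f10 _]] := df1; have [mf2 [f20 _]] := df2.
  have F1fin : fisher_val f1 G1 = (fine (fisher_val f1 G1))%:E.
    by rewrite fineK// ge0_fin_numE// fisher_val_ge0//; have [] := wg1.
  have F2fin : fisher_val f2 G2 = (fine (fisher_val f2 G2))%:E.
    by rewrite fineK// ge0_fin_numE// fisher_val_ge0//; have [] := wg2.
  set v1 := fine _ in F1fin; set v2 := fine _ in F2fin.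
  move: h1 h2; rewrite F1fin F2fin !lte_fin => h1 h2.
  have [leI [e eE leE]] := clt_pair n0 m0 df1 wg1 F1fin df2 wg2 F2fin.
  rewrite (u1 _ _ df1 wg1 F1oo) (u2 _ _ df2 wg2 F2oo) in leE.
  have /andP[t0 t1] := t01; have t1' : 0 <= 1 - t by rewrite subr_ge0.
  split.
    apply: (le_trans leI); rewrite lee_fin -/t.
    have := ler_wpM2l t0 (ltW h1); have := ler_wpM2l t1' (ltW h2); lra.
  exists e => //; apply: (le_trans leE); rewrite -/t.
  have := ler_wpM2l t1' (ltW h1); have := ler_wpM2l t0 (ltW h2); lra.
have Foo : (fisherI (U (n + m)) < +oo)%E by apply: le_lt_trans (key 1 ltr01).1 (ltry _).
have [r [e [rE eE _]]] := finite_fisher Foo.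
exists r1, r2, r, e1, e2, e; split => //.
  apply/ler_addgt0Pr => eps eps0; have [+ _] := key eps eps0.
  by rewrite rE lee_fin.
apply/ler_addgt0Pr => eps eps0; have [_ [e' e'E]] := key eps eps0.
by move: e'E; rewrite eE => -[->].
Qed.

End clt_step.

Unset Implicit Arguments.
Local Open Scope ereal_scope.

Theorem theorem4 (R : realType) (d : nat) (mu : probability (Rd R d) R) :
  centered mu ->
  (forall n m : nat, (0 < n)%N -> (0 < m)%N ->
     deltaLSI (Ulaw mu (n + m)) <= deltaLSI (Ulaw mu n) + deltaLSI (Ulaw mu m)) /\
  (forall n : nat, (0 < n)%N ->
     relD (Ulaw mu n) >= relD mu - (n.-1)%:R%:E * deltaLSI mu /\
     (2^-1)%:E * fisherI (Ulaw mu n) >=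
       (2^-1)%:E * fisherI mu - n%:R%:E * deltaLSI mu + deltaLSI (Ulaw mu n)).
Proof.
move=> cmu.
have I1 : fisherI mu = fisherI (Ulaw mu 1) by apply: eq_fisherI => A mA; rewrite Ulaw1.
have D1 : relD mu = relD (Ulaw mu 1) by apply: eq_relD => A mA; rewrite Ulaw1.
have dfin n (r e : R) : fisherI (Ulaw mu n) = r%:E -> relD (Ulaw mu n) = e%:E ->
    deltaLSI (Ulaw mu n) = (2^-1 * r - e)%:E.
  by move=> rE eE; rewrite /deltaLSI rE eE /= -EFinM -EFinB.
(* Since [+oo + -oo] is [-oo], this is needed for an infinite deficit on the right-hand side to
   dominate. *)
have dNy n : deltaLSI (Ulaw mu n) != -oo.
  have [Ioo|Ioo] := eqVneq (fisherI (Ulaw mu n)) +oo; first by rewrite /deltaLSI Ioo eqxx.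
  have [|r [e [rE eE _]]] := finite_fisher cmu (n := n); first by rewrite ltey.
  by rewrite (dfin _ _ _ rE eE).
split=> [n m n0 m0|n n0].
  have [Ioo|Ioo] := eqVneq (fisherI (Ulaw mu n)) +oo.
    by rewrite [deltaLSI (Ulaw mu n)]/deltaLSI Ioo eqxx addye ?leey.
  have [Joo|Joo] := eqVneq (fisherI (Ulaw mu m)) +oo.
    by rewrite [deltaLSI (Ulaw mu m)]/deltaLSI Joo eqxx addey ?leey.
  have [||r1 [r2 [r [e1 [e2 [e [[r1E e1E] [r2E e2E] [rE eE] h1 h2]]]]]]] := clt_step cmu n0 m0.
  - by rewrite ltey.
  - by rewrite ltey.
  rewrite (dfin _ _ _ r1E e1E) (dfin _ _ _ r2E e2E) (dfin _ _ _ rE eE) -EFinD lee_fin.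
  lra.
(* With an infinite deficit the lower bounds are [-oo], except for the entropy at [n = 1], where
   [0 * +oo = 0] and both sides are equal. *)
have [Ioo|Ioo] := eqVneq (fisherI mu) +oo.
  have doo : deltaLSI mu = +oo by rewrite /deltaLSI Ioo eqxx.
  rewrite doo; split.
    case: n n0 => [//|[|n]] _ /=; first by rewrite mul0e sube0 D1.
    by rewrite gt0_muley ?lte_fin ?ltr0n// addeNy leNye.
  by rewrite gt0_muley ?lte_fin ?ltr0n// addeNy addNye leNye.
have I1oo : fisherI (Ulaw mu 1) < +oo by rewrite -I1 ltey.
have [r1 [e1 [r1E e1E _]]] := finite_fisher cmu I1oo.
have d1 : deltaLSI mu = (2^-1 * r1 - e1)%:E by rewrite /deltaLSI I1 D1 r1E e1E /= -EFinM -EFinB.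
(* The bound [r <= r1] has to be carried along: the information of the current sum enters the
   entropy inequality with weight [1 - t], and replacing it by [r1] makes each step cost exactly one
   deficit. *)
have ind k : exists r e : R, [/\ fisherI (Ulaw mu k.+1) = r%:E, relD (Ulaw mu k.+1) = e%:E,
    (r <= r1)%R & (e1 - k%:R * (2^-1 * r1 - e1) <= e)%R].
  elim: k => [|k [r [e [rE eE rr1 ee1]]]].
    by exists r1, e1; split => //; rewrite mul0r subr0.
  have [||] := @clt_step R d mu cmu k.+1 1 isT isT; first by rewrite rE ltry.
    exact: I1oo.
  rewrite addn1 => r' [r2 [r3 [e' [e2 [e3 [[r'E e'E] [r2E e2E] [r3E e3E] h1 h2]]]]]].
  have er : r' = r by apply: EFin_inj; rewrite -r'E rE.
  have ee : e' = e by apply: EFin_inj; rewrite -e'E eE.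
  have er2 : r2 = r1 by apply: EFin_inj; rewrite -r2E r1E.
  have ee2 : e2 = e1 by apply: EFin_inj; rewrite -e2E e1E.
  rewrite er er2 in h1; rewrite ee ee2 er er2 in h2.
  exists r3, e3; set t : R := (_ / _)%R in h1 h2.
  have t01 : (0 <= t <= 1)%R.
    by rewrite /t divr_ge0 ?ler0n//= ler_pdivrMr ?ltr0n// mul1r ler_nat.
  have /andP[t0 t1] := t01; have t1' : (0 <= 1 - t)%R by rewrite subr_ge0.
  have k1 := ler_wpM2l t0 rr1; have k2 := ler_wpM2l t1' rr1.
  have kS : (k.+1%:R = k%:R + 1 :> R)%R by rewrite -natr1.
  split => //; first by lra.
  by rewrite kS mulrDl mul1r; lra.
have [k nk] : exists k, n = k.+1 by exists n.-1; rewrite prednK.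
have [r [e [rE eE rr1 ee1]]] := ind k; rewrite nk d1 (dfin _ _ _ rE eE) rE eE I1 D1 r1E e1E /=.
have kS : (k.+1%:R = k%:R + 1 :> R)%R by rewrite -natr1.
split; first by rewrite -EFinD lee_fin.
by rewrite -!EFinM -!EFinD lee_fin kS mulrDl mul1r; lra.
Qed.
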